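(* Let $\alpha>0$ and let $\theta\in\mathbb{H}$ with $|\theta|=1$. Then $\widetilde{\mathcal{L}_\theta^\alpha}=\mathcal{A}^{-1}\,\Gamma_\theta\,\mathcal{A}$ is a unitary transform from $L^{2,\alpha}_{\mathbb{H}}(\mathbb{R}^+)$ into $L^{2,\alpha}_{\mathbb{H}}(\mathbb{R}^+)$.
   Context: $\mathbb{H}$ denotes the quaternions, $\mathbb{B}=\{q\in\mathbb{H}:|q|<1\}$, $\mathbb{R}^+=(0,\infty)$. For $\alpha>0$, $L^{2,\alpha}_{\mathbb{H}}(\mathbb{R}^+)$ is the right quaternionic Hilbert space of functions $\varphi:\mathbb{R}^+\to\mathbb{H}$ square integrable with respect to the inner product $\langle\varphi,\psi\rangle_\alpha=\int_0^\infty\overline{\varphi(x)}\,\psi(x)\,x^\alpha e^{-x}\,dx$. The slice hyperholomorphic Bergman space of second kind is $$A^{2,\alpha}_{slice}(\mathbb{B})=\Big\{f(q)=\sum_{n=0}^\infty q^nc_n:\ c_n\in\mathbb{H},\ \sum_{n=0}^\infty\frac{n!}{\Gamma(\alpha+n+1)}|c_n|^2<\infty\Big\},$$ with inner product $\langle f,g\rangle=\int_{\mathbb{B}_I}\overline{f(z)}\,g(z)\,(1-|z|^2)^{\alpha-1}\,dx\,dy$, where $z=x+Iy$, $\mathbb{B}_I=\mathbb{B}\cap(\mathbb{R}+I\mathbb{R})$ and $I\in\mathbb{H}$ with $I^2=-1$ (the value does not depend on $I$). The second Bargmann transform $\mathcal{A}:L^{2,\alpha}_{\mathbb{H}}(\mathbb{R}^+)\to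 A^{2,\alpha}_{slice}(\mathbb{B})$, $$(\mathcal{A}\varphi)(q)=\frac{1}{\sqrt{\pi\Gamma(\alpha)}\,(1-q)^{\alpha+1}}\int_0^\infty\exp\Big(\frac{tq}{q-1}\Big)\varphi(t)\,t^\alpha e^{-t}\,dt,$$ is known to be a unitary isometry onto. For $\theta\in\mathbb{H}$ and $f(q)=\sum_n q^nc_n$, the action $\Gamma_\theta$ is $\Gamma_\theta f(q)=\sum_{n=0}^\infty q^n\theta^nc_n$. *)

(* Defs.v *)
From HB Require Import structures.
From mathcomp Require Import all_boot all_order all_algebra.
From mathcomp Require Import ring lra.
From mathcomp Require Import all_classical all_reals all_analysis.

Set Implicit Arguments.
Unset Strict Implicit.
Unset Printing Implicit Defensive.

Import Order.TTheory GRing.Theory Num.Theory.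
Import numFieldNormedType.Exports.

Local Open Scope classical_set_scope.
Local Open Scope ring_scope.

Record quat (R : Type) : Type := Quat { qre : R; qi : R; qj : R; qk : R }.

Definition quat_to_prod (R : Type) (q : quat R) : R * R * R * R :=
  (qre q, qi q, qj q, qk q).
Definition quat_of_prod (R : Type) (p : R * R * R * R) : quat R :=
  Quat p.1.1.1 p.1.1.2 p.1.2 p.2.
Lemma quat_to_prodK (R : Type) : cancel (@quat_to_prod R) (@quat_of_prod R).
Proof. by case. Qed.

HB.instance Definition _ (R : choiceType) :=
  Choice.copy (quat R) (can_type (@quat_to_prodK R)).

Section QuatAlgebra.
Variable R : realType.
Implicit Types p q r : quat R.

Definition qadd p q :=
  Quat (qre p + qre q) (qi p + qi q) (qj p + qj q) (qk p + qk q).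
Definition qopp p := Quat (- qre p) (- qi p) (- qj p) (- qk p).
Definition qmul p q := Quat
  (qre p * qre q - qi p * qi q - qj p * qj q - qk p * qk q)
  (qre p * qi q + qi p * qre q + qj p * qk q - qk p * qj q)
  (qre p * qj q - qi p * qk q + qj p * qre q + qk p * qi q)
  (qre p * qk q + qi p * qj q - qj p * qi q + qk p * qre q).
Definition qscale (a : R) p := Quat (a * qre p) (a * qi p) (a * qj p) (a * qk p).
Definition qconj p := Quat (qre p) (- qi p) (- qj p) (- qk p).
Definition qnormsq p : R := qre p ^+ 2 + qi p ^+ 2 + qj p ^+ 2 + qk p ^+ 2.
Definition qnorm p : R := Num.sqrt (qnormsq p).
(* qnormsq p = 0 only for p = 0, and then qinv p = 0. *)
Definition qinv p := qscale (qnormsq p)^-1 (qconj p).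

Let quatE p q : qre p = qre q -> qi p = qi q -> qj p = qj q -> qk p = qk q ->
  p = q.
Proof. by case: p => ? ? ? ?; case: q => ? ? ? ? /= -> -> -> ->. Qed.

Lemma qaddA : associative qadd.
Proof. by move=> p q r; apply: quatE => /=; rewrite addrA. Qed.
Lemma qaddC : commutative qadd.
Proof. by move=> p q; apply: quatE => /=; rewrite addrC. Qed.
Lemma qadd0 : left_id (Quat 0 0 0 0) qadd.
Proof. by move=> p; apply: quatE => /=; rewrite add0r. Qed.
Lemma qaddN : left_inverse (Quat 0 0 0 0) qopp qadd.
Proof. by move=> p; apply: quatE => /=; rewrite addNr. Qed.

HB.instance Definition _ :=
  GRing.isZmodule.Build (quat R) qaddA qaddC qadd0 qaddN.

Lemma qmulA : associative qmul.
Proof. by move=> p q r; apply: quatE => /=; ring. Qed.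
Lemma qmul1l : left_id (Quat 1 0 0 0) qmul.
Proof. by move=> p; apply: quatE => /=; ring. Qed.
Lemma qmul1r : right_id (Quat 1 0 0 0) qmul.
Proof. by move=> p; apply: quatE => /=; ring. Qed.
Lemma qmulDl : left_distributive qmul +%R.
Proof. by move=> p q r; apply: quatE => /=; ring. Qed.
Lemma qmulDr : right_distributive qmul +%R.
Proof. by move=> p q r; apply: quatE => /=; ring. Qed.
Lemma qone_neq0 : Quat 1 0 0 0 != 0 :> quat R.
Proof. by apply/eqP => -[] /eqP; rewrite oner_eq0. Qed.

HB.instance Definition _ := GRing.Zmodule_isNzRing.Build (quat R)
  qmulA qmul1l qmul1r qmulDl qmulDr qone_neq0.

Lemma qscaleA (a b : R) p : qscale a (qscale b p) = qscale (a * b) p.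
Proof. by apply: quatE => /=; rewrite mulrA. Qed.
Lemma qscale1 : left_id 1 qscale.
Proof. by move=> p; apply: quatE => /=; rewrite mul1r. Qed.
Lemma qscaleDr : right_distributive qscale +%R.
Proof. by move=> a p q; apply: quatE => /=; rewrite mulrDr. Qed.
Lemma qscaleDl p : {morph qscale^~ p : a b / a + b}.
Proof. by move=> a b; apply: quatE => /=; rewrite mulrDl. Qed.

HB.instance Definition _ := GRing.Zmodule_isLmodule.Build R (quat R)
  qscaleA qscale1 qscaleDr qscaleDl.

Lemma qscaleAl (a : R) p q : a *: (p * q) = (a *: p) * q.
Proof. by apply: quatE => /=; ring. Qed.
HB.instance Definition _ := GRing.Lmodule_isLalgebra.Build R (quat R) qscaleAl.
Lemma qscaleAr (a : R) p q : a *: (p * q) = p * (a *: q).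
Proof. by apply: quatE => /=; ring. Qed.
HB.instance Definition _ := GRing.Lalgebra_isAlgebra.Build R (quat R) qscaleAr.

Lemma qnormsq_ge0 p : 0 <= qnormsq p.
Proof. by rewrite /qnormsq !addr_ge0 ?sqr_ge0. Qed.
Lemma qnormsq_eq0 p : qnormsq p = 0 -> p = 0.
Proof.
move=> /eqP; rewrite /qnormsq !paddr_eq0 ?addr_ge0 ?sqr_ge0// !sqrf_eq0.
move=> /andP[/andP[/andP[/eqP a0 /eqP b0] /eqP c0] /eqP d0].
exact: quatE.
Qed.

Definition qunit : pred (quat R) := fun q => q != 0.
Lemma qmulVl : {in qunit, left_inverse 1 qinv *%R}.
Proof.
move=> q q0; have /eqP n0 : qnormsq q != 0.
  by apply: contraNN q0 => /eqP/qnormsq_eq0/eqP.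
by apply: quatE => /=; rewrite /qnormsq in n0 *; field; exact/eqP.
Qed.
Lemma qmulVr : {in qunit, right_inverse 1 qinv *%R}.
Proof.
move=> q q0; have /eqP n0 : qnormsq q != 0.
  by apply: contraNN q0 => /eqP/qnormsq_eq0/eqP.
by apply: quatE => /=; rewrite /qnormsq in n0 *; field; exact/eqP.
Qed.
Lemma qunitPl p q : q * p = 1 /\ p * q = 1 -> qunit p.
Proof.
move=> [qp _]; apply: contra_eq_neq qp => ->.
by rewrite mulr0 eq_sym oner_neq0.
Qed.
Lemma qinv_out : {in [predC qunit], qinv =1 id}.
Proof.
by move=> q; rewrite inE negbK => /eqP ->; apply: quatE; rewrite /= ?oppr0 mulr0.
Qed.
HB.instance Definition _ := GRing.NzRing_hasMulInverse.Build (quat R)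
  qmulVl qmulVr qunitPl qinv_out.

Lemma ler_qnormD p q : qnorm (p + q) <= qnorm p + qnorm q.
Proof.
have np := qnormsq_ge0 p; have nq := qnormsq_ge0 q.
rewrite /qnorm -[leRHS]ger0_norm ?addr_ge0 ?sqrtr_ge0// -sqrtr_sqr.
apply: ler_wsqrtr; rewrite sqrrD !sqr_sqrtr// -sqrtrM//.
set ip := qre p * qre q + qi p * qi q + qj p * qj q + qk p * qk q.
have -> : qnormsq (p + q) = qnormsq p + ip *+ 2 + qnormsq q.
  by rewrite /qnormsq /ip /=; ring.
rewrite lerD2r lerD2l lerMn2r /=; apply: (le_trans (ler_norm _)).
rewrite -sqrtr_sqr; apply: ler_wsqrtr; rewrite -subr_ge0.
have -> : qnormsq p * qnormsq q - ip ^+ 2 =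
    (qre p * qi q - qi p * qre q) ^+ 2 + (qre p * qj q - qj p * qre q) ^+ 2
  + (qre p * qk q - qk p * qre q) ^+ 2 + (qi p * qj q - qj p * qi q) ^+ 2
  + (qi p * qk q - qk p * qi q) ^+ 2 + (qj p * qk q - qk p * qj q) ^+ 2.
  by rewrite /qnormsq /ip; ring.
by rewrite !addr_ge0 ?sqr_ge0.
Qed.
Lemma qnormZ (a : R) p : qnorm (a *: p) = `|a| * qnorm p.
Proof.
rewrite /qnorm -sqrtr_sqr -sqrtrM ?sqr_ge0//; congr Num.sqrt.
by rewrite /qnormsq /=; ring.
Qed.
Lemma qnorm_eq0 p : qnorm p = 0 -> p = 0.
Proof.
move=> /eqP; rewrite sqrtr_eq0 => n0; apply/qnormsq_eq0/eqP.
by rewrite eq_le n0 qnormsq_ge0.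
Qed.

HB.instance Definition _ := Lmodule_isNormed.Build R (quat R)
  ler_qnormD qnormZ qnorm_eq0.

End QuatAlgebra.

Section Bargmann.
Variable R : realType.
Local Notation H := (quat R).
Local Notation mu := (@lebesgue_measure R).

Definition posline : set R := `]0, +oo[.
Definition qball : set H := [set q : H | `|q| < 1].

Definition gammaf (a : R) : R :=
  \int[mu]_(x in posline) (x `^ (a - 1) * expR (- x)).

Definition qmeasurable_fun (D : set R) (f : R -> H) : Prop :=
  [/\ measurable_fun D (@qre R \o f), measurable_fun D (@qi R \o f),
      measurable_fun D (@qj R \o f) & measurable_fun D (@qk R \o f)].

Definition qintegral (D : set R) (f : R -> H) : H :=
  Quat (\int[mu]_(x in D) qre (f x)) (\int[mu]_(x in D) qi (f x))
       (\int[mu]_(x in D) qj (f x)) (\int[mu]_(x in D) qk (f x)).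

Definition weight (alpha x : R) : R := x `^ alpha * expR (- x).

(* Elements of the L2 space are represented by functions on R of which only the
   values on ]0, +oo[ matter; L2_eq is the equality of the classes. *)
Definition L2 (alpha : R) : set (R -> H) := [set phi |
  qmeasurable_fun posline phi /\
  (\int[mu]_(x in posline) (`|phi x| ^+ 2 * weight alpha x)%:E < +oo)%E].

Definition L2_eq (phi psi : R -> H) : Prop :=
  {ae mu, forall x, posline x -> phi x = psi x}.

Definition L2_inner (alpha : R) (phi psi : R -> H) : H :=
  qintegral posline (fun x => weight alpha x *: (qconj (phi x) * psi x)).

Definition unitary (alpha : R) (T : (R -> H) -> (R -> H)) : Prop :=
  [/\ forall phi, L2 alpha phi -> L2 alpha (T phi),
      forall phi psi, L2 alpha phi -> L2 alpha psi ->
        L2_eq phi psi -> L2_eq (T phi) (T psi),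
      forall phi psi (a b : H), L2 alpha phi -> L2 alpha psi ->
        L2_eq (T (fun x => phi x * a + psi x * b))
              (fun x => T phi x * a + T psi x * b),
      forall phi psi, L2 alpha phi -> L2 alpha psi ->
        L2_inner alpha (T phi) (T psi) = L2_inner alpha phi psi
    & forall psi, L2 alpha psi -> exists2 phi, L2 alpha phi & L2_eq (T phi) psi].

Definition qpower_series (c : nat -> H) (q : H) : nat -> H :=
  series (fun n => q ^+ n * c n).

(* f is a function on H of which only the values on the unit ball matter. *)
Definition expansion (f : H -> H) (c : nat -> H) : Prop :=
  forall q, qball q -> qpower_series c q @ \oo --> f q.

Definition bergman (alpha : R) : set (H -> H) := [set f | exists2 c : nat -> H,
  cvgn (series (fun n => n`!%:R / gammaf (alpha + n%:R + 1) * `|c n| ^+ 2)) &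
  expansion f c].

Definition qexp (q : H) : H := limn (series (fun n => (n`!%:R^-1 : R) *: q ^+ n)).

Definition qim (q : H) : H := q - (qre q)%:A.

(* Principal logarithm: for q = x + I y with I^2 = -1 and y >= 0 it is
   ln |q| + I arg q, with arg q in [0, pi]; for real q > 0 the second term
   vanishes. *)
Definition qlog (q : H) : H :=
  (ln `|q|)%:A + (acos (qre q / `|q|) / `|qim q|) *: qim q.

Definition qpow (q : H) (b : R) : H := qexp (b *: qlog q).

Definition bargmann (alpha : R) (phi : R -> H) (q : H) : H :=
  (Num.sqrt (pi * gammaf alpha))^-1 *:
    ((qpow (1 - q) (alpha + 1))^-1 *
     qintegral posline
       (fun t => weight alpha t *: (qexp (t *: (q / (q - 1))) * phi t))).

(* The inverse of bargmann, from bergman alpha to L2 alpha; it selects a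
   representative of the preimage. The default value 0 is taken exactly when g
   is not in bergman alpha or has no preimage. *)
Definition bargmann_inv (alpha : R) (g : H -> H) : R -> H :=
  xget (fun=> 0) [set phi | [/\ bergman alpha g, L2 alpha phi &
    forall q, qball q -> bargmann alpha phi q = g q]].

(* The coefficients of f, which are unique when they exist. *)
Definition coefs (f : H -> H) : nat -> H := xget (fun=> 0) (expansion f).

Definition Gamma_act (theta : H) (f : H -> H) (q : H) : H :=
  limn (qpower_series (fun n => theta ^+ n * coefs f n) q).

Definition Ltheta (alpha : R) (theta : H) (phi : R -> H) : R -> H :=
  bargmann_inv alpha (Gamma_act theta (bargmann alpha phi)).

End Bargmann.

(* Main.v *)
Require Import Defs.
From mathcomp Require Import all_boot all_order all_algebra.
From mathcomp Require Import ring lra.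
From mathcomp Require Import all_classical all_reals all_analysis measurable_realfun.

(** Write L_n for the Laguerre polynomials of parameter alpha and
    c_n(phi) for the integral of L_n phi against the weight t^alpha e^(-t).

    The kernel (1 - q)^(-alpha - 1) exp(t q / (q - 1)) of the Bargmann transform
    A is the generating function of the L_n(t), so that
    (A phi)(q) = kappa (sum of the q^n c_n(phi)) with a real constant kappa
    ([bargmann_expansion]).  The L_n are orthogonal, with squared norms
    Gamma(alpha + n + 1) / n!, and complete; hence phi -> (c_n(phi)) is a
    bijection from L2 onto the sequences for which the sum of the
    n! / Gamma(alpha + n + 1) |c_n|^2 is finite ([qriesz_fischer],
    [qcoef_unique]), which are the coefficient sequences of the Bergman space,
    and it turns the inner product into the corresponding weighted sum
    ([qparseval]).  Conjugating Gamma_theta by A therefore gives the map that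
    multiplies c_n(phi) on the left by theta^n ([Ltheta_spec]).  As
    |theta^n| = 1, left multiplication by theta^n preserves conj(c) d, is
    invertible, and commutes with right multiplication: the diagonal map is
    unitary and right linear ([diagonal_unitary]).

    Three points need an argument.

    - The generating function.  A quaternion lies in a plane R + R J with
      J^2 = -1, where the kernel is a complex function of q = x + y J, so it is
      enough to work with real and imaginary parts.  For fixed t, both sides are
      solutions of (1 - w)^2 G' = ((alpha + 1) (1 - w) - t) G along the segment
      from 0 to q, and an equation G' = (a + i b) G is solved by a complex
      exponential of primitives of a and b ([polar_ode], [generating_function]).
      Following the argument along the segment also identifies the principal
      power of 1 - q.

    - Convergence.  The sum of the s^n |L_n(t)|, for s < 1, converges for almost
      every t, because the s^n ||L_n|| are summable; this avoids pointwise
      estimates of L_n, and the same sum dominates the series under the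
      integral sign ([laguerre_series_integral]).

    - Completeness.  If all the c_n(phi) vanish, so does the integral of phi
      against the kernel at the real point q = k / (k + 1), where
      q / (q - 1) = - k.  Thus the Laplace transform of t^alpha e^(-t) phi
      vanishes at all natural numbers, which forces phi = 0 almost everywhere
      ([laplace_unique], [lagfun_total]). *)

Set Implicit Arguments.
Unset Strict Implicit.
Unset Printing Implicit Defensive.

Import Order.TTheory GRing.Theory Num.Theory.
Import numFieldNormedType.Exports.

Local Open Scope classical_set_scope.
Local Open Scope ring_scope.

(** * Derivatives of real functions written as expressions *)

Section EtaDerivatives.
Variable R : realType.
Implicit Types (f g : R -> R) (x a b c : R).

Lemma der_cst x c : is_derive x 1 (fun=> c) (0 : R).
Proof. exact: is_derive_cst. Qed.

Lemma der_id x : is_derive x 1 (fun y : R => y) (1 : R).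
Proof. exact: is_derive_id. Qed.

Lemma der_eq f x a b : is_derive x 1 f a -> a = b -> is_derive x 1 f b.
Proof. by move=> + <-. Qed.

Lemma derD f g x a b : is_derive x 1 f a -> is_derive x 1 g b ->
  is_derive x 1 (fun y => f y + g y) (a + b).
Proof. exact: is_deriveD. Qed.

Lemma derB f g x a b : is_derive x 1 f a -> is_derive x 1 g b ->
  is_derive x 1 (fun y => f y - g y) (a - b).
Proof. exact: is_deriveB. Qed.

Lemma derN f x a : is_derive x 1 f a -> is_derive x 1 (fun y => - f y) (- a).
Proof. exact: is_deriveN. Qed.

Lemma derM f g x a b : is_derive x 1 f a -> is_derive x 1 g b ->
  is_derive x 1 (fun y => f y * g y) (f x * b + g x * a).
Proof. exact: is_deriveM. Qed.

Lemma derZ c f x a : is_derive x 1 f a -> is_derive x 1 (fun y => c * f y) (c * a).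
Proof. exact: is_deriveZ. Qed.

Lemma der_comp (h : R -> R) f x a b : is_derive (f x) 1 h b -> is_derive x 1 f a ->
  is_derive x 1 (fun y => h (f y)) (b * a).
Proof. exact: is_derive1_comp. Qed.

Lemma der_expR f x a : is_derive x 1 f a ->
  is_derive x 1 (fun y => expR (f y)) (a * expR (f x)).
Proof. by move=> df; rewrite mulrC; apply: der_comp. Qed.

Lemma der_cos f x a : is_derive x 1 f a ->
  is_derive x 1 (fun y => cos (f y)) (- a * sin (f x)).
Proof. by move=> df; rewrite mulrC mulrN -mulNr; apply: der_comp. Qed.

Lemma der_sin f x a : is_derive x 1 f a ->
  is_derive x 1 (fun y => sin (f y)) (a * cos (f x)).
Proof. by move=> df; rewrite mulrC; apply: der_comp. Qed.

Lemma der_atan f x a : is_derive x 1 f a ->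
  is_derive x 1 (fun y => atan (f y)) (a / (1 + f x ^+ 2)).
Proof. by move=> df; rewrite mulrC; apply: der_comp. Qed.

Lemma der_ln f x a : 0 < f x -> is_derive x 1 f a ->
  is_derive x 1 (fun y => ln (f y)) (a / f x).
Proof.
move=> f0 df; rewrite mulrC; apply: der_comp => //.
exact: is_derive1_ln.
Qed.

Lemma derV f x a : f x != 0 -> is_derive x 1 f a ->
  is_derive x 1 (fun y => (f y)^-1) (- a / f x ^+ 2).
Proof.
move=> fx0 df; have /(_ fx0 df) H := @is_deriveV R f x a 1.
by apply: (der_eq H); rewrite /GRing.scale/= mulNr [X in - X]mulrC -mulNr.
Qed.

Lemma der_continuous f x a : is_derive x 1 f a -> {for x, continuous f}.
Proof. by move=> [df _]; exact/differentiable_continuous/derivable1_diffP. Qed.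

End EtaDerivatives.

(** * Series with nonnegative terms *)

Section RealSeries.
Variable R : realType.

Lemma nnseries_bounded_cvg (u : nat -> R) (M : R) :
  (forall n, 0 <= u n) -> (forall n, series u n <= M) -> cvgn (series u).
Proof.
move=> u0 uM; apply: nondecreasing_is_cvgn.
  by apply: nondecreasing_series => n _ _; exact: u0.
by exists M => _ [n _ <-].
Qed.

Lemma nnseries_le_lim (u : nat -> R) n :
  (forall n, 0 <= u n) -> cvgn (series u) -> series u n <= limn (series u).
Proof.
move=> u0 cu; apply: nondecreasing_cvgn_le => //.
by apply: nondecreasing_series => k _ _; exact: u0.
Qed.

(** Monotone convergence and termwise integration speak of extended real sums,
    the power series of real ones; this lemma and the next one pass between the
    two. *)
Lemma nneseries_lty_cvg (u : nat -> R) : (forall n, 0 <= u n) ->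
  ((\sum_(n <oo) (u n)%:E) < +oo)%E -> cvgn (series u).
Proof.
move=> u0 uoo.
apply: (@nnseries_bounded_cvg u (fine (\sum_(n <oo) (u n)%:E)%E)) => // n.
rewrite -lee_fin fineK; last first.
  by rewrite ge0_fin_numE// nneseries_ge0// => k _ _; rewrite lee_fin.
rewrite /series /= -sumEFin.
apply: nneseries_lim_ge => k _ _; by rewrite lee_fin.
Qed.

Lemma cvg_nneseries_lty (u : nat -> R) : (forall n, 0 <= u n) ->
  cvgn (series u) -> ((\sum_(n <oo) (u n)%:E) < +oo)%E.
Proof.
move=> u0 cu; apply: (@le_lt_trans _ _ (limn (series u))%:E); last exact: ltry.
apply: lime_le; first by apply: is_cvg_nneseries => n _ _; rewrite lee_fin.
by apply: nearW => n; rewrite sumEFin lee_fin nnseries_le_lim.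
Qed.

End RealSeries.

(** * Real L2 spaces *)

Section L2space.
Context d (T : measurableType d) (R : realType).
Variables (mu : {measure set T -> \bar R}) (D : set T) (mD : measurable D).

Implicit Types f g h : T -> R.

Lemma ae_imp (P Q : T -> Prop) : (forall x, P x -> Q x) ->
  {ae mu, forall x, P x} -> {ae mu, forall x, Q x}.
Proof. by move=> PQ; apply: filterS. Qed.

Lemma ae_and (P Q : T -> Prop) : {ae mu, forall x, P x} -> {ae mu, forall x, Q x} ->
  {ae mu, forall x, P x /\ Q x}.
Proof. by move=> aP aQ; apply: filterI. Qed.

(** Integrability of a real function, so that sums, multiples and bounds can be
    stated without extended reals. *)
Definition intg (f : T -> R) := mu.-integrable D (EFin \o f).
Definition sqint (f : T -> R) := measurable_fun D f /\ intg (fun x => f x ^+ 2).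
Definition ip (f g : T -> R) : R := \int[mu]_(x in D) (f x * g x).

Lemma intgD f g : intg f -> intg g -> intg (fun x => f x + g x).
Proof. by move=> If Ig; exact: (integrableD mD If Ig). Qed.

Lemma intgZ a f : intg f -> intg (fun x => a * f x).
Proof. by move=> If; exact: (integrableZl mD a If). Qed.

Lemma intg_measurable f : intg f -> measurable_fun D f.
Proof. by move=> /measurable_int/measurable_EFinP. Qed.

Lemma intg_le f g : measurable_fun D f -> (forall x, D x -> `|f x| <= g x) ->
  intg g -> intg f.
Proof.
move=> mf fg; apply: le_integrable => //; first exact/measurable_EFinP.
by move=> x Dx; rewrite /= lee_fin (le_trans (fg x Dx))// ler_norm.
Qed.

Lemma intg_eq f g : (forall x, D x -> f x = g x) -> intg f -> intg g.
Proof.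
by move=> fg; apply: eq_integrable => // x /set_mem Dx; rewrite /= fg.
Qed.

Lemma intg_ge0P f : measurable_fun D f -> (forall x, D x -> 0 <= f x) ->
  (\int[mu]_(x in D) (f x)%:E < +oo)%E -> intg f.
Proof.
move=> mf f0 foo; apply/integrableP; split; first exact/measurable_EFinP.
rewrite (eq_integral (fun x => (f x)%:E))// => x /set_mem Dx.
by rewrite /= ger0_norm ?f0.
Qed.

Lemma intg_int f : intg f ->
  (\int[mu]_(x in D) (f x)%:E)%E = (\int[mu]_(x in D) f x)%:E.
Proof. by move=> If; rewrite /Rintegral fineK//; exact: integrable_fin_num. Qed.

Lemma sqintM f g : sqint f -> sqint g -> intg (fun x => f x * g x).
Proof.
move=> [mf If] [mg Ig]; apply: (@intg_le _ (fun x => f x ^+ 2 + g x ^+ 2)).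
- exact: measurable_funM.
- by move=> x _; rewrite ler_norml; apply/andP; split; nra.
- exact: intgD.
Qed.

Lemma sqintD f g : sqint f -> sqint g -> sqint (fun x => f x + g x).
Proof.
move=> sf sg; split; first by apply: measurable_funD; [case: sf|case: sg].
apply: (@intg_eq (fun x => (f x ^+ 2 + 2 * (f x * g x)) + g x ^+ 2)).
  by move=> x _; ring.
apply: intgD; last by case: sg.
by apply: intgD; [case: sf|exact/intgZ/sqintM].
Qed.

Lemma sqintZ a f : sqint f -> sqint (fun x => a * f x).
Proof.
move=> [mf If]; split; first exact: measurable_funM.
by apply: (intg_eq _ (intgZ (a ^+ 2) If)) => x _; ring.
Qed.

Lemma sqintB f g : sqint f -> sqint g -> sqint (fun x => f x - g x).
Proof.
move=> sf sg; have := sqintD sf (sqintZ (-1) sg).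
by congr sqint; apply/funext => x; rewrite mulN1r.
Qed.

Lemma sqint0 : sqint (fun=> 0).
Proof.
split; first exact: measurable_cst.
apply: (@intg_eq (fun=> 0)); first by move=> x _; rewrite expr0n.
exact: integrable0.
Qed.

Lemma sqint_sum (a : nat -> R) (e : nat -> T -> R) n : (forall k, sqint (e k)) ->
  sqint (fun x => \sum_(k < n) a k * e k x).
Proof.
move=> se; elim: n => [|n IH].
  by under eq_fun do rewrite big_ord0; exact: sqint0.
by under eq_fun do rewrite big_ord_recr/=; apply: sqintD => //; exact: sqintZ.
Qed.

Lemma dominated_Rintegral (F : nat -> T -> R) f (b : T -> R) :
  (forall n, measurable_fun D (F n)) -> measurable_fun D f ->
  {ae mu, forall x, D x -> F ^~ x @ \oo --> f x} ->
  intg b -> {ae mu, forall x, forall n, D x -> `|F n x| <= b x} ->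
  intg f /\ (fun n => \int[mu]_(x in D) F n x) @ \oo --> \int[mu]_(x in D) f x.
Proof.
move=> mF mf Ff Ib Fb.
have Ff' : {ae mu, forall x, D x -> (fun n => (F n x)%:E) @ \oo --> (f x)%:E}.
  apply: filterS Ff => x H Dx; apply: cvg_EFin; first exact: nearW.
  exact: H.
have Fb' : {ae mu, forall x, forall n, D x -> (`|(F n x)%:E| <= (b x)%:E)%E}.
  by apply: filterS Fb => x H n Dx; rewrite lee_fin; exact: H.
have [If _ H] := @dominated_convergence _ _ _ mu D mD (fun n => EFin \o F n) (EFin \o f)
  (EFin \o b) (fun n => (measurable_EFinP _ _).2 (mF n)) ((measurable_EFinP _ _).2 mf)
  Ff' Ib Fb'.
split=> //; apply: fine_cvg; rewrite fineK; last exact: integrable_fin_num.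
exact: H.
Qed.

Lemma ipC f g : ip f g = ip g f.
Proof. by apply: eq_Rintegral => x _; rewrite mulrC. Qed.

Lemma ip_sq f : ip f f = \int[mu]_(x in D) (f x ^+ 2).
Proof. by apply: eq_Rintegral => x _; rewrite expr2. Qed.

Lemma ip_ge0 f : 0 <= ip f f.
Proof. by apply: Rintegral_ge0 => x _; rewrite -expr2 sqr_ge0. Qed.

Lemma ipDl f g h : sqint f -> sqint g -> sqint h ->
  ip (fun x => f x + g x) h = ip f h + ip g h.
Proof.
move=> sf sg sh; rewrite /ip -RintegralD//; [|exact: sqintM..].
by apply: eq_Rintegral => x _; rewrite mulrDl.
Qed.

Lemma ipZl a f h : sqint f -> sqint h -> ip (fun x => a * f x) h = a * ip f h.
Proof.
move=> sf sh; rewrite /ip -RintegralZl//; last exact: sqintM.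
by apply: eq_Rintegral => x _; rewrite mulrA.
Qed.

Lemma ipBl f g h : sqint f -> sqint g -> sqint h ->
  ip (fun x => f x - g x) h = ip f h - ip g h.
Proof.
move=> sf sg sh; rewrite /ip -RintegralB//; [|exact: sqintM..].
by apply: eq_Rintegral => x _; rewrite mulrBl.
Qed.

Lemma ipBr f g h : sqint f -> sqint g -> sqint h ->
  ip h (fun x => f x - g x) = ip h f - ip h g.
Proof. by move=> sf sg sh; rewrite ipC ipBl// (ipC f) (ipC g). Qed.

Lemma ip_suml (a : nat -> R) (e : nat -> T -> R) n h :
  (forall k, sqint (e k)) -> sqint h ->
  ip (fun x => \sum_(k < n) a k * e k x) h = \sum_(k < n) a k * ip (e k) h.
Proof.
move=> se sh; elim: n => [|n IH].
  under eq_fun do rewrite big_ord0.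
  rewrite big_ord0 /ip; under eq_Rintegral do rewrite mul0r.
  by rewrite /Rintegral integral0.
under eq_fun do rewrite big_ord_recr/=.
by rewrite ipDl ?IH ?ipZl ?big_ord_recr//; [exact: sqint_sum|exact: sqintZ].
Qed.

(** The quadratic t -> ip (f - t g) (f - t g) is nonnegative; evaluate it at
    its minimum, or, if ip g g = 0, where it would be negative. *)
Lemma ip_cauchy_schwarz f g : sqint f -> sqint g ->
  ip f g ^+ 2 <= ip f f * ip g g.
Proof.
move=> sf sg.
have quad t : 0 <= ip f f - 2 * t * ip f g + t ^+ 2 * ip g g.
  have := ip_ge0 (fun x => f x - t * g x).
  have st := sqintZ t sg.
  rewrite ipBl//; [|exact: sqintB]; rewrite !ipBr// !ipZl//.
  rewrite (ipC f (fun x => t * g x)) (ipC g (fun x => t * g x)) !ipZl// (ipC g f).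
  lra.
have [g0|g0] := eqVneq (ip g g) 0.
  have [->|fg0] := eqVneq (ip f g) 0; first by rewrite expr0n mulr_ge0 ?ip_ge0.
  (* here the quadratic is affine, and this t gives it the value - 1 *)
  have := quad ((ip f f + 1) / (2 * ip f g)); rewrite g0 mulr0 addr0.
  have -> : 2 * ((ip f f + 1) / (2 * ip f g)) * ip f g = ip f f + 1.
    by field; rewrite fg0.
  lra.
have gp : 0 < ip g g by rewrite lt_def g0 ip_ge0.
have := quad (ip f g / ip g g).
have -> : ip f f - 2 * (ip f g / ip g g) * ip f g + (ip f g / ip g g) ^+ 2 * ip g g =
  (ip f f * ip g g - ip f g ^+ 2) / ip g g by field.
by rewrite pmulr_lge0 ?invr_gt0// subr_ge0.
Qed.

Lemma ip_aeL f f' g : measurable_fun D f -> measurable_fun D f' ->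
  measurable_fun D g -> {ae mu, forall x, D x -> f x = f' x} ->
  ip f g = ip f' g.
Proof.
move=> mf mf' mg ff'; rewrite /ip /Rintegral; congr fine.
apply: ae_eq_integral => //; [exact/measurable_EFinP/measurable_funM..|].
by apply: filterS ff' => x ff' Dx /=; rewrite ff'.
Qed.

Section orthonormal.
Variable e : nat -> T -> R.
Hypothesis se : forall n, sqint (e n).
Hypothesis oe : forall m n, ip (e m) (e n) = (m == n)%:R.

Definition psum (a : nat -> R) n (x : T) : R := \sum_(k < n) a k * e k x.
Implicit Types a : nat -> R.

Lemma sqint_psum a n : sqint (psum a n). Proof. exact: sqint_sum. Qed.

Lemma ip_psum_e a n m : ip (psum a n) (e m) = (m < n)%:R * a m.
Proof.
rewrite ip_suml//; under eq_bigr do rewrite oe.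
have [mn|nm] := ltnP m n.
  rewrite (bigD1 (Ordinal mn))//= eqxx mulr1 big1 ?addr0 ?mul1r// => i.
  by rewrite -val_eqE/= => /negPf ->; rewrite mulr0.
rewrite mul0r big1// => i _; rewrite (_ : (_ == _) = false) ?mulr0//.
by apply/negbTE; rewrite neq_ltn (leq_trans (ltn_ord i) nm).
Qed.

Lemma ip_psum2 a m n :
  ip (psum a m) (psum a n) = series (fun k => a k ^+ 2) (minn m n).
Proof.
rewrite ip_suml//; last exact: sqint_psum.
under eq_bigr do rewrite ipC ip_psum_e.
rewrite /series /= big_mkord -!(big_mkord xpredT (fun k => a k * ((k < n)%:R * a k))).
rewrite -(big_mkord xpredT (fun k => a k ^+ 2)).
rewrite (big_cat_nat _ (n := minn m n))//= ?geq_minl//.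
rewrite [X in _ + X]big_nat_cond [X in _ + X]big1 ?addr0; last first.
  move=> i /andP[/andP[+ im] _]; rewrite leqNgt ltn_min im/= => /negPf ->.
  by rewrite mul0r mulr0.
apply: eq_big_nat => i; rewrite ltn_min => /andP[_ /andP[_ ->]].
by rewrite mul1r expr2.
Qed.

(** Convergence of the series of the a k ^+ 2 thus becomes the Cauchy property
    of the partial sums in L2. *)
Lemma ip_psumB a m n (s := series (fun k => a k ^+ 2)) :
  ip (fun x => psum a m x - psum a n x) (fun x => psum a m x - psum a n x)
  = `|s m - s n|.
Proof.
have sm := sqint_psum a.
rewrite ipBl//; [|exact: sqintB]; rewrite !ipBr// !ip_psum2 !minnn (minnC n m) -/s.
have ns i j : (i <= j)%N -> s i <= s j.
  by move=> ij; apply: nondecreasing_series => // k _ _; exact: sqr_ge0.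
have [mn|/ltnW nm] := leqP m n.
  rewrite ler0_norm ?subr_le0 ?ns//; lra.
rewrite ger0_norm ?subr_ge0 ?ns//; lra.
Qed.

Lemma bessel f n : sqint f -> series (fun k => ip f (e k) ^+ 2) n <= ip f f.
Proof.
move=> sf; have sm := sqint_psum (fun k => ip f (e k)).
have := ip_ge0 (fun x => f x - psum (fun k => ip f (e k)) n x).
rewrite ipBl//; [|exact: sqintB]; rewrite !ipBr// ip_psum2 minnn (ipC f (psum _ _)).
rewrite ip_suml// /series /= big_mkord.
under eq_bigr do rewrite (ipC _ f) -expr2.
lra.
Qed.

Lemma is_cvg_bessel f : sqint f -> cvgn (series (fun k => ip f (e k) ^+ 2)).
Proof.
move=> sf; apply: (@nnseries_bounded_cvg _ _ (ip f f)) => n; first exact: sqr_ge0.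
exact: bessel.
Qed.

(** Completeness of L2, along the partial sums: a subsequence F with squared
    steps below 4^-k converges almost everywhere, because the sum over k of 2^k
    (F_{k+1} - F_k)^2 has finite integral and |u| <= 2^k u^2 + 2^-k bounds the
    steps themselves. Fatou then compares the limit f with every partial sum,
    not only with those of the subsequence. *)
Theorem riesz_fischer a (s := series (fun k => a k ^+ 2)) : cvgn s ->
  exists f, [/\ sqint f, forall n, ip f (e n) = a n
    & forall N, ip (fun x => f x - psum a N x) (fun x => f x - psum a N x)
                <= limn s - s N].
Proof.
move=> cs; set L := limn s.
have sL n : s n <= L by apply: nnseries_le_lim => // k; exact: sqr_ge0.
have /choice[n_ n_P] : forall k, exists n, L - s n <= 4^-1 ^+ k.
  move=> k; have k0 : 0 < 4^-1 ^+ k :> R by rewrite exprn_gt0// invr_gt0.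
  have [N _ /(_ N (leqnn _))/=] := (cvgrPdist_le _ _).1 cs _ k0.
  by rewrite -/L ger0_norm ?subr_ge0 ?sL//; exists N.
pose F k x := psum a (n_ k) x.
have sF k : sqint (F k) by exact: sqint_psum.
pose g k x : R := 2 ^+ k * (F k.+1 x - F k x) ^+ 2.
have g0 k x : 0 <= g k x by rewrite mulr_ge0 ?sqr_ge0// exprn_ge0.
have Ig k : intg (g k) by apply/intgZ; case: (sqintB (sF k.+1) (sF k)).
have mg k : measurable_fun D (fun x => (g k x)%:E).
  exact/measurable_EFinP/intg_measurable.
have Lg k : (\int[mu]_(x in D) (g k x)%:E <= (2^-1 ^+ k)%:E)%E.
  rewrite intg_int// lee_fin /g RintegralZl//; last first.
    by case: (sqintB (sF k.+1) (sF k)).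
  rewrite -(ip_sq (fun x => F k.+1 x - F k x)) ip_psumB.
  rewrite -/s (_ : 2^-1 ^+ k = 2 ^+ k * 4^-1 ^+ k); last first.
    by rewrite -exprMn; congr (_ ^+ _); field.
  rewrite ler_wpM2l ?exprn_ge0//.
  have h1 := n_P k; have h2 := n_P k.+1; have h3 := sL (n_ k); have h4 := sL (n_ k.+1).
  have h5 : 4^-1 ^+ k.+1 <= 4^-1 ^+ k :> R.
    by rewrite exprS ler_piMl ?exprn_ge0//; lra.
  by rewrite ler_norml; apply/andP; split; lra.
have half_series : cvgn (series (fun k => 2^-1 ^+ k : R)).
  have := @is_cvg_geometric_series _ 1 (2^-1 : R).
  rewrite (_ : geometric _ _ = (fun k => 2^-1 ^+ k)); last first.
    by apply/funext => k /=; rewrite mul1r.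
  apply; rewrite ger0_norm ?invr_ge0// invf_lt1//; lra.
have G_lty : (\int[mu]_(x in D) (\sum_(k <oo) (g k x)%:E) < +oo)%E.
  rewrite integral_nneseries//; last by move=> k x _; rewrite lee_fin.
  apply: (@le_lt_trans _ _ (\sum_(k <oo) (2^-1 ^+ k)%:E)%E).
    apply: lee_nneseries => [k _ _|k _ //].
    by apply: integral_ge0 => x _; rewrite lee_fin.
  apply: (@cvg_nneseries_lty _ (fun k => 2^-1 ^+ k)) => [k|].
    by rewrite exprn_ge0.
  exact: half_series.
have mG : measurable_fun D (fun x => \sum_(k <oo) (g k x)%:E)%E.
  by apply: ge0_emeasurable_sum => // k x _ _; rewrite lee_fin.
have IG : mu.-integrable D (fun x => \sum_(k <oo) (g k x)%:E)%E.
  apply/integrableP; split; first exact: mG.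
  rewrite (eq_integral (fun x => \sum_(k <oo) (g k x)%:E)%E)// => x _.
  by rewrite gee0_abs// nneseries_ge0// => k _ _; rewrite lee_fin.
(* the upper limit is measurable, and where F converges it is the limit *)
pose f x := fine (limn_esup (fun k => (F k x)%:E)).
have Ff : {ae mu, forall x, D x -> F ^~ x @ \oo --> f x}.
  apply: filterS (integrable_ae mD IG) => x /[apply] Gfin.
  have cg : cvgn (series (g ^~ x)).
    apply: nneseries_lty_cvg => [k|]; first exact: g0.
    move: Gfin; rewrite ge0_fin_numE//; apply: nneseries_ge0 => k _ _.
    by rewrite lee_fin.
  have cF : cvgn (F ^~ x).
    have cD : cvgn (series (telescope (F ^~ x))).
      apply: normed_cvg; rewrite /normed_series_of/=.
      apply: (@series_le_cvg _ _ (fun k => g k x + 2^-1 ^+ k)).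
      - by move=> k /=; exact: normr_ge0.
      - by move=> k; rewrite addr_ge0// exprn_ge0.
      - move=> k; rewrite /telescope/= /g.
        have h : 2 ^+ k * 2^-1 ^+ k = 1 :> R by rewrite -exprMn divff// expr1n.
        have h0 : 0 < 2 ^+ k :> R by rewrite exprn_gt0.
        have h1 : 0 < 2^-1 ^+ k :> R by rewrite exprn_gt0// invr_gt0.
        move: h h0 h1; move: (2 ^+ k) (2^-1 ^+ k) (F k.+1 x - F k x) => A B u h h0 h1.
        (* expanding this square gives |u| <= A u^2 + B, since A B = 1 *)
        have : 0 <= B * (A * `|u| - 1) ^+ 2 by rewrite mulr_ge0 ?sqr_ge0// ltW.
        have -> : B * (A * `|u| - 1) ^+ 2 = (A * B) * A * `|u| ^+ 2 - 2 * (A * B) * `|u| + B by ring.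
        rewrite h real_normK ?num_real// !mul1r.
        have : 0 <= `|u| by [].
        lra.
      - exact: (is_cvg_seriesD cg half_series).
    have -> : F ^~ x = (fun n => F 0%N x + series (telescope (F ^~ x)) n).
      by apply/funext => n; rewrite -(eq_sum_telescope (F ^~ x)).
    by apply: is_cvgD; [exact: is_cvg_cst|exact: cD].
  have : (fun k => (F k x)%:E) @ \oo --> (limn (F ^~ x))%:E.
    by apply: cvg_EFin; [exact: nearW|exact: cF].
  move=> /cvg_limn_einf_sup[_]; rewrite /f => -> //=.
have mF k : measurable_fun D (F k) by case: (sF k).
have mf : measurable_fun D f.
  apply: (@measurableT_comp _ _ _ _ _ _ fine) => //.
  by apply: measurable_fun_limn_esup => k; exact/measurable_EFinP.
have tail N : (\int[mu]_(x in D) ((f x - psum a N x) ^+ 2)%:E <= (L - s N)%:E)%E.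
  have mp : measurable_fun D (psum a N) by case: (sqint_psum a N).
  pose h k x := ((F k x - psum a N x) ^+ 2)%:E.
  have mh k : measurable_fun D (h k).
    by apply/measurable_EFinP; apply: measurable_funX; exact: measurable_funB.
  have h0 k x : D x -> (0 <= h k x)%E by move=> _; rewrite lee_fin sqr_ge0.
  apply: (@le_trans _ _ (\int[mu]_(x in D) limn_einf (h ^~ x))%E).
    apply: ae_ge0_le_integral => //.
    - by move=> x _; rewrite lee_fin sqr_ge0.
    - by apply/measurable_EFinP; apply: measurable_funX; exact: measurable_funB.
    - move=> x Dx; rewrite limn_einf_lim; apply: lime_ge; first exact: is_cvg_einfs.
      by apply: nearW => n; apply: le_ereal_inf_tmp => _ [m _ <-]; exact: h0.
    - apply: measurableT_comp => //; apply: measurable_fun_limn_esup => k.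
      exact: measurableT_comp.
    apply: filterS Ff => x /[apply] Fx.
    have : (h ^~ x) @ \oo --> ((f x - psum a N x) ^+ 2)%:E.
      apply: cvg_EFin; first exact: nearW.
      apply: (@cvgM _ _ _ _ (fun k => F k x - psum a N x) (fun k => F k x - psum a N x)).
        by apply: cvgB => //; exact: cvg_cst.
      by apply: cvgB => //; exact: cvg_cst.
    by move=> /cvg_limn_einf_sup[-> _].
  apply: (le_trans (fatou mu mD mh h0)).
  have : (fun k => \int[mu]_(x in D) h k x)%E @ \oo --> (L - s N)%:E.
    have -> : (fun k => \int[mu]_(x in D) h k x)%E = (fun k => (`|s (n_ k) - s N|)%:E).
      apply/funext => k; have sB := sqintB (sF k) (sqint_psum a N).
      rewrite /h intg_int; last by case: sB.
      by rewrite -(ip_sq (fun x => F k x - psum a N x)) ip_psumB.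
    apply: cvg_EFin; first exact: nearW.
    rewrite -(@ger0_norm _ (L - s N)) ?subr_ge0//.
    apply: cvg_norm; apply: cvgB; last exact: cvg_cst.
    have c4 : (fun k => L - 4^-1 ^+ k) @ \oo --> L.
      rewrite -[X in _ --> X]subr0; apply: cvgB; first exact: cvg_cst.
      apply: cvg_expr; rewrite ger0_norm ?invr_ge0// invf_lt1//; lra.
    apply: (@squeeze_cvgr _ _ _ _ (fun k => L - 4^-1 ^+ k) (cst L) (fun k => s (n_ k))) => //.
      by apply: nearW => k; rewrite sL andbT; have := n_P k; lra.
    exact: cvg_cst.
  by move=> /cvg_limn_einf_sup[-> _].
have sB N : sqint (fun x => f x - psum a N x).
  have mp : measurable_fun D (psum a N) by case: (sqint_psum a N).
  split; first exact: measurable_funB.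
  apply: intg_ge0P; first by apply: measurable_funX; exact: measurable_funB.
    by move=> x _; exact: sqr_ge0.
  by apply: (le_lt_trans (tail N)); exact: ltry.
have sf : sqint f.
  have := sqintD (sB 0%N) (sqint_psum a 0).
  by under eq_fun do rewrite subrK.
have tail' N : ip (fun x => f x - psum a N x) (fun x => f x - psum a N x) <= L - s N.
  rewrite ip_sq -lee_fin -intg_int; first exact: tail.
  by case: (sB N).
exists f; split => // n.
apply/eqP; rewrite -subr_eq0 -sqrf_eq0; apply/eqP/le_anti/andP; split; last exact: sqr_ge0.
have cL : (fun N => L - s N) @ \oo --> (0 : R).
  by rewrite -(subrr L); apply: cvgB => //; exact: cvg_cst.
rewrite -(cvg_lim _ cL)//; apply: limr_ge; first by apply/cvg_ex; exists 0.
exists n.+1 => // N /= nN.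
apply: le_trans (tail' N).
have -> : ip f (e n) - a n = ip (fun x => f x - psum a N x) (e n).
  by rewrite ipBl//; [rewrite ip_psum_e nN mul1r|exact: sqint_psum].
apply: (le_trans (ip_cauchy_schwarz (sB N) (se n))).
by rewrite oe eqxx mulr1.
Qed.

Definition total_family := forall f, sqint f -> (forall n, ip f (e n) = 0) ->
  {ae mu, forall x, D x -> f x = 0}.

(** The function that Riesz-Fischer builds from the coefficients of f has the
    same coefficients as f, so it equals f almost everywhere, and its error
    bound is one for f. *)
Lemma psum_cvg f a : total_family -> sqint f -> (forall n, ip f (e n) = a n) ->
  (fun N => ip (fun x => f x - psum a N x) (fun x => f x - psum a N x))
    @ \oo --> (0 : R).
Proof.
move=> tot sf fa.
have cs : cvgn (series (fun k => a k ^+ 2)).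
  rewrite (_ : (fun k => a k ^+ 2) = (fun k => ip f (e k) ^+ 2)).
    exact: is_cvg_bessel.
  by apply/funext => k; rewrite fa.
have [f' [sf' fa' tail]] := riesz_fischer cs.
have ff' : {ae mu, forall x, D x -> f x - f' x = 0}.
  by apply: tot => [|n]; [exact: sqintB|rewrite ipBl// fa fa' subrr].
apply: (@squeeze_cvgr _ _ _ _ (cst 0) (fun N => limn (series (fun k => a k ^+ 2))
  - series (fun k => a k ^+ 2) N)).
- apply: nearW => N; rewrite ip_ge0/= (le_trans _ (tail N))//.
  have sp := sqint_psum a N.
  have sB := sqintB sf sp; have sB' := sqintB sf' sp.
  have ae : {ae mu, forall x, D x -> f x - psum a N x = f' x - psum a N x}.
    by apply: filterS ff' => x /[apply] /eqP; rewrite subr_eq0 => /eqP ->.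
  have [mB mB'] : measurable_fun D (fun x => f x - psum a N x) /\
      measurable_fun D (fun x => f' x - psum a N x).
    by split; [case: sB|case: sB'].
  by rewrite (ip_aeL mB mB' mB ae) ipC (ip_aeL mB mB' mB' ae).
- exact: cvg_cst.
- rewrite -[X in _ --> X](subrr (limn (series (fun k => a k ^+ 2)))).
  by apply: cvgB => //; exact: cvg_cst.
Qed.

(** Cauchy-Schwarz bounds the error ip (f - psum) g by the L2 error of the
    partial sums of f. *)
Theorem parseval f g : total_family -> sqint f -> sqint g ->
  series (fun k => ip f (e k) * ip g (e k)) @ \oo --> ip f g.
Proof.
move=> tot sf sg; pose a n := ip f (e n).
have c0 := psum_cvg tot sf (fun n => erefl (a n)).
have -> : series (fun k => ip f (e k) * ip g (e k)) = (fun N => ip (psum a N) g).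
  apply/funext => N; rewrite ip_suml// /series/= big_mkord.
  by under [RHS]eq_bigr do rewrite ipC.
apply: cvg_zero.
have : (fun N => (ip f g - ip (psum a N) g) ^+ 2) @ \oo --> (0 : R).
  apply: (@squeeze_cvgr _ _ _ _ (cst 0) (fun N => ip (fun x => f x - psum a N x)
    (fun x => f x - psum a N x) * ip g g)).
  - apply: nearW => N; rewrite sqr_ge0/= -ipBl//; last exact: sqint_psum.
    by apply: ip_cauchy_schwarz => //; apply: sqintB => //; exact: sqint_psum.
  - exact: cvg_cst.
  - by rewrite -(mul0r (ip g g)); apply: cvgMr_tmp.
move=> /cvgrPdist_lt h; apply/cvgrPdist_lt => eps eps0.
have := h _ (exprn_gt0 2 eps0); apply: filterS => N.
rewrite !sub0r !normrN normrX ltr_pXn2r ?nnegrE ?normr_ge0 ?(ltW eps0)//= => hN.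
by rewrite distrC.
Qed.

End orthonormal.

End L2space.

(** * Improper integrals on the half-line and the Gamma function *)

Section Gamma.
Variable R : realType.
Local Notation mu := (@lebesgue_measure R).
Implicit Types (f g h F : R -> R) (x s : R).

Lemma measurable_posline : measurable (@posline R : set (measurableTypeR R)).
Proof. exact: measurable_itv. Qed.
#[local] Hint Resolve measurable_posline : core.

Lemma poslineE x : posline x = (0 < x) :> Prop.
Proof. by rewrite /posline/= in_itv/= andbT. Qed.

(** The derivative of F is a difference of nonnegative functions, so over the
    segments [1/(n+2), n+2] the fundamental theorem of calculus applies and
    monotone convergence passes to the limit in each of the two integrals
    separately; finiteness of the one of h then gives that of the one of g. *)
Lemma FTC_posline F g h (l : R) :
  (forall x, 0 < x -> is_derive x 1 F (g x - h x)) ->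
  (forall x, 0 < x -> {for x, continuous g}) ->
  (forall x, 0 < x -> {for x, continuous h}) ->
  (forall x, 0 < x -> 0 <= g x) -> (forall x, 0 < x -> 0 <= h x) ->
  (fun n => F n.+2%:R - F n.+2%:R^-1) @ \oo --> l ->
  (\int[mu]_(x in @posline R) (h x)%:E < +oo)%E ->
  (\int[mu]_(x in @posline R) (g x)%:E =
   \int[mu]_(x in @posline R) (h x)%:E + l%:E)%E.
Proof.
move=> dF cg ch g0 h0 Fl hoo.
pose A n := `[(n.+2%:R^-1 : R), n.+2%:R]%classic.
have a0 n : 0 < n.+2%:R^-1 :> R by rewrite invr_gt0 ltr0n.
have ab n : n.+2%:R^-1 < n.+2%:R :> R.
  by rewrite (@lt_trans _ _ 1)// ?invf_lt1 ?ltr1n ?ltr0n.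
have A0 n x : A n x -> 0 < x.
  by rewrite /A/= in_itv/= => /andP[+ _]; exact: lt_le_trans.
have mA n : measurable (A n) by exact: measurable_itv.
have ndA : nondecreasing_seq A.
  apply/nondecreasing_seqP => n; apply/subsetPset => x; rewrite /A/= !in_itv/=.
  move=> /andP[h1 h2]; rewrite (le_trans h2) ?ler_nat// andbT (le_trans _ h1)//.
  by rewrite lef_pV2 ?posrE ?ltr0n// ler_nat.
have UA : \bigcup_n A n = @posline R.
  apply/seteqP; split => [x [n _ /A0]|x]; rewrite poslineE// => x0.
  have [n nP] : exists n : nat, Num.max x x^-1 < n.+2%:R.
    exists (Num.bound (Num.max x x^-1)); have := archi_boundP (ltW (lt_le_trans x0 _ : 0 < Num.max x x^-1)).
    by move=> /(_ ltac:(by rewrite le_max lexx)) h1; apply: (lt_trans h1); rewrite ltr_nat.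
  exists n => //; rewrite /A/= in_itv/=; move: nP; rewrite gt_max => /andP[h1 h2].
  by rewrite (ltW h1) andbT -[x]invrK lef_pV2 ?posrE ?invr_gt0 ?ltr0n// ltW.
have cA f : (forall x, 0 < x -> {for x, continuous f}) -> forall n, {within A n, continuous f}.
  move=> cf n; apply: continuous_in_subspaceT => x /set_mem /A0 x0; exact: cf.
have IA f : (forall x, 0 < x -> {for x, continuous f}) -> forall n, mu.-integrable (A n) (EFin \o f).
  move=> cf n; apply: continuous_compact_integrable; [exact: segment_compact|exact: cA].
have step n : (\int[mu]_(x in A n) (g x)%:E =
    \int[mu]_(x in A n) (h x)%:E + (F n.+2%:R - F n.+2%:R^-1)%:E)%E.
  have -> : (\int[mu]_(x in A n) (g x)%:E =
      \int[mu]_(x in A n) (h x + (g x - h x))%:E)%E.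
    by apply: eq_integral => x _; rewrite addrC subrK.
  have cgh x : 0 < x -> {for x, continuous (fun x => g x - h x)}.
    by move=> x0; apply: cvgB; [exact: cg|exact: ch].
  under eq_integral do rewrite EFinD.
  rewrite integralD//; [|exact: mA|exact: (IA _ ch n)|exact: (IA _ cgh n)].
  congr (_ + _)%E; rewrite EFinB; apply: continuous_FTC2 => //.
  - exact: cA.
  - have dFx x : 0 < x -> derivable F x 1 by move=> /dF[].
    have cF x : 0 < x -> {for x, continuous F}.
      by move=> x0; apply/differentiable_continuous/derivable1_diffP/dFx.
    split.
    + by move=> x; rewrite in_itv/= => /andP[h1 _]; apply: dFx; exact: lt_trans h1.
    + by apply: cvg_at_right_filter; apply: cF.
    + by apply: cvg_at_left_filter; apply: cF; rewrite ltr0n.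
  - move=> x; rewrite in_itv/= => /andP[h1 _]; rewrite derive1E.
    by have [_ ->] := dF _ (lt_trans (a0 n) h1).
have lim f : (forall x, 0 < x -> {for x, continuous f}) -> (forall x, 0 < x -> 0 <= f x) ->
   (fun n => \int[mu]_(x in A n) (f x)%:E)%E @ \oo --> (\int[mu]_(x in @posline R) (f x)%:E)%E.
  move=> cf f0; rewrite -UA; apply: ge0_nondecreasing_set_cvg_integral => //.
  - by move=> n; apply: measurable_int; exact: (IA _ cf n).
  - by move=> n x /A0 x0; rewrite lee_fin f0.
have lg := lim g cg g0.
rewrite -(cvg_lim _ lg)//; apply/cvg_lim => //.
under eq_fun do rewrite step.
have hfin : (\int[mu]_(x in @posline R) (h x)%:E)%E \is a fin_num.
  by rewrite ge0_fin_numE// integral_ge0// => x; rewrite poslineE => x0; rewrite lee_fin h0.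
apply: cvgeD; [by rewrite fin_num_adde_defr|exact: lim|].
by apply: cvg_EFin; [exact: nearW|].
Qed.

Lemma cvg_invS2 : (fun n => n.+2%:R^-1 : R) @ \oo --> (0 : R).
Proof. by have := @cvg_harmonic R; rewrite -cvg_shiftS. Qed.

Lemma expRN_le_inv x : 0 < x -> expR (- x) <= x^-1.
Proof.
move=> x0; rewrite expRN lef_pV2 ?posrE ?expR_gt0//.
by apply: le_trans (expR_ge1Dx x); rewrite lerDr.
Qed.

Lemma cvg_powR_invS2 s : 0 < s -> (fun n => n.+2%:R^-1 `^ s : R) @ \oo --> (0 : R).
Proof.
move=> s0; have /cvg_at_rightP := powR_cvg0 s0.
by apply; split; [move=> n; rewrite invr_gt0|exact: cvg_invS2].
Qed.

Lemma der_expRN c x : is_derive x 1 (fun y : R => expR (- (c * y))) (- c * expR (- (c * x))).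
Proof.
have dg := derN (derZ c (der_id x)).
by apply: (der_eq (der_expR dg)); ring.
Qed.

Lemma expR_decay_lty c : 0 < c ->
  (\int[mu]_(x in @posline R) (c * expR (- (c * x)))%:E < +oo)%E.
Proof.
move=> c0; have dF x : is_derive x 1 (fun x : R => - expR (- (c * x)))
    (c * expR (- (c * x)) - 0).
  by apply: (der_eq (derN (der_expRN c x))); ring.
have dg x : is_derive x 1 (fun x : R => c * expR (- (c * x)))
    (c * (- c * expR (- (c * x)))).
  exact/derZ/der_expRN.
suff -> : (\int[mu]_(x in @posline R) (c * expR (- (c * x)))%:E =
    \int[mu]_(x in @posline R) ((fun=> 0) x : R)%:E + 1%:E)%E.
  by rewrite integral0 add0e ltry.
apply: (FTC_posline (fun x _ => dF x)).
- by move=> x _; apply: der_continuous (dg x).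
- by move=> x _; exact: cvg_cst.
- by move=> x _; rewrite mulr_ge0 ?expR_ge0// ltW.
- by [].
- rewrite -[X in _ --> X]add0r -[X in _ --> X + _]oppr0 -[X in _ --> _ + X]opprK.
  apply: cvgB; last first.
    apply: cvgN.
    rewrite -[X in _ --> X](@expR0 R) -[X in _ --> expR X]oppr0 -[X in _ --> expR (- X)](mulr0 c).
    apply: continuous_cvg; first exact: continuous_expR.
    by apply: cvgN; apply: cvgMl_tmp; exact: cvg_invS2.
  apply: cvgN; apply: (@squeeze_cvgr _ _ _ _ (cst 0) (fun n => c^-1 * n.+2%:R^-1)).
  + apply: nearW => n; rewrite expR_ge0/= -invfM; apply: expRN_le_inv.
    by rewrite mulr_gt0.
  + exact: cvg_cst.
  + by rewrite -[X in _ --> X](mulr0 c^-1); apply: cvgMl_tmp; exact: cvg_invS2.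
by rewrite integral0 ltry.
Qed.

Lemma measurable_powexp s c :
  measurable_fun (@posline R) (fun x : R => x `^ s * expR (- (c * x))).
Proof.
apply: measurable_funM; first exact: measurable_funS (measurable_powR s).
by apply: measurableT_comp => //; apply: measurableT_comp => //.
Qed.

(** Half of the exponential absorbs the power: with b = 2 s / c, ln (x / b) <=
    x / b gives s ln x <= s ln b + c x / 2. *)
Lemma powR_expR_le s c x : 0 < s -> 0 < c -> 0 < x ->
  x `^ s * expR (- (c * x)) <= expR (s * ln (2 * s / c)) * expR (- (c / 2 * x)).
Proof.
move=> s0 c0 x0; rewrite /powR gt_eqF// -!expRD ler_expR.
have b0 : 0 < 2 * s / c by rewrite divr_gt0// mulr_gt0.
have y0 : 0 < x / (2 * s / c) by rewrite divr_gt0.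
have -> : ln x = ln (x / (2 * s / c)) + ln (2 * s / c).
  by rewrite -lnM ?posrE// divfK// gt_eqF.
have h := ln_sublinear y0.
have : s * ln (x / (2 * s / c)) <= c / 2 * x.
  apply: (@le_trans _ _ (s * (x / (2 * s / c)))); first by rewrite ler_wpM2l// ltW.
  by rewrite le_eqVlt; apply/orP; left; apply/eqP; field; rewrite !gt_eqF.
by rewrite mulrDr; lra.
Qed.

Lemma powexp_lty s c : 0 < s -> 0 < c ->
  (\int[mu]_(x in @posline R) (x `^ s * expR (- (c * x)))%:E < +oo)%E.
Proof.
move=> s0 c0; set K := expR (s * ln (2 * s / c)).
have c20 : 0 < c / 2 by rewrite divr_gt0.
have me : measurable_fun (@posline R) (fun x : R => c / 2 * expR (- (c / 2 * x))).
  apply: measurable_funM => //; apply: measurableT_comp => //.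
  by apply: measurableT_comp => //; exact: measurable_funM.
apply: (@le_lt_trans _ _ (\int[mu]_(x in @posline R)
    ((K * (c / 2)^-1)%:E * (c / 2 * expR (- (c / 2 * x)))%:E))%E).
  apply: ge0_le_integral => //.
  - by move=> x _; rewrite lee_fin mulr_ge0 ?powR_ge0 ?expR_ge0.
  - by apply/measurable_EFinP; exact: measurable_powexp.
  - by apply: emeasurable_funM => //; exact/measurable_EFinP.
  - move=> x; rewrite poslineE => x0; rewrite -EFinM lee_fin mulrA divfK ?gt_eqF//.
    exact: powR_expR_le.
rewrite ge0_integralZl//; last 3 first.
- exact/measurable_EFinP.
- by move=> x _; rewrite lee_fin mulr_ge0 ?expR_ge0// ltW.
- by rewrite lee_fin mulr_ge0 ?expR_ge0// invr_ge0 ltW.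
by rewrite lte_mul_pinfty ?lee_fin ?mulr_ge0 ?expR_ge0 ?invr_ge0 ?(ltW c20)//; exact: expR_decay_lty.
Qed.

Definition gamma_int s : \bar R :=
  (\int[mu]_(x in @posline R) (x `^ (s - 1) * expR (- x))%:E)%E.

(** Integration by parts. On the left the integrand may be unbounded at 0, so
    that integral is an extended real here; [gamma_int_fin] deduces from this
    equality that it is finite. *)
Lemma gamma_int_rec s : 0 < s -> (s%:E * gamma_int s = gamma_int (s + 1))%E /\
  (gamma_int (s + 1) < +oo)%E.
Proof.
move=> s0; have Hoo : (gamma_int (s + 1) < +oo)%E.
  have := powexp_lty s0 ltr01; rewrite /gamma_int addrK.
  by under eq_integral do rewrite mul1r.
split=> //; rewrite /gamma_int addrK in Hoo *.
have dF x : 0 < x -> is_derive x 1 (fun x : R => x `^ s * expR (- x))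
    (s * (x `^ (s - 1) * expR (- x)) - x `^ s * expR (- x)).
  move=> x0; have dp := is_derive1_powR s x0.
  have := der_expRN 1 x; under eq_fun do rewrite mul1r; rewrite mul1r => de.
  by apply: (der_eq (derM dp de)); ring.
have dg r x : 0 < x -> {for x, continuous (fun x : R => x `^ r * expR (- x))}.
  move=> x0; have dp := is_derive1_powR r x0.
  have := der_expRN 1 x; under eq_fun do rewrite mul1r; rewrite mul1r => de.
  exact: der_continuous (derM dp de).
rewrite -ge0_integralZl//; last 3 first.
- by apply/measurable_EFinP; have := measurable_powexp (s - 1) 1; under eq_fun do rewrite mul1r.
- by move=> x _; rewrite lee_fin mulr_ge0 ?powR_ge0 ?expR_ge0.
- by rewrite lee_fin ltW.
under eq_integral do rewrite -EFinM.
rewrite -[RHS]adde0; apply: (FTC_posline dF) => //.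
- by move=> x x0; apply: cvgMl_tmp; exact: dg.
- by move=> x x0; exact: dg.
- by move=> x _; rewrite !mulr_ge0 ?powR_ge0 ?expR_ge0// ltW.
- by move=> x _; rewrite mulr_ge0 ?powR_ge0 ?expR_ge0.
rewrite -[X in _ --> X](subr0 0); apply: cvgB.
  apply: (@squeeze_cvgr _ _ _ _ (cst 0)
      (fun n => expR (s * ln (2 * s / 1)) * (2 * n.+2%:R^-1))).
  - apply: nearW => n; rewrite mulr_ge0 ?powR_ge0 ?expR_ge0//=.
    have n0 : 0 < n.+2%:R :> R by [].
    have := powR_expR_le s0 ltr01 n0; rewrite mul1r => /le_trans; apply.
    rewrite ler_wpM2l ?expR_ge0//; apply: (le_trans (expRN_le_inv _)).
      by rewrite !mulr_gt0.
    by rewrite invfM mul1r invrK.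
  - exact: cvg_cst.
  - have := cvgMl_tmp (a := expR (s * ln (2 * s / 1))) (cvgMl_tmp (a := 2) cvg_invS2).
    by rewrite !mulr0; apply.
apply: (@squeeze_cvgr _ _ _ _ (cst 0) (fun n => n.+2%:R^-1 `^ s)).
- apply: nearW => n; rewrite mulr_ge0 ?powR_ge0 ?expR_ge0//=.
  by rewrite ler_piMr ?powR_ge0// expR_le1 oppr_le0 invr_ge0.
- exact: cvg_cst.
- exact: cvg_powR_invS2.
Qed.

(** If the integral were 0, the integrand, which is positive, would vanish
    almost everywhere on ]0, 1]. *)
Lemma gamma_int_gt0 s : (0 < gamma_int s)%E.
Proof.
have g0 x : (0 <= (x `^ (s - 1) * expR (- x))%:E)%E.
  by rewrite lee_fin mulr_ge0 ?powR_ge0 ?expR_ge0.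
have mg : measurable_fun (@posline R) (fun x : R => (x `^ (s - 1) * expR (- x))%:E).
  by apply/measurable_EFinP; have := measurable_powexp (s - 1) 1; under eq_fun do rewrite mul1r.
rewrite lt0e integral_ge0 ?andbT//; apply/eqP => g_eq0.
have : ae_eq mu (@posline R) (fun x => (x `^ (s - 1) * expR (- x))%:E) (cst 0).
  apply/ae_eq_integral_abs => //; rewrite -[RHS]g_eq0.
  by apply: eq_integral => x _; rewrite gee0_abs.
move=> [N [mN N0 sub]].
have : (mu `](0:R)%R, 1%R] <= mu N)%E.
  apply: le_measure; rewrite ?inE//.
  move=> x; rewrite /= in_itv/= => /andP[x0 _]; apply: sub => /= h; move: h.
  rewrite poslineE => /(_ x0)/eqP; rewrite eqe mulf_eq0 gt_eqF ?powR_gt0//.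
  by rewrite gt_eqF ?expR_gt0.
by rewrite N0 lebesgue_measure_itv/= lte_fin ltr01 oppr0 adde0 lee_fin ler10.
Qed.

Lemma gamma_int_fin s : 0 < s -> gamma_int s = (gammaf s)%:E.
Proof.
move=> s0; rewrite /gammaf /Rintegral fineK// -/(gamma_int s).
rewrite ge0_fin_numE ?ltW ?gamma_int_gt0//.
have [h h2] := gamma_int_rec s0.
have := gamma_int_gt0 s; move: h h2; case: (gamma_int s) => [r _ _ _||]//.
  by rewrite ltry.
by rewrite mulry gtr0_sg// mul1e => <-.
Qed.

Lemma gammaf_gt0 s : 0 < s -> 0 < gammaf s :> R.
Proof. by move=> s0; rewrite -lte_fin -gamma_int_fin// gamma_int_gt0. Qed.

Lemma gammaf_rec s : 0 < s -> gammaf (s + 1) = s * gammaf s :> R.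
Proof.
move=> s0; have [h _] := gamma_int_rec s0.
apply: EFin_inj; rewrite -gamma_int_fin ?addr_gt0// -h gamma_int_fin//.
Qed.

End Gamma.

#[export] Hint Extern 0 (measurable _) => solve [exact: measurable_posline] : core.

(** * Functions determined by their Laplace transform at the natural numbers *)

Section Laplace.
Variable R : realType.
Local Notation mu := (@lebesgue_measure R).
Local Notation pos := (@posline R).
Implicit Types (f g h F : R -> R) (x s t : R).

Let mpos := @measurable_posline R.

Lemma norm_exp_series_le x n : `|series (exp_coeff x) n| <= expR `|x|.
Proof.
apply: (@le_trans _ _ (series (exp_coeff `|x|) n)).
  rewrite /series/=; apply: (le_trans (ler_norm_sum _ _ _)).
  by apply: ler_sum => i _; rewrite /exp_coeff/= normrM normfV normrX normr_nat.
rewrite /expR; apply: nnseries_le_lim; last exact: is_cvg_series_exp_coeff.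
by move=> k; exact: exp_coeff_ge0.
Qed.

Lemma cvg_expRn_0 (c : R) : 0 < c -> (fun n : nat => expR (- (n%:R * c))) @ \oo --> (0 : R).
Proof.
move=> c0; under eq_fun do rewrite -mulrN expRM_natl.
by apply: cvg_expr; rewrite ger0_norm ?expR_ge0// expR_lt1 oppr_lt0.
Qed.

(** Expand the outer exponential: each term is a multiple of the integral of
    e^(-nkt) g, hence 0, and exp (exp z) |g| dominates the partial sums. *)
Lemma laplace_exp_exp g (z : R) (n : nat) : intg mu pos g ->
  (forall k : nat, \int[mu]_(t in pos) (expR (- (k%:R * t)) * g t) = 0) ->
  \int[mu]_(t in pos) (expR (- (expR z * expR (- (n%:R * t)))) * g t) = 0.
Proof.
move=> Ig g0.
have mg := intg_measurable Ig.
pose u t := - (expR z * expR (- (n%:R * t))).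
have mu' : measurable_fun pos u.
  apply: measurableT_comp => //; apply: measurable_funM => //.
  by apply: measurableT_comp => //; apply: measurableT_comp => //; exact: measurable_funM.
have ub t : pos t -> `|u t| <= expR z.
  rewrite poslineE => t0; rewrite /u normrN ger0_norm ?mulr_ge0 ?expR_ge0//.
  by rewrite ler_piMr ?expR_ge0// expR_le1 oppr_le0 mulr_ge0// ltW.
pose F N t := series (exp_coeff (u t)) N * g t.
have mF N : measurable_fun pos (F N).
  apply: measurable_funM => //; rewrite /series/=.
  under eq_fun do rewrite big_mkord.
  apply: measurable_sum => i; rewrite /exp_coeff/=.
  by apply: measurable_funM => //; exact: measurable_funX.
have Ek (k : nat) : intg mu pos (fun t => expR (- (k%:R * t)) * g t).
  apply: (@intg_le _ _ _ mu pos mpos _ (fun t => `|g t|)).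
  - apply: measurable_funM => //; apply: measurableT_comp => //.
    by apply: measurableT_comp => //; exact: measurable_funM.
  - move=> t; rewrite poslineE => t0; rewrite normrM ger0_norm ?expR_ge0//.
    by rewrite ler_piMl// expR_le1 oppr_le0 mulr_ge0// ltW.
  - exact: integrable_norm.
have F0 N : \int[mu]_(t in pos) F N t = 0 /\ intg mu pos (F N).
  elim: N => [|N [IH IN]].
    rewrite /F /series/=; split.
      under eq_Rintegral do rewrite big_geq// mul0r.
      by rewrite /Rintegral integral0.
    by under eq_fun do rewrite big_geq// mul0r; exact: integrable0.
  have FS t : F N.+1 t = F N t + (- expR z) ^+ N / N`!%:R * (expR (- ((n * N)%:R * t)) * g t).
    rewrite /F /series/= big_nat_recr//= mulrDl; congr (_ + _).
    rewrite /exp_coeff/= /u -mulNr exprMn -expRM_natl mulrN mulrA -natrM mulnC.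
    by rewrite !mulrA; congr (_ * _); rewrite mulrAC.
  split.
    under eq_Rintegral do rewrite FS.
    rewrite RintegralD//; last exact: intgZ.
    rewrite IH add0r RintegralZl//; last exact: Ek.
    by apply/eqP; rewrite mulf_eq0; apply/orP; right; apply/eqP; exact: g0.
  by rewrite (funext FS); apply: intgD => //; exact: intgZ.
have [] := @dominated_Rintegral _ _ _ mu pos mpos F (fun t => expR (u t) * g t)
  (fun t => expR (expR z) * `|g t|).
- exact: mF.
- by apply: measurable_funM => //; exact: measurableT_comp.
- apply: aeW => t _; apply: cvgMr_tmp; exact: is_cvg_series_exp_coeff.
- by apply: intgZ => //; exact: integrable_norm.
- apply: aeW => t N pt; rewrite normrM ler_wpM2r//.
  apply: (le_trans (norm_exp_series_le _ _)); rewrite ler_expR; exact: ub.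
move=> _; under eq_fun do rewrite (F0 _).1.
by move=> /(cvg_lim (@Rhausdorff R)) <-; rewrite lim_cst.
Qed.

(** As n grows, exp (- exp (n (x - t))) tends to 1 for t > x and to 0 for t <
    x. *)
Lemma laplace_tail g (x : R) : intg mu pos g ->
  (forall k : nat, \int[mu]_(t in pos) (expR (- (k%:R * t)) * g t) = 0) ->
  \int[mu]_(t in pos) (((x < t)%R)%:R * g t) = 0.
Proof.
move=> Ig g0.
have mg := intg_measurable Ig.
pose h (n : nat) t := expR (- (expR (n%:R * x) * expR (- (n%:R * t)))).
have h1 n t : 0 <= h n t <= 1 by rewrite expR_ge0 expR_le1 oppr_le0 mulr_ge0 ?expR_ge0.
have mh n : measurable_fun pos (h n).
  do 2 (apply: measurableT_comp => //); apply: measurable_funM => //.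
  by do 2 (apply: measurableT_comp => //); exact: measurable_funM.
have mi : measurable_fun pos (fun t => ((x < t)%R)%:R * g t).
  apply: measurable_funM => //.
  have -> : (fun t : R => ((x < t)%R)%:R) = \1_(`]x, +oo[ : set R) :> (R -> R).
    by apply/funext => t; rewrite indicE mem_setE in_itv/= andbT.
  by apply: measurable_funTS; exact: measurable_indic.
have [] := @dominated_Rintegral _ _ _ mu pos mpos (fun n t => h n t * g t)
  (fun t => ((x < t)%R)%:R * g t) (fun t => `|g t|).
- by move=> n; apply: measurable_funM; [exact: mh|exact: mg].
- exact: mi.
- exists [set x]; split => //; first exact: lebesgue_measure_set1.
  move=> t; apply: contraPP => /eqP tx; apply; move=> _; apply: cvgMr_tmp.
  have hE n : h n t = expR (- expR (n%:R * (x - t))) by rewrite /h -expRD mulrBr.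
  under eq_fun do rewrite hE.
  move: tx; rewrite neq_lt => /orP[tx|xt].
    have d0 : 0 < x - t by rewrite subr_gt0.
    rewrite ltNge ltW//=.
    apply: (@squeeze_cvgr _ _ _ _ (cst 0) (fun n : nat => expR (- (n%:R * (x - t))))).
    - apply: nearW => n; rewrite expR_ge0/= [leRHS]expRN; apply: expRN_le_inv.
      exact: expR_gt0.
    - exact: cvg_cst.
    - exact: cvg_expRn_0.
  have d0 : 0 < t - x by rewrite subr_gt0.
  have E : (fun n : nat => - expR (n%:R * (x - t))) @ \oo --> (0 : R).
    have nE n : - expR (n%:R * (x - t)) = - expR (- (n%:R * (t - x))).
      by congr (- expR _); ring.
    by under eq_fun do rewrite nE; rewrite -oppr0; apply: cvgN; exact: cvg_expRn_0.
  rewrite xt -[true%:R]/(1 : R) -[X in nbhs X](@expR0 R).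
  apply: continuous_cvg; first exact: continuous_expR.
  exact: E.
- exact: integrable_norm.
- apply: aeW => t n _; rewrite normrM ler_piMl//.
  by have /andP[h0 h2] := h1 n t; rewrite ger0_norm.
move=> _; under eq_fun do rewrite laplace_exp_exp//.
by move=> /(cvg_lim (@Rhausdorff R)) <-; rewrite lim_cst.
Qed.

(** All the tails of the integral of g vanish, so its primitive is 0, and by
    Lebesgue differentiation so is g almost everywhere. *)
Theorem laplace_unique g : intg mu pos g ->
  (forall k : nat, \int[mu]_(t in pos) (expR (- (k%:R * t)) * g t) = 0) ->
  {ae mu, forall t, pos t -> g t = 0}.
Proof.
move=> Ig g0.
pose f := g \_ pos.
have locf : locally_integrable setT f by exact: integrable_locally.
have If y : mu.-integrable `]0, y] (EFin \o f).
  have : mu.-integrable setT (EFin \o f).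
    by rewrite -restrict_EFin; apply/(integrable_mkcond _ mpos).1.
  exact: integrableS.
have F0 y : \int[mu]_(t in `]0, y]) f t = 0.
  have [y0|y0] := leP y 0.
    by rewrite set_itv_ge ?Rintegral_set0// bnd_simp -leNgt.
  have If' : mu.-integrable `]0, +oo[ (EFin \o f).
    apply: (intg_eq mpos _ Ig) => t pt; by rewrite /f patchE mem_set.
  have := @Rintegral_itvB R f (BRight 0) +oo%O y If'.
  rewrite !bnd_simp => /(_ (ltW y0) isT) H.
  have tot : \int[mu]_(t in `]0, +oo[) f t = 0.
    rewrite -[RHS](g0 0%N); apply: eq_Rintegral => t pt.
    by rewrite mul0r oppr0 expR0 mul1r /f patchE pt.
  have tail : \int[mu]_(t in `]y, +oo[) f t = 0.
    rewrite -[RHS](laplace_tail y Ig g0).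
    rewrite (_ : `]y, +oo[%classic = pos `&` `]y, +oo[%classic).
      rewrite Rintegral_mkcondr; apply: eq_Rintegral => t pt.
      rewrite patchE mem_setE in_itv/= andbT; case: ifPn => _; rewrite ?mul1r ?mul0r//.
      by rewrite /f patchE pt.
    apply/seteqP; split => [t|t []//]; rewrite /= !in_itv/= !andbT => yt; split => //.
    by rewrite poslineE (lt_trans y0).
  by move: H; rewrite tot tail sub0r => /eqP; rewrite oppr_eq0 => /eqP.
have := @FTC1 R f (BRight 0) If locf.
apply: filterS; first exact: (ae_filter_ringOfSetsType mu).
move=> t H; rewrite poslineE => t0.
have [_] := H t0.
rewrite (_ : (fun x : R => _) = cst 0); last by apply/funext => y; exact: F0.
by rewrite derive1_cst /f patchE mem_set ?poslineE.
Qed.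

End Laplace.

(** * Laguerre polynomials and their orthogonality *)

Section Laguerre.
Variable R : realType.
Local Notation mu := (@lebesgue_measure R).
Local Notation pos := (@posline R).
Variables (al : R) (al0 : 0 < al).
Implicit Types (p q : {poly R}) (t : R).

Let mpos := @measurable_posline R.

(** The pair (L_n, L_{n+1}): the three-term recurrence needs the two previous
    polynomials. *)
Fixpoint laguerre_pair (n : nat) : {poly R} * {poly R} :=
  if n is m.+1 then
    let: (a, b) := laguerre_pair m in
    (b, (m.+2%:R^-1)%:P * (((2 * m.+1%:R + 1 + al)%:P - 'X) * b - (m.+1%:R + al)%:P * a))
  else (1, (1 + al)%:P - 'X).
Definition laguerre n := (laguerre_pair n).1.
Definition laguerre_pred n := if n is m.+1 then laguerre m else 0.

(** With L_{-1} = 0 the recurrence starts at n = 0, which keeps [wint_XLL] free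
    of cases. *)
Lemma laguerre_rec n : n.+1%:R%:P * laguerre n.+1 =
  ((2 * n%:R + 1 + al)%:P - 'X) * laguerre n - (n%:R + al)%:P * laguerre_pred n.
Proof.
case: n => [|n]; first by rewrite /laguerre/= !mulr0 subr0 add0r polyC1 mul1r mulr1.
rewrite /laguerre/laguerre_pred/laguerre/=.
case: (laguerre_pair n) => a b /=.
by rewrite mulrA -polyCM divff ?pnatr_eq0// mul1r.
Qed.

Lemma mul_polyC_natS_inj n p q : n.+1%:R%:P * p = n.+1%:R%:P * q -> p = q.
Proof. by move/mulfI; apply; rewrite polyC_eq0 pnatr_eq0. Qed.

(** Both identities are needed for either one in the induction: differentiating
    the recurrence leaves X L_{n+1}', which the second identity evaluates, and
    the first identity at n + 1 yields the second one. *)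
Lemma laguerre_deriv n :
  (laguerre n.+1)^`() = (laguerre n)^`() - laguerre n /\
  'X * (laguerre n.+1)^`() = n.+1%:R%:P * laguerre n.+1 - (n.+1%:R + al)%:P * laguerre n.
Proof.
elim: n => [|n [IH1 IH2]].
  have -> : (laguerre 1)^`() = - 1 by rewrite /laguerre/= derivB derivX derivC sub0r.
  have -> : (laguerre 0)^`() = 0 by rewrite /laguerre/= -polyC1 derivC.
  by rewrite /laguerre/=; split; rewrite ?polyC1; ring.
have H := laguerre_rec n.+1; rewrite /= in H.
have H1 : (laguerre n.+2)^`() = (laguerre n.+1)^`() - laguerre n.+1.
  apply: (@mul_polyC_natS_inj n.+1).
  have := congr1 (@deriv R) H.
  rewrite derivB !derivM derivB derivX !derivC !mul0r !add0r => ->.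
  have E : (laguerre n)^`() = (laguerre n.+1)^`() + laguerre n by rewrite IH1; ring.
  rewrite E.
  have -> : ((2 * n.+1%:R + 1 + al)%:P - 'X) * (laguerre n.+1)^`() =
     (2 * n.+1%:R + 1 + al)%:P * (laguerre n.+1)^`() - 'X * (laguerre n.+1)^`() by ring.
  rewrite IH2 -[n.+2%:R]natr1 !(polyCD, polyCM, polyC1); ring.
split=> //; rewrite H1 mulrBr IH2 H -[n.+2%:R]natr1 !(polyCD, polyCM, polyC1); ring.
Qed.

Lemma measurable_weight : measurable_fun pos (weight al).
Proof.
have := @measurable_powexp R al 1; rewrite /weight.
by under eq_fun do rewrite mul1r.
Qed.

Lemma weight_gt0 t : pos t -> 0 < weight al t.
Proof. by rewrite poslineE => t0; rewrite mulr_gt0 ?powR_gt0 ?expR_gt0. Qed.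

Lemma weight_moment t (k : nat) : pos t ->
  t ^+ k * weight al t = t `^ (al + k%:R + 1 - 1) * expR (- t).
Proof.
rewrite poslineE => t0; rewrite addrK powRD; last by rewrite (gt_eqF t0) implybT.
by rewrite powR_mulrn ?(ltW t0)// /weight; ring.
Qed.

Lemma alk_gt0 (k : nat) : 0 < al + k%:R. Proof. by rewrite ltr_wpDr. Qed.
Lemma alk1_gt0 (k : nat) : 0 < al + k%:R + 1.
Proof. by rewrite addr_gt0// alk_gt0. Qed.

Lemma intg_moment (k : nat) : intg mu pos (fun t => t ^+ k * weight al t).
Proof.
apply: intg_ge0P => //.
- by apply: measurable_funM; [exact: measurable_funX|exact: measurable_weight].
- move=> t pt; rewrite mulr_ge0 ?(ltW (weight_gt0 pt))// exprn_ge0//.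
  by move: pt; rewrite poslineE => /ltW.
have -> : (\int[mu]_(t in pos) (t ^+ k * weight al t)%:E =
    gamma_int (al + k%:R + 1))%E.
  by apply: eq_integral => t /set_mem pt; rewrite weight_moment.
by rewrite gamma_int_fin ?ltry// alk1_gt0.
Qed.

Lemma moment (k : nat) :
  \int[mu]_(t in pos) (t ^+ k * weight al t) = gammaf (al + k%:R + 1).
Proof.
by apply: eq_Rintegral => t /set_mem pt; rewrite weight_moment.
Qed.

Lemma intg_polyX p (k : nat) : intg mu pos (fun t => (p * 'X^k).[t] * weight al t).
Proof.
elim/poly_ind: p k => [|p c IH] k.
  apply: (intg_eq mpos _ (intgZ mpos 0 (intg_moment 0))) => t _.
  by rewrite !mul0r horner0 mul0r.
apply: (intg_eq mpos _ (intgD mpos (IH k.+1) (intgZ mpos c (intg_moment k)))) => t _.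
by rewrite !(hornerM, hornerD, hornerX, hornerC, hornerXn) exprS; ring.
Qed.

Definition wint p := \int[mu]_(t in pos) (p.[t] * weight al t).

Lemma intg_poly p : intg mu pos (fun t => p.[t] * weight al t).
Proof. by have := intg_polyX p 0; rewrite expr0 mulr1. Qed.

Lemma wintD p q : wint (p + q) = wint p + wint q.
Proof.
rewrite /wint -RintegralD//; [|exact: intg_poly..].
by apply: eq_Rintegral => t _; rewrite hornerD mulrDl.
Qed.

Lemma wintZ c p : wint (c%:P * p) = c * wint p.
Proof.
rewrite /wint -RintegralZl//; last exact: intg_poly.
by apply: eq_Rintegral => t _; rewrite hornerM hornerC -mulrA.
Qed.

Lemma wintB p q : wint (p - q) = wint p - wint q.
Proof. by rewrite -mulN1r -polyC1 -polyCN wintD wintZ mulN1r. Qed.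

Lemma wint0 : wint 0 = 0.
Proof. by have := wintB 0 0; rewrite !subrr. Qed.

Lemma wintXn (k : nat) : wint 'X^k = gammaf (al + k%:R + 1).
Proof. by rewrite -moment; apply: eq_Rintegral => t _; rewrite hornerXn. Qed.

(** The polynomial times the weight is the derivative of t^(alpha + 1) e^(-t)
    p(t), which vanishes at both ends. It is enough to treat monomials, and
    there the statement is the functional equation of the Gamma function. *)
Lemma wint_parts p : wint ('X * p^`() + ((al + 1)%:P - 'X) * p) = 0.
Proof.
(* the factor X^k makes the induction on p, which peels off constant terms, go
   through *)
suff H (k : nat) : wint ('X * (p * 'X^k)^`() + ((al + 1)%:P - 'X) * (p * 'X^k)) = 0.
  by have := H 0%N; rewrite expr0 mulr1.
elim/poly_ind: p k => [|p c IH] k.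
  rewrite mul0r -polyC0 derivC polyC0 !mulr0 addr0.
  exact: wint0.
have -> : (p * 'X + c%:P) * 'X^k = p * 'X^(k.+1) + c%:P * 'X^k by rewrite exprS; ring.
have E : 'X * ('X^(k.-1) *+ k) = k%:R%:P * 'X^k :> {poly R}.
  case: k {IH} => [|k]; first by rewrite mulr0n mulr0 mul0r.
  by rewrite exprS -mulr_natr polyC_natr/= mulrA mulrC.
set u := p * 'X^(k.+1).
have -> : 'X * (u + c%:P * 'X^k)^`() + ((al + 1)%:P - 'X) * (u + c%:P * 'X^k) =
   ('X * u^`() + ((al + 1)%:P - 'X) * u) +
   c%:P * ((k%:R + al + 1)%:P * 'X^k - 'X^(k.+1)).
  rewrite derivD derivM derivC mul0r add0r derivXn.
  have -> : 'X * (u^`() + c%:P * ('X^(k.-1) *+ k)) = 'X * u^`() + c%:P * (k%:R%:P * 'X^k).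
    by rewrite -E; ring.
  by rewrite !polyCD exprS; ring.
rewrite wintD IH add0r wintZ wintB wintZ !wintXn.
have -> : al + k.+1%:R + 1 = (al + k%:R + 1) + 1 by rewrite -natr1; ring.
by rewrite (@gammaf_rec _ (al + k%:R + 1)) ?alk1_gt0//; ring.
Qed.

Lemma laguerre_X n : 'X * laguerre n = (2 * n%:R + 1 + al)%:P * laguerre n
  - (n%:R + al)%:P * laguerre_pred n - n.+1%:R%:P * laguerre n.+1.
Proof. by rewrite laguerre_rec; ring. Qed.

(** Integration by parts applied to L_m, together with the recurrence, shows
    that (m + 1) times the integral of L_{m+1} equals m times that of L_m,
    which is 0 at m = 0. *)
Lemma wint_laguerre n : wint (laguerre n.+1) = 0.
Proof.
have step m : m.+1%:R * wint (laguerre m.+1) = m%:R * wint (laguerre m).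
  have := wint_parts (laguerre m); case: m => [|m].
    have -> : (laguerre 0)^`() = 0 by rewrite /laguerre/= -polyC1 derivC.
    by rewrite mulr0 add0r /laguerre/= mulr1 mul0r mul1r (addrC al).
  rewrite (laguerre_deriv m).2 mulrBl laguerre_X.
  rewrite (_ : _ + _ = m.+2%:R%:P * laguerre m.+2 - m.+1%:R%:P * laguerre m.+1).
    by rewrite wintB !wintZ => /eqP; rewrite subr_eq0 => /eqP.
  by rewrite /= -[m.+2%:R]natr1 -[m.+1%:R]natr1 !(polyCD, polyCM, polyC1); ring.
elim: n => [|n IH].
  by have := step 0%N; rewrite mul0r mul1r.
have := step n.+1; rewrite IH mulr0 => /eqP; rewrite mulf_eq0 pnatr_eq0/=.
by move/eqP.
Qed.

(** Multiplication by X is symmetric for the inner product; evaluating the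
    integral of X L_m L_n by the recurrence for L_m and by that for L_n relates
    neighbouring inner products. *)
Lemma wint_XLL m n : wint ('X * laguerre m * laguerre n) =
  (2 * m%:R + 1 + al) * wint (laguerre m * laguerre n)
  - (m%:R + al) * wint (laguerre_pred m * laguerre n)
  - m.+1%:R * wint (laguerre m.+1 * laguerre n).
Proof. by rewrite laguerre_X !mulrBl -!mulrA !wintB !wintZ. Qed.

(** Induction on m: in the two expressions of the integral of X L_m L_n all
    terms but the multiple of the integral of L_{m+1} L_n vanish. *)
Lemma wint_orth m n : (m < n)%N -> wint (laguerre m * laguerre n) = 0.
Proof.
(* the recurrence has order two, so the induction carries two consecutive
   indices *)
suff H : (forall n, (m < n)%N -> wint (laguerre m * laguerre n) = 0) /\
         (forall n, (m.+1 < n)%N -> wint (laguerre m.+1 * laguerre n) = 0).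
  exact: H.1.
have step k : (forall n, (k < n)%N -> wint (laguerre k * laguerre n) = 0) ->
    (forall n, (k < n)%N -> wint (laguerre_pred k * laguerre n) = 0) ->
    forall n, (k.+1 < n)%N -> wint (laguerre k.+1 * laguerre n) = 0.
  move=> H H' i ki.
  have h1 := wint_XLL k i; have h2 := wint_XLL i k.
  have e : 'X * laguerre i * laguerre k = 'X * laguerre k * laguerre i by ring.
  case: i ki h1 h2 e => // i; rewrite ltnS => ki h1 h2 e.
  have Hs j : (k < j)%N -> wint (laguerre j * laguerre k) = 0.
    by move=> kj; rewrite mulrC H.
  have ki1 : (k < i.+1)%N by exact: ltnW.
  have ki2 : (k < i.+2)%N by exact: ltnW.
  rewrite e h1 /= (H _ ki1) (H' _ ki1) (Hs _ ki1) (Hs _ ki) (Hs _ ki2) in h2.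
  move: h2; rewrite !mulr0 !subr0 sub0r => /eqP; rewrite oppr_eq0 mulf_eq0 pnatr_eq0/=.
  by move/eqP.
elim: m => [|m [IH1 IH2]].
  have H0 k : (0 < k)%N -> wint (laguerre 0 * laguerre k) = 0.
    by case: k => // k _; rewrite mul1r wint_laguerre.
  split=> //; apply: step => // k _; by rewrite mul0r wint0.
split=> //; apply: step => // k km; exact: IH1 (ltnW km).
Qed.

(** The two evaluations of the integral of X L_n L_{n+1} give (n + 1) <L_{n+1},
    L_{n+1}> = (n + 1 + alpha) <L_n, L_n>. *)
Lemma wint_sq n : wint (laguerre n * laguerre n) = gammaf (al + n%:R + 1) / n`!%:R.
Proof.
elim: n => [|n IH].
  by rewrite fact0 divr1 mulr1 -[laguerre 0]/('X^0) wintXn.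
have h1 := wint_XLL n n.+1; have h2 := wint_XLL n.+1 n.
have e : 'X * laguerre n.+1 * laguerre n = 'X * laguerre n * laguerre n.+1 by ring.
have p0 : wint (laguerre_pred n * laguerre n.+1) = 0.
  by case: n {IH h1 h2 e} => [|n]; [rewrite mul0r wint0|rewrite /= wint_orth].
have o1 : wint (laguerre n * laguerre n.+1) = 0 by rewrite wint_orth.
have o2 : wint (laguerre n.+1 * laguerre n) = 0 by rewrite mulrC.
have o3 : wint (laguerre n.+2 * laguerre n) = 0 by rewrite mulrC wint_orth.
rewrite e h1 /= o1 o2 o3 p0 IH !mulr0 !subr0 !sub0r in h2; move/oppr_inj : h2 => h2.
have -> : al + n.+1%:R + 1 = (al + n%:R + 1) + 1 by rewrite -natr1; ring.
rewrite gammaf_rec ?alk1_gt0// factS natrM.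
apply: (@mulfI _ n.+1%:R); first by rewrite pnatr_eq0.
rewrite h2 -[n.+1%:R]natr1; field.
rewrite pnatr_eq0 -lt0n fact_gt0/= natr1 pnatr_eq0//.
Qed.

End Laguerre.

(** * Series of Laguerre functions *)

Section RatioTest.
Variable R : realType.

Lemma ratio_test (u : nat -> R) (r : R) (N : nat) : (forall n, 0 <= u n) ->
  0 < r < 1 -> (forall n, (N <= n)%N -> u n.+1 <= r * u n) -> cvgn (series u).
Proof.
move=> u0 /andP[r0 r1] ur.
have uN k : u (N + k)%N <= u N * r ^+ k.
  elim: k => [|k IH]; first by rewrite addn0 expr0 mulr1.
  rewrite addnS; apply: (le_trans (ur _ (leq_addr _ _))).
  by rewrite exprS mulrCA ler_wpM2l// ltW.
have cg : cvgn (series (geometric (u N) r)).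
  by apply: is_cvg_geometric_series; rewrite gtr0_norm.
apply: (@nnseries_bounded_cvg _ _ (series u N + limn (series (geometric (u N) r)))) => // n.
have g0 k : 0 <= geometric (u N) r k by rewrite /= mulr_ge0// exprn_ge0// ltW.
have [nN|Nn] := leqP n N.
  apply: (@le_trans _ _ (series u N)).
    by apply: nondecreasing_series.
  by rewrite lerDl (le_trans _ (@nnseries_le_lim _ _ 0 g0 cg))// /series/= big_geq.
rewrite /series/= (big_cat_nat _ (n := N))//= ?(ltnW Nn)// lerD2l.
apply: (le_trans _ (@nnseries_le_lim _ _ (n - N) g0 cg)).
have -> : \sum_(N <= k < n) u k = \sum_(0 <= k < n - N) u (k + N)%N.
  by rewrite -{1}[N]add0n big_addn.
by rewrite /series/=; apply: ler_sum => i _; rewrite addnC; exact: uN.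
Qed.

End RatioTest.

Section LaguerreSystem.
Variable R : realType.
Local Notation mu := (@lebesgue_measure R).
Local Notation pos := (@posline R).
Variables (al : R) (al0 : 0 < al).
Implicit Types (p q : {poly R}) (t s : R) (f : R -> R).

Let mpos := @measurable_posline R.
Local Notation L := (laguerre al).

(** The L2 theory uses the Lebesgue measure: a function phi on the half-line is
    represented by phi times the square root of the weight. *)
Definition rootw t := Num.sqrt (weight al t).
(** The squared norm of L_n ([wint_sq]); its inverse is the weight in the
    Bergman space. *)
Definition lnorm (n : nat) : R := gammaf (al + n%:R + 1) / n`!%:R.

Lemma rootw_gt0 t : pos t -> 0 < rootw t.
Proof. by move=> pt; rewrite sqrtr_gt0 weight_gt0. Qed.

Lemma rootw_sq t : pos t -> rootw t ^+ 2 = weight al t.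
Proof. by move=> pt; rewrite sqr_sqrtr// ltW// weight_gt0. Qed.

Lemma measurable_rootw : measurable_fun pos rootw.
Proof.
have := measurable_weight al; rewrite /rootw => mw.
apply: (@measurableT_comp _ _ _ _ _ _ (@Num.sqrt R)) => //.
by apply: continuous_measurable_fun; exact: sqrt_continuous.
Qed.

Lemma measurable_rootwV : measurable_fun pos (fun t => (rootw t)^-1).
Proof.
apply: (@eq_measurable_fun _ _ _ _ _ (fun t => Num.sqrt (t `^ (- al) * expR t))).
  move=> t /set_mem pt; rewrite /rootw /weight.
  have t0 : 0 < t by move: pt; rewrite poslineE.
  have et : expR t = (expR (- t))^-1 by rewrite expRN invrK.
  by rewrite et powRN -invfM sqrtrV// mulr_ge0 ?powR_ge0 ?expR_ge0.
apply: (@measurableT_comp _ _ _ _ _ _ (@Num.sqrt R)) => //.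
  by apply: continuous_measurable_fun; exact: sqrt_continuous.
apply: measurable_funM; first exact: measurable_funS (measurable_powR (- al)).
exact: measurable_funS (@measurable_expR R).
Qed.

Lemma lnorm_gt0 n : 0 < lnorm n.
Proof. by rewrite divr_gt0 ?gammaf_gt0 ?alk1_gt0// ltr0n fact_gt0. Qed.

Lemma lnormS n : lnorm n.+1 = (1 + al / n.+1%:R) * lnorm n.
Proof.
rewrite /lnorm (_ : al + n.+1%:R + 1 = (al + n%:R + 1) + 1); last first.
  by rewrite -natr1; ring.
rewrite (@gammaf_rec _ (al + n%:R + 1)) ?alk1_gt0// factS natrM -natr1; field.
by rewrite natr1 !pnatr_eq0 -lt0n fact_gt0.
Qed.

Lemma sqint_poly p : sqint mu pos (fun t => p.[t] * rootw t).
Proof.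
split.
  apply: measurable_funM; last exact: measurable_rootw.
  by apply: measurable_funTS; apply: continuous_measurable_fun; exact: continuous_horner.
apply: (intg_eq mpos _ (intg_poly al0 (p * p))) => t pt.
by rewrite hornerM exprMn rootw_sq// expr2.
Qed.

Lemma ip_poly p q : ip mu pos (fun t => p.[t] * rootw t) (fun t => q.[t] * rootw t) =
  wint al (p * q).
Proof.
apply: eq_Rintegral => t /set_mem pt.
by rewrite hornerM -rootw_sq//; ring.
Qed.

Definition lagfun n t := (Num.sqrt (lnorm n))^-1 * ((L n).[t] * rootw t).

Lemma sqint_lagfun n : sqint mu pos (lagfun n).
Proof. by apply: sqintZ => //; exact: sqint_poly. Qed.

Lemma lagfun_orthonormal m n : ip mu pos (lagfun m) (lagfun n) = (m == n)%:R.
Proof.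
rewrite ipZl//; [|exact: sqint_poly|exact: sqint_lagfun].
rewrite ipC ipZl//; [|exact: sqint_poly..].
rewrite ip_poly; have [->|] := eqVneq m n.
  rewrite wint_sq// -/(lnorm n) mulrA -invfM -expr2 sqr_sqrtr ?mulVf//.
    by rewrite gt_eqF// lnorm_gt0.
  by rewrite ltW// lnorm_gt0.
rewrite neq_ltn => /orP[mn|nm]; last by rewrite wint_orth ?mulr0.
by rewrite (mulrC (L n)) wint_orth ?mulr0.
Qed.

(** The coefficient against L_n itself, not against its normalisation [lagfun]:
    these are the coefficients of the Bargmann transform. *)
Definition lagcoef n f := ip mu pos (fun t => (L n).[t] * rootw t) f.

Lemma lagcoefE n f : sqint mu pos f ->
  lagcoef n f = Num.sqrt (lnorm n) * ip mu pos f (lagfun n).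
Proof.
move=> sf; rewrite ipC /lagfun ipZl//; last exact: sqint_poly.
by rewrite mulrA divff ?mul1r// sqrtr_eq0 -ltNge lnorm_gt0.
Qed.

(** The ratio of consecutive terms tends to s. *)
Lemma lnorm_geometric s : 0 <= s < 1 -> cvgn (series (fun n => s ^+ n * lnorm n)).
Proof.
move=> /andP[s0 s1].
(* from the index N on, alpha / (n + 1) <= r - s, and the ratio is at most r *)
pose r := (1 + s) / 2.
have r1 : 0 < r < 1 by rewrite /r; apply/andP; split; lra.
have sr : 0 < r - s by rewrite /r; lra.
pose N := Num.bound (al / (r - s)).
have aN : al / (r - s) < N%:R by apply: archi_boundP; rewrite divr_ge0// ltW.
apply: (@ratio_test _ _ r N) => //.
  by move=> n; rewrite mulr_ge0 ?exprn_ge0// ltW// lnorm_gt0.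
move=> n Nn; rewrite lnormS exprS.
have n0 : 0 < n.+1%:R :> R by [].
have h : al / n.+1%:R <= r - s.
  rewrite ler_pdivrMr// mulrC -ler_pdivrMr// ltW// (lt_le_trans aN)// ler_nat.
  exact: leqW.
have : s * (1 + al / n.+1%:R) <= r.
  have x0 : 0 <= al / n.+1%:R by rewrite divr_ge0// ltW.
  move: (al / n.+1%:R) x0 h => x x0 h.
  by have := ler_piMl x0 (ltW s1); lra.
move=> sr'; have h0 : 0 <= s ^+ n * lnorm n.
  by rewrite mulr_ge0 ?exprn_ge0// ltW// lnorm_gt0.
have := ler_wpM2r h0 sr'; apply: le_trans.
by rewrite le_eqVlt; apply/orP; left; apply/eqP; ring.
Qed.

(** Integrate termwise and use 2 |a b| <= a^2 + b^2: the n-th integral is at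
    most s^n (||L_n||^2 + ||f||^2), and these are summable. *)
Lemma abs_series_intg f s : sqint mu pos f -> 0 <= s < 1 ->
  mu.-integrable pos (fun t => \sum_(n <oo) (s ^+ n * `|(L n).[t] * rootw t * f t|)%:E)%E.
Proof.
move=> sf s01; have /andP[s0 s1] := s01.
pose g n t := s ^+ n * `|(L n).[t] * rootw t * f t|.
have g0 n t : 0 <= g n t by rewrite mulr_ge0// exprn_ge0.
have Ip n : intg mu pos (fun t => `|(L n).[t] * rootw t * f t|).
  by apply: integrable_norm; apply: sqintM => //; exact: sqint_poly.
have Ig n : intg mu pos (g n) by apply: intgZ.
have mg n : measurable_fun pos (fun t => (g n t)%:E).
  by apply/measurable_EFinP; exact: intg_measurable (Ig n).
have mG : measurable_fun pos (fun t => \sum_(n <oo) (g n t)%:E)%E.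
  by apply: ge0_emeasurable_sum => // n t _ _; rewrite lee_fin.
apply/integrableP; split; first exact: mG.
apply: (@le_lt_trans _ _ (\int[mu]_(t in pos) \sum_(n <oo) (g n t)%:E)%E).
  rewrite le_eqVlt; apply/orP; left; apply/eqP; apply: eq_integral => t _.
  by rewrite gee0_abs// nneseries_ge0// => n _ _; rewrite lee_fin; exact: g0.
rewrite integral_nneseries//; last by move=> n t _; rewrite lee_fin.
pose c n := s ^+ n * lnorm n + ip mu pos f f * s ^+ n.
have c0 n : 0 <= c n.
  rewrite addr_ge0// mulr_ge0 ?exprn_ge0 ?ip_ge0//.
  exact/ltW/lnorm_gt0.
apply: (@le_lt_trans _ _ (\sum_(n <oo) (c n)%:E)%E).
  apply: lee_nneseries => [n _ _|n _].
    by apply: integral_ge0 => t _; rewrite lee_fin.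
  rewrite intg_int// lee_fin /g RintegralZl//; last exact: Ip.
  rewrite /c (mulrC (ip _ _ _ _)) -mulrDr ler_wpM2l ?exprn_ge0//.
  have <- : wint al (L n * L n) = lnorm n by exact: wint_sq.
  rewrite -ip_poly !ip_sq -RintegralD//; [|by case: (sqint_poly (L n))|by case: sf].
  apply: le_Rintegral => //; [exact: Ip| |].
    by apply: intgD => //; [case: (sqint_poly (L n))|case: sf].
  by move=> t _; rewrite ler_norml; apply/andP; split; nra.
apply: cvg_nneseries_lty => //.
apply: is_cvg_seriesD; first exact: lnorm_geometric.
have := @is_cvg_geometric_series _ (ip mu pos f f) s.
by apply; rewrite ger0_norm.
Qed.

Lemma abs_series_ae f s : sqint mu pos f -> 0 <= s < 1 ->
  {ae mu, forall t, pos t ->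
    cvgn (series (fun n => s ^+ n * `|(L n).[t] * rootw t * f t|))}.
Proof.
move=> sf s01; have /andP[s0 s1] := s01.
apply: (ae_imp _ (integrable_ae mpos (abs_series_intg sf s01))) => t /[apply] H.
have g0 n : 0 <= s ^+ n * `|(L n).[t] * rootw t * f t| by rewrite mulr_ge0// exprn_ge0.
apply: nneseries_lty_cvg => //; rewrite -ge0_fin_numE//.
by apply: nneseries_ge0 => n _ _; rewrite lee_fin.
Qed.

(** Take for f the square root of the weight in [abs_series_intg]; a function
    with finite integral is finite almost everywhere. *)
Lemma laguerre_abs_cvg s : 0 <= s < 1 ->
  {ae mu, forall t, pos t -> cvgn (series (fun n => s ^+ n * `|(L n).[t]|))}.
Proof.
move=> s01.
apply: (ae_imp _ (abs_series_ae (sqint_poly 1) s01)) => t H pt; have {H} := H pt.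
have w0 : 0 < rootw t ^+ 2 by rewrite exprn_gt0// rootw_gt0.
move=> /(@is_cvg_seriesZ _ _ (rootw t ^+ 2)^-1).
set u := _ *: _; have -> : u = (fun n => s ^+ n * `|(L n).[t]|); last by [].
apply/funext => n; rewrite /u !fctE hornerC mul1r -mulrA normrM -expr2 (gtr0_norm w0).
by rewrite /GRing.scale/=; field; rewrite gt_eqF// rootw_gt0.
Qed.

(** Dominated convergence, the sum in [abs_series_intg] being the bound. *)
Lemma laguerre_series_integral f (z : nat -> R) (U : R -> R) s : sqint mu pos f -> 0 <= s < 1 ->
  (forall n, `|z n| <= s ^+ n) -> measurable_fun pos U ->
  {ae mu, forall t, pos t -> series (fun n => z n * (L n).[t]) @ \oo --> U t} ->
  intg mu pos (fun t => U t * (rootw t * f t)) /\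
  series (fun n => z n * lagcoef n f) @ \oo -->
    \int[mu]_(t in pos) (U t * (rootw t * f t)).
Proof.
move=> sf s01 zs mU zU; have /andP[s0 s1] := s01.
have mf : measurable_fun pos f by case: sf.
pose F N t := series (fun n => z n * (L n).[t]) N * (rootw t * f t).
pose b t := fine (\sum_(n <oo) (s ^+ n * `|(L n).[t] * rootw t * f t|)%:E)%E.
have g0 n t : 0 <= s ^+ n * `|(L n).[t] * rootw t * f t| by rewrite mulr_ge0// exprn_ge0.
have IG := abs_series_intg sf s01.
have mrf : measurable_fun pos (fun t => rootw t * f t).
  by apply: measurable_funM => //; exact: measurable_rootw.
have FE N t : F N t = \sum_(k < N) z k * ((L k).[t] * rootw t * f t).
  rewrite /F /series/= big_mkord mulr_suml; apply: eq_bigr => k _; ring.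
have Ik k : intg mu pos (fun t => (L k).[t] * rootw t * f t).
  by apply: sqintM => //; exact: sqint_poly.
have [IF FI] : (forall N, intg mu pos (F N)) /\
    (forall N, \int[mu]_(t in pos) F N t = series (fun n => z n * lagcoef n f) N).
  suff H N : intg mu pos (F N) /\
     \int[mu]_(t in pos) F N t = series (fun n => z n * lagcoef n f) N.
    by split => N; have [] := H N.
  rewrite (funext (FE N)) /series/= big_mkord.
  elim: N => [|N [IH1 IH2]].
    rewrite big_ord0; split.
      by under eq_fun do rewrite big_ord0; exact: integrable0.
    under eq_Rintegral do rewrite big_ord0.
    by rewrite /Rintegral integral0.
  rewrite big_ord_recr/=; split.
    by under eq_fun do rewrite big_ord_recr/=; apply: intgD => //; exact: intgZ.
  under eq_Rintegral do rewrite big_ord_recr/=.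
  rewrite RintegralD//; last exact: intgZ.
  by congr (_ + _); [exact: IH2|exact: (RintegralZl (z N) mpos (Ik N))].
have Ib : intg mu pos b.
  apply: (le_integrable mpos _ _ IG).
    apply/measurable_EFinP; apply: (@measurableT_comp _ _ _ _ _ _ fine) => //.
    exact: measurable_int IG.
  move=> t _.
  have fine_le (x : \bar R) : ((`|fine x|)%:E <= `|x|)%E.
    by case: x => [r||] //=; rewrite ?normr0 ?leey.
  exact: fine_le.
have [] := @dominated_Rintegral _ _ _ mu pos mpos F (fun t => U t * (rootw t * f t)) b.
- by move=> N; exact: intg_measurable (IF N).
- exact: measurable_funM.
- by apply: (ae_imp _ zU) => t /[apply] {}zU; apply: cvgMr_tmp.
- exact: Ib.
- apply: (ae_imp _ (integrable_ae mpos IG)) => t H N pt; have {H} := H pt => H.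
  rewrite -lee_fin /b fineK// FE.
  apply: (@le_trans _ _ (\sum_(k < N) (s ^+ k * `|(L k).[t] * rootw t * f t|))%:E).
    rewrite lee_fin; apply: (le_trans (ler_norm_sum _ _ _)); apply: ler_sum => k _.
    by rewrite normrM ler_wpM2r.
  rewrite -sumEFin -(big_mkord xpredT (fun k => (s ^+ k * `|(L k).[t] * rootw t * f t|)%:E)).
  by apply: nneseries_lim_ge => n _ _; rewrite lee_fin.
move=> IU; under eq_fun do rewrite FI.
by split.
Qed.

End LaguerreSystem.

(** * Plane linear equations and power series near the unit interval *)

Section PolarODE.
Variable R : realType.
Implicit Types (A B f g a b : R -> R) (r x y : R).

Lemma zero_derivative_const f : (forall r, 0 <= r <= 1 -> is_derive r 1 f (0 : R)) ->
  f 1 = f 0.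
Proof.
move=> df; have [||c _] := @MVT R f (fun=> 0) 0 1 ltr01.
- by move=> r; rewrite in_itv/= => /andP[r0 r1]; apply: df; rewrite !ltW.
- apply: derivable_within_continuous => r; rewrite in_itv/= => r01.
  by case: (df r r01).
- by rewrite mul0r => /eqP; rewrite subr_eq0 => /eqP.
Qed.

(** The hypotheses say that f + i g solves F' = (a + i b) F, where a + i b is
    the derivative of A + i B. Then e^(-A - iB) (f + i g), whose real and
    imaginary parts are P and Q, is constant. *)
Lemma polar_ode A B a b f g :
  (forall r, 0 <= r <= 1 -> is_derive r 1 A (a r)) ->
  (forall r, 0 <= r <= 1 -> is_derive r 1 B (b r)) ->
  (forall r, 0 <= r <= 1 -> is_derive r 1 f (a r * f r - b r * g r)) ->
  (forall r, 0 <= r <= 1 -> is_derive r 1 g (a r * g r + b r * f r)) ->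
  A 0 = 0 -> B 0 = 0 -> f 0 = 1 -> g 0 = 0 ->
  f 1 = expR (A 1) * cos (B 1) /\ g 1 = expR (A 1) * sin (B 1).
Proof.
move=> dA dB df dg A0 B0 f0 g0.
pose P r := expR (- A r) * (cos (B r) * f r + sin (B r) * g r).
pose Q r := expR (- A r) * (cos (B r) * g r - sin (B r) * f r).
have P1 : P 1 = 1.
  suff dP r : 0 <= r <= 1 -> is_derive r 1 P (0 : R).
    by rewrite (zero_derivative_const dP) /P A0 B0 f0 g0 oppr0 expR0 cos0; ring.
  move=> r01; have [dA' dB'] := (dA r r01, dB r r01).
  have [df' dg'] := (df r r01, dg r r01).
  have dE := der_expR (derN dA'); have dC := der_cos dB'; have dS := der_sin dB'.
  by apply: (der_eq (derM dE (derD (derM dC df') (derM dS dg')))); ring.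
have Q1 : Q 1 = 0.
  suff dQ r : 0 <= r <= 1 -> is_derive r 1 Q (0 : R).
    by rewrite (zero_derivative_const dQ) /Q A0 B0 f0 g0 oppr0 expR0 cos0 sin0; ring.
  move=> r01; have [dA' dB'] := (dA r r01, dB r r01).
  have [df' dg'] := (df r r01, dg r r01).
  have dE := der_expR (derN dA'); have dC := der_cos dB'; have dS := der_sin dB'.
  by apply: (der_eq (derM dE (derB (derM dC dg') (derM dS df')))); ring.
have CS : cos (B 1) ^+ 2 + sin (B 1) ^+ 2 = 1 by exact: cos2Dsin2.
have E := expRxMexpNx_1 (A 1).
have -> : f 1 = expR (A 1) * (cos (B 1) * P 1 - sin (B 1) * Q 1).
  rewrite /P /Q; transitivity ((expR (A 1) * expR (- A 1)) *
    (cos (B 1) ^+ 2 + sin (B 1) ^+ 2) * f 1); last by ring.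
  by rewrite E CS !mul1r.
have -> : g 1 = expR (A 1) * (sin (B 1) * P 1 + cos (B 1) * Q 1).
  rewrite /P /Q; transitivity ((expR (A 1) * expR (- A 1)) *
    (cos (B 1) ^+ 2 + sin (B 1) ^+ 2) * g 1); last by ring.
  by rewrite E CS !mul1r.
by rewrite P1 Q1 !mulr1 !mulr0 subr0 addr0.
Qed.

(** A coefficient bound M s^n with s < 1 makes the power series converge in a
    neighbourhood of [0, 1], so that it can be differentiated at the end point
    1. *)
Definition geombound (c : nat -> R) (s : R) := exists M, forall n, `|c n| <= M * s ^+ n.

Lemma natS_le_geometric (d : R) n : 0 < d -> n.+1%:R <= (1 + d^-1) * (1 + d) ^+ n.
Proof.
move=> d0; have h : 1 + n%:R * d <= (1 + d) ^+ n.
  elim: n => [|n IH]; first by rewrite mul0r addr0 expr0.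
  rewrite exprS; apply: (@le_trans _ _ ((1 + d) * (1 + n%:R * d))).
    rewrite -natr1; have : 0 <= n%:R * d * d by rewrite !mulr_ge0// ltW.
    lra.
  by rewrite ler_wpM2l// addr_ge0// ltW.
have d'0 : 0 < d^-1 by rewrite invr_gt0.
apply: (@le_trans _ _ ((1 + d^-1) * (1 + n%:R * d))); last first.
  by rewrite ler_wpM2l// addr_ge0// ltW.
have -> : (1 + d^-1) * (1 + n%:R * d) = n.+1%:R + d^-1 + n%:R * d.
  by rewrite -natr1; field; rewrite gt_eqF.
by rewrite -addrA lerDl addr_ge0 ?mulr_ge0// ltW.
Qed.

(** The factor n + 1 of a derivative is absorbed by an arbitrarily small
    increase of s. *)
Lemma geombound_natS c s d : 0 <= s -> 0 < d -> geombound c s ->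
  geombound (fun n => n.+1%:R * c n) ((1 + d) * s).
Proof.
move=> s0 d0 [M cM]; exists ((1 + d^-1) * M) => n.
rewrite normrM normr_nat exprMn.
have -> : (1 + d^-1) * M * ((1 + d) ^+ n * s ^+ n) =
  ((1 + d^-1) * (1 + d) ^+ n) * (M * s ^+ n) by ring.
by apply: ler_pM => //; exact: natS_le_geometric.
Qed.

Lemma geombound_diffs c s d : 0 <= s -> 0 < d -> geombound c s ->
  geombound (pseries_diffs c) ((1 + d) * s).
Proof.
move=> s0 d0 [M cM]; have : geombound (fun n => c n.+1) s.
  by exists (M * s) => n; rewrite -mulrA -exprS.
by move/(geombound_natS s0 d0).
Qed.

Lemma geombound_cvg c s K : 0 <= s -> geombound c s -> 0 <= K -> s * K < 1 ->
  cvgn (pseries c K).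
Proof.
move=> s0 [M cM] K0 sK; apply: normed_cvg; rewrite /normed_series_of/=.
apply: (@series_le_cvg _ _ (geometric M (s * K))).
- by move=> n; exact: normr_ge0.
- move=> n /=; rewrite exprMn mulrA mulr_ge0 ?exprn_ge0//.
  exact: le_trans (cM n).
- move=> n /=; rewrite normrM normrX (ger0_norm K0) exprMn mulrA.
  by rewrite ler_wpM2r// exprn_ge0.
- by apply: is_cvg_geometric_series; rewrite ger0_norm// mulr_ge0.
Qed.

Definition pser (c : nat -> R) r := limn (pseries c r).

(** Differentiating a power series at r requires convergence of the series and
    of its first two derivatives at a point beyond r: each derivative enlarges
    s by a factor 1 + d, and the point is 1 + d. *)
Lemma geombound_derive c s r : 0 <= s < 1 -> geombound c s -> 0 <= r <= 1 ->
  [/\ is_derive r 1 (pser c) (pser (pseries_diffs c) r),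
      cvgn (pseries c r) & cvgn (pseries (pseries_diffs c) r)].
Proof.
move=> /andP[s0 s1] cs /andP[r0 r1].
(* chosen so that (1 + d)^3 s < 1, since (1 + d)^3 <= 1 + 7 d for d <= 1 *)
pose d := (1 - s) / 8.
have d0 : 0 < d by rewrite /d; lra.
have d1 : d <= 1 by rewrite /d; lra.
have sd : (1 + d) * ((1 + d) * s) * (1 + d) < 1.
  have h : (1 + d) * (1 + d) * (1 + d) <= 1 + 7 * d by nra.
  have : (1 + 7 * d) * s < 1 by rewrite /d; nra.
  by apply: le_lt_trans; rewrite (_ : _ * _ = (1 + d) * (1 + d) * (1 + d) * s) ?ler_wpM2r//; ring.
have h1 : s * (1 + d) < 1.
  have e0 : 0 <= s * (1 + d) by rewrite mulr_ge0//; lra.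
  have e1 : 1 <= (1 + d) * (1 + d) by nra.
  have := ler_peMr e0 e1; lra.
have h2 : (1 + d) * s * (1 + d) < 1.
  have e0 : 0 <= (1 + d) * s * (1 + d) by rewrite !mulr_ge0//; lra.
  have e1 : 1 <= 1 + d by lra.
  have := ler_peMr e0 e1; lra.
have D1 := geombound_diffs s0 d0 cs.
have s0' : 0 <= (1 + d) * s by rewrite mulr_ge0//; lra.
have D2 := geombound_diffs s0' d0 D1.
have s0'' : 0 <= (1 + d) * ((1 + d) * s) by rewrite mulr_ge0//; lra.
have K0 : 0 <= 1 + d by lra.
split.
- apply: (@pseries_snd_diffs _ _ (1 + d)).
  + exact: geombound_cvg cs K0 h1.
  + exact: geombound_cvg D1 K0 h2.
  + exact: geombound_cvg D2 K0 sd.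
  + by rewrite !ger0_norm//; lra.
- by apply: (geombound_cvg s0 cs r0); nra.
- by apply: (geombound_cvg s0' D1 r0); nra.
Qed.

Lemma pser0 c : pser c 0 = c 0%N.
Proof.
apply/cvg_lim => //; apply: cvg_near_cst.
exists 1%N => // -[//|n] _; rewrite /pseries /series/=.
rewrite big_nat_recl// big1 ?addr0 ?expr0 ?mulr1// => i _.
by rewrite expr0n/= mulr0.
Qed.

End PolarODE.

(** * The exponential and the Laguerre generating function in real coordinates *)

Section PowerPairs.
Variables (R : realType) (x y : R).
Implicit Types (r t : R).

(** Real and imaginary parts of (x + i y)^n. *)
Fixpoint cpow (n : nat) : R * R :=
  if n is m.+1 then (x * (cpow m).1 - y * (cpow m).2, x * (cpow m).2 + y * (cpow m).1)
  else (1, 0).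
Local Notation u n := (cpow n).1.
Local Notation v n := (cpow n).2.

Definition cmod := Num.sqrt (x ^+ 2 + y ^+ 2).

Lemma cmod_ge0 : 0 <= cmod. Proof. exact: sqrtr_ge0. Qed.
Lemma cmod_sq : cmod ^+ 2 = x ^+ 2 + y ^+ 2.
Proof. by rewrite sqr_sqrtr// addr_ge0// sqr_ge0. Qed.

Lemma cmod_lt1 : x ^+ 2 + y ^+ 2 < 1 -> cmod < 1.
Proof.
move=> xy1; rewrite -(ltr_pXn2r (n := 2)) ?nnegrE ?cmod_ge0//.
by rewrite cmod_sq expr1n.
Qed.

Lemma cpow_sq n : u n ^+ 2 + v n ^+ 2 = (cmod ^+ n) ^+ 2.
Proof.
elim: n => [|n IH]; first by rewrite /=; ring.
rewrite (exprS cmod) exprMn cmod_sq -IH /=; ring.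
Qed.

Lemma cpow_le n : `|u n| <= cmod ^+ n /\ `|v n| <= cmod ^+ n.
Proof.
have r0 : 0 <= cmod ^+ n by rewrite exprn_ge0// cmod_ge0.
have := cpow_sq n.
have u2 := sqr_ge0 (u n); have v2 := sqr_ge0 (v n).
by split; rewrite -(ler_pXn2r (n := 2)) ?nnegrE// real_normK ?num_real//; lra.
Qed.

Lemma pseries1 (c : nat -> R) : pseries c 1 = series c.
Proof.
apply/funext => n; rewrite /pseries; congr (series _ n).
by apply/funext => k /=; rewrite expr1n mulr1.
Qed.

Lemma pser_lin (c c' : nat -> R) (a b r : R) : cvgn (pseries c r) -> cvgn (pseries c' r) ->
  pser (fun n => a * c n + b * c' n) r = a * pser c r + b * pser c' r.
Proof.
move=> cc cc'; apply/cvg_lim => //.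
have -> : pseries (fun n => a * c n + b * c' n) r =
    (fun N => a * pseries c r N + b * pseries c' r N).
  apply/funext => N; rewrite /pseries /series/= !mulr_sumr -big_split/=.
  by apply: eq_bigr => i _; ring.
by apply: cvgD; apply: cvgMl_tmp.
Qed.

(** Along r in [0, 1], the series of exp (r (x + i y)) satisfies F' = (x + i y)
    F. *)
Theorem cexp_series :
  series (fun n => u n / n`!%:R) @ \oo --> expR x * cos y /\
  series (fun n => v n / n`!%:R) @ \oo --> expR x * sin y.
Proof.
pose c n := u n / n`!%:R; pose c' n := v n / n`!%:R.
(* |z|^n / n! <= M 2^-n, because the exponential series at 2 |z| has bounded
   terms *)
have [M hM] : exists M, forall n, (2 * cmod) ^+ n / n`!%:R <= M.
  exists (expR (2 * cmod)) => n.
  have z0 : 0 <= 2 * cmod by rewrite mulr_ge0// cmod_ge0.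
  have e0 k : 0 <= exp_coeff (2 * cmod) k by exact: exp_coeff_ge0.
  apply: le_trans (nnseries_le_lim n.+1 e0 (is_cvg_series_exp_coeff _)).
  by rewrite /series/= big_nat_recr//= lerDr sumr_ge0.
have fact0' n : 0 < n`!%:R :> R by rewrite ltr0n fact_gt0.
have bnd (z : nat -> R) : (forall n, `|z n| <= cmod ^+ n) ->
    geombound (fun n => z n / n`!%:R) 2^-1.
  move=> hz; exists M => n; rewrite normrM normfV normr_nat.
  apply: le_trans (_ : (2 * cmod) ^+ n / n`!%:R * 2^-1 ^+ n <= _).
    have e2 : 2 ^+ n * 2^-1 ^+ n = 1 :> R by rewrite -exprMn divff// expr1n.
    rewrite exprMn (_ : _ * 2^-1 ^+ n = (2 ^+ n * 2^-1 ^+ n) * (cmod ^+ n / n`!%:R)).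
      by rewrite e2 mul1r ler_wpM2r ?invr_ge0.
    ring.
  by rewrite ler_wpM2r// exprn_ge0// invr_ge0.
have gc : geombound c 2^-1 by apply: bnd => n; exact: (cpow_le n).1.
have gc' : geombound c' 2^-1 by apply: bnd => n; exact: (cpow_le n).2.
have h01 : 0 <= (2^-1 : R) < 1 by rewrite invr_ge0 ler0n invf_lt1 ?ltr1n ?ltr0n.
have dc : pseries_diffs c = (fun n => x * c n + (- y) * c' n).
  apply/funext => n; rewrite /pseries_diffs /c /c' factS natrM/=.
  by field; rewrite nat1r !pnatr_eq0 -lt0n fact_gt0.
have dc' : pseries_diffs c' = (fun n => x * c' n + y * c n).
  apply/funext => n; rewrite /pseries_diffs /c /c' factS natrM/=.
  by field; rewrite nat1r !pnatr_eq0 -lt0n fact_gt0.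
have dx r : is_derive r 1 (fun r => x * r) x by apply: (der_eq (derZ x (der_id r))); rewrite mulr1.
have dy r : is_derive r 1 (fun r => y * r) y by apply: (der_eq (derZ y (der_id r))); rewrite mulr1.
have df r : 0 <= r <= 1 -> is_derive r 1 (pser c) (x * pser c r - y * pser c' r).
  move=> r01; have [d1 h1 _] := geombound_derive h01 gc r01.
  have [_ h2 _] := geombound_derive h01 gc' r01.
  by apply: (der_eq d1); rewrite dc pser_lin// mulNr.
have dg r : 0 <= r <= 1 -> is_derive r 1 (pser c') (x * pser c' r + y * pser c r).
  move=> r01; have [_ h1 _] := geombound_derive h01 gc r01.
  have [d2 h2 _] := geombound_derive h01 gc' r01.
  by apply: (der_eq d2); rewrite dc' pser_lin.
have f0 : pser c 0 = 1 by rewrite pser0 /c /= fact0 divr1.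
have g0 : pser c' 0 = 0 by rewrite pser0 /c' /= mul0r.
have [H1 H2] := polar_ode (fun r _ => dx r) (fun r _ => dy r) df dg (mulr0 x) (mulr0 y) f0 g0.
have one : 0 <= (1 : R) <= 1 by rewrite ler01 lexx.
have [_ c1 _] := geombound_derive h01 gc one; have [_ c2 _] := geombound_derive h01 gc' one.
rewrite !mulr1 in H1 H2.
by rewrite -H1 -H2 /pser !pseries1 -/c -/c'; rewrite !pseries1 in c1 c2; split.
Qed.

Section GeneratingFunction.
Variables (al t : R) (a : nat -> R).
Hypothesis xy1 : x ^+ 2 + y ^+ 2 < 1.
Hypothesis a0 : a 0%N = 1.
Hypothesis a1 : a 1%N = 1 + al - t.
Hypothesis aS : forall n, n.+2%:R * a n.+2 =
  (2 * n.+1%:R + 1 + al - t) * a n.+1 - (n.+1%:R + al) * a n.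
Variable s : R.
Hypothesis s_gt : cmod < s.
Hypothesis s_lt1 : s < 1.
Hypothesis a_cvg : cvgn (series (fun n => s ^+ n * `|a n|)).

Let c n := u n * a n.
Let c' n := v n * a n.

Let s0 : 0 < s. Proof. exact: le_lt_trans cmod_ge0 s_gt. Qed.
Let q01 : 0 <= cmod / s < 1.
Proof. by rewrite divr_ge0 ?cmod_ge0 ?(ltW s0)//= ltr_pdivrMr// mul1r. Qed.

Let geombound_a (z : nat -> R) : (forall n, `|z n| <= cmod ^+ n) ->
  geombound (fun n => z n * a n) (cmod / s).
Proof.
move=> hz; exists (limn (series (fun n => s ^+ n * `|a n|))) => n.
have g0 k : 0 <= s ^+ k * `|a k| by rewrite mulr_ge0// exprn_ge0// ltW.
have := nnseries_le_lim n.+1 g0 a_cvg.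
rewrite {1}/series/= big_nat_recr//= => h.
have {h} h : s ^+ n * `|a n| <= limn (series (fun n => s ^+ n * `|a n|)).
  by apply: le_trans h; rewrite lerDr sumr_ge0.
rewrite normrM expr_div_n mulrA ler_pdivlMr ?exprn_gt0//.
rewrite -mulrA (mulrC `|a n|) [leRHS]mulrC.
apply: (@le_trans _ _ (cmod ^+ n * (s ^+ n * `|a n|))).
  by rewrite ler_wpM2r.
by rewrite ler_wpM2l// exprn_ge0// cmod_ge0.
Qed.

Let gc : geombound c (cmod / s).
Proof. by apply: geombound_a => n; exact: (cpow_le n).1. Qed.
Let gc' : geombound c' (cmod / s).
Proof. by apply: geombound_a => n; exact: (cpow_le n).2. Qed.

Let p1 r := (1 - r * x) ^+ 2 - (r * y) ^+ 2.
Let p2 r := - 2 * (r * y) * (1 - r * x).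
Let g1 r := x * ((al + 1) * (1 - r * x) - t) + y ^+ 2 * (al + 1) * r.
Let g2 r := y * ((al + 1) * (1 - r * x) - t) - x * y * (al + 1) * r.

(** Let F be the sum of the r^n z^n a_n. The recurrence for a gives (1 - r z)^2
    F' = z ((al + 1) (1 - r z) - t) F, where p1 + i p2 and g1 + i g2 are the
    values of the two factors. For partial sums the terms cancel except at the
    upper end; this is the real part of that statement. *)
Lemma residual1 r n :
  p1 r * pseries (pseries_diffs c) r n.+1 - p2 r * pseries (pseries_diffs c') r n.+1
  - g1 r * pseries c r n.+1 + g2 r * pseries c' r n.+1 =
  r ^+ n.+1 * (u n.+2 * ((n.+1%:R + al) * a n - 2 * n.+1%:R * a n.+1)
    + r * n.+1%:R * u n.+3 * a n.+1).
Proof.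
elim: n => [|n IH].
  rewrite /pseries /series/= !big_nat1 /pseries_diffs /c /c' /= a0 a1 /p1 /p2 /g1 /g2.
  ring.
have rS z : pseries z r n.+2 = pseries z r n.+1 + z n.+1 * r ^+ n.+1.
  by rewrite /pseries /series/= big_nat_recr.
rewrite !rS.
transitivity ((p1 r * pseries (pseries_diffs c) r n.+1 -
   p2 r * pseries (pseries_diffs c') r n.+1
  - g1 r * pseries c r n.+1 + g2 r * pseries c' r n.+1)
  + (p1 r * pseries_diffs c n.+1 - p2 r * pseries_diffs c' n.+1
     - g1 r * c n.+1 + g2 r * c' n.+1) * r ^+ n.+1); first by ring.
rewrite IH /pseries_diffs /c /c'.
have -> : a n.+2 = ((2 * n.+1%:R + 1 + al - t) * a n.+1 - (n.+1%:R + al) * a n) / n.+2%:R.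
  by rewrite -aS mulrAC divff ?mul1r// pnatr_eq0.
have uS m : u m.+1 = x * u m - y * v m by [].
have vS m : v m.+1 = x * v m + y * u m by [].
rewrite (exprS r n.+1) /p1 /p2 /g1 /g2 (uS n.+3) (uS n.+2) (vS n.+2) (uS n.+1) (vS n.+1).
move: (u n.+1) (v n.+1) (a n.+1) (a n) (r ^+ n.+1) => U V a2 a3 rn.
rewrite -[n.+2%:R]natr1 -[n.+1%:R]natr1; field.
by rewrite !natr1 pnatr_eq0.
Qed.

(** The imaginary part of the same identity. *)
Lemma residual2 r n :
  p1 r * pseries (pseries_diffs c') r n.+1 + p2 r * pseries (pseries_diffs c) r n.+1
  - g1 r * pseries c' r n.+1 - g2 r * pseries c r n.+1 =
  r ^+ n.+1 * (v n.+2 * ((n.+1%:R + al) * a n - 2 * n.+1%:R * a n.+1)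
    + r * n.+1%:R * v n.+3 * a n.+1).
Proof.
elim: n => [|n IH].
  rewrite /pseries /series/= !big_nat1 /pseries_diffs /c /c' /= a0 a1 /p1 /p2 /g1 /g2.
  ring.
have rS z : pseries z r n.+2 = pseries z r n.+1 + z n.+1 * r ^+ n.+1.
  by rewrite /pseries /series/= big_nat_recr.
rewrite !rS.
transitivity ((p1 r * pseries (pseries_diffs c') r n.+1 +
   p2 r * pseries (pseries_diffs c) r n.+1
  - g1 r * pseries c' r n.+1 - g2 r * pseries c r n.+1)
  + (p1 r * pseries_diffs c' n.+1 + p2 r * pseries_diffs c n.+1
     - g1 r * c' n.+1 - g2 r * c n.+1) * r ^+ n.+1); first by ring.
rewrite IH /pseries_diffs /c /c'.
have -> : a n.+2 = ((2 * n.+1%:R + 1 + al - t) * a n.+1 - (n.+1%:R + al) * a n) / n.+2%:R.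
  by rewrite -aS mulrAC divff ?mul1r// pnatr_eq0.
have uS m : u m.+1 = x * u m - y * v m by [].
have vS m : v m.+1 = x * v m + y * u m by [].
rewrite (exprS r n.+1) /p1 /p2 /g1 /g2 (vS n.+3) (vS n.+2) (uS n.+2) (uS n.+1) (vS n.+1).
move: (u n.+1) (v n.+1) (a n.+1) (a n) (r ^+ n.+1) => U V a2 a3 rn.
rewrite -[n.+2%:R]natr1 -[n.+1%:R]natr1; field.
by rewrite !natr1 pnatr_eq0.
Qed.

Let w n := n.+1%:R * (cmod ^+ n * `|a n|).

(** A geometric bound with a slightly larger ratio absorbs the factor n + 1;
    these are the terms that bound the residuals. *)
Let w_cvg0 : w @ \oo --> (0 : R).
Proof.
have /andP[q0 q1] := q01.
have gw : geombound (fun n => cmod ^+ n * `|a n|) (cmod / s).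
  have [|M hM] := @geombound_a (fun n => cmod ^+ n).
    by move=> n; rewrite ger0_norm// exprn_ge0// cmod_ge0.
  by exists M => n; rewrite normrM normr_id -normrM.
pose d := (1 - cmod / s) / 2.
have d0 : 0 < d by rewrite /d; lra.
have gw' := geombound_natS q0 d0 gw.
have : cvgn (pseries w 1).
  apply: (geombound_cvg _ gw'); rewrite ?mulr1//; first by rewrite mulr_ge0//; lra.
  rewrite /d; nra.
by move=> /cvg_series_cvg_0; under eq_fun do rewrite expr1n mulr1.
Qed.

Let wbound (z : nat -> R) r n : (forall n, `|z n| <= cmod ^+ n) -> 0 <= r <= 1 -> 0 <= al ->
  `|r ^+ n.+1 * (z n.+2 * ((n.+1%:R + al) * a n - 2 * n.+1%:R * a n.+1)
    + r * n.+1%:R * z n.+3 * a n.+1)| <= (1 + al) * w n + 3 * w n.+1.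
Proof.
move=> hz /andP[r0 r1] al0; have r00 := cmod_ge0.
have rho1 : cmod <= 1 by rewrite ltW// (lt_trans s_gt).
have hz2 m k : (m <= k)%N -> `|z k| <= cmod ^+ m.
  by move=> mk; apply: (le_trans (hz k)); exact: ler_wiXn2l.
have rn : `|r ^+ n.+1| <= 1 by rewrite ger0_norm ?exprn_ge0// exprn_ile1.
rewrite normrM; apply: (le_trans (ler_piMl _ rn)) => //.
apply: (le_trans (ler_normD _ _)).
have n1 : 0 <= n.+1%:R :> R by [].
have t1 : `|z n.+2 * ((n.+1%:R + al) * a n)| <= (1 + al) * w n.
  rewrite !normrM (@ger0_norm _ (n.+1%:R + al)) ?addr_ge0//.
  rewrite /w; apply: (@le_trans _ _ (cmod ^+ n * (((1 + al) * n.+1%:R) * `|a n|))); last first.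
    by rewrite le_eqVlt; apply/orP; left; apply/eqP; ring.
  apply: ler_pM => //; rewrite ?mulr_ge0 ?addr_ge0//; first exact: (hz2 n n.+2 (leq_addl 2 n)).
  by rewrite ler_wpM2r// mulrDl mul1r lerD2l ler_peMr// ler1n.
have t2 Z : `|Z| <= cmod ^+ n.+1 -> `|Z * (n.+1%:R * a n.+1)| <= w n.+1.
  move=> hZ; rewrite !normrM normr_nat /w.
  apply: (@le_trans _ _ (cmod ^+ n.+1 * (n.+1%:R * `|a n.+1|))).
    by rewrite ler_wpM2r// mulr_ge0.
  by rewrite mulrCA ler_wpM2r ?mulr_ge0 ?exprn_ge0// ler_nat.
have e1 : z n.+2 * ((n.+1%:R + al) * a n - 2 * n.+1%:R * a n.+1) =
   z n.+2 * ((n.+1%:R + al) * a n) - 2 * (z n.+2 * (n.+1%:R * a n.+1)) by ring.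
have e2 : r * n.+1%:R * z n.+3 * a n.+1 = r * (z n.+3 * (n.+1%:R * a n.+1)) by ring.
rewrite e1 e2.
have h1 := ler_normB (z n.+2 * ((n.+1%:R + al) * a n)) (2 * (z n.+2 * (n.+1%:R * a n.+1))).
have h2 := t2 _ (hz2 n.+1 n.+2 (leqnSn _)).
have h3 := t2 _ (hz2 n.+1 n.+3 (leq_addl 2 n.+1)).
rewrite (normrM 2) (ger0_norm (ler0n R 2)) in h1.
have h4 : `|r * (z n.+3 * (n.+1%:R * a n.+1))| <= `|z n.+3 * (n.+1%:R * a n.+1)|.
  by rewrite normrM (ger0_norm r0) ler_piMl.
lra.
Qed.

Hypothesis al_ge0 : 0 <= al.

(** The limit of either residual identity; z is the real or the imaginary part
    of the powers. *)
Let residual_zero (z : nat -> R) (d1 d2 : nat -> R) r q1 q2 h1 h2 (f1 f2 : nat -> R) :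
  (forall n, `|z n| <= cmod ^+ n) -> 0 <= r <= 1 ->
  cvgn (pseries d1 r) -> cvgn (pseries d2 r) ->
  cvgn (pseries f1 r) -> cvgn (pseries f2 r) ->
  (forall n, q1 * pseries d1 r n.+1 + q2 * pseries d2 r n.+1
    + h1 * pseries f1 r n.+1 + h2 * pseries f2 r n.+1 =
    r ^+ n.+1 * (z n.+2 * ((n.+1%:R + al) * a n - 2 * n.+1%:R * a n.+1)
    + r * n.+1%:R * z n.+3 * a n.+1)) ->
  q1 * pser d1 r + q2 * pser d2 r + h1 * pser f1 r + h2 * pser f2 r = 0.
Proof.
move=> hz r01 c1 c2 c3 c4 E.
pose F n := q1 * pseries d1 r n + q2 * pseries d2 r n
    + h1 * pseries f1 r n + h2 * pseries f2 r n.
have cF : F @ \oo --> q1 * pser d1 r + q2 * pser d2 r + h1 * pser f1 r + h2 * pser f2 r.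
  by do 3 (apply: cvgD; last by apply: cvgMl_tmp); apply: cvgMl_tmp.
have cF0 : F @ \oo --> (0 : R).
  rewrite -cvg_shiftS; apply: norm_cvg0.
  apply: (@squeeze_cvgr _ _ _ _ (cst 0) (fun n => (1 + al) * w n + 3 * w n.+1)).
  - by apply: nearW => n; rewrite normr_ge0/= /F E; exact: wbound.
  - exact: cvg_cst.
  - have : (fun n => (1 + al) * w n + 3 * w n.+1) @ \oo --> (1 + al) * 0 + 3 * 0.
      apply: cvgD; apply: cvgMl_tmp; first exact: w_cvg0.
      by have := w_cvg0; rewrite -cvg_shiftS.
    by rewrite !mulr0 addr0.
exact: (cvg_unique _ cF cF0).
Qed.

Let N r := (1 - r * x) ^+ 2 + (r * y) ^+ 2.
Let A r := t * ((r ^+ 2 * (x ^+ 2 + y ^+ 2) - r * x) / N r) - (al + 1) / 2 * ln (N r).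
Let B r := - t * (r * y / N r) + (al + 1) * atan (r * y / (1 - r * x)).
(* da + i db is the quotient (g1 + i g2) / (p1 + i p2), and the derivative of
   A + i B *)
Let da r := (g1 r * p1 r + g2 r * p2 r) / N r ^+ 2.
Let db r := (g2 r * p1 r - g1 r * p2 r) / N r ^+ 2.

Let x_lt1 : x < 1.
Proof.
rewrite ltNge; apply/negP => x1; have y2 := sqr_ge0 y.
have x2 : 1 <= x ^+ 2 by rewrite exprn_ege1.
by move: xy1; rewrite ltNge => /negP; apply; lra.
Qed.

Let rx_gt0 r : 0 <= r <= 1 -> 0 < 1 - r * x.
Proof.
move=> /andP[r0 r1]; have h := x_lt1.
have [x0|/ltW x0] := leP x 0; first by have := mulr_ge0_le0 r0 x0; lra.
by have := ler_piMl x0 r1; lra.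
Qed.

Let N_gt0 r : 0 <= r <= 1 -> 0 < N r.
Proof. by move=> /rx_gt0 h; rewrite ltr_pwDl ?sqr_ge0// exprn_gt0. Qed.

Let dN r : is_derive r 1 N (2 * (r * (x ^+ 2 + y ^+ 2) - x)).
Proof.
have d1 := derB (der_cst r 1) (derM (der_id r) (der_cst r x)).
have d2 := derM (der_id r) (der_cst r y).
apply: (der_eq (derD (derM d1 d1) (derM d2 d2))); ring.
Qed.

Let dA r : 0 <= r <= 1 -> is_derive r 1 A (da r).
Proof.
move=> r01; have N0 := N_gt0 r01.
have N0' : N r != 0 by rewrite gt_eqF.
have di := der_id r.
have d1 := derB (derM (derM di di) (der_cst r (x ^+ 2 + y ^+ 2))) (derM di (der_cst r x)).
have d2 := derZ t (derM d1 (derV N0' (dN r))).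
have d3 := derZ ((al + 1) / 2) (der_ln N0 (dN r)).
apply: (der_eq (derB d2 d3)); rewrite /da /g1 /g2 /p1 /p2.
rewrite /N in N0' *; field; exact: N0'.
Qed.

Let dB r : 0 <= r <= 1 -> is_derive r 1 B (db r).
Proof.
move=> r01; have N0 := N_gt0 r01.
have N0' : N r != 0 by rewrite gt_eqF.
have x0 : 1 - r * x != 0 by rewrite gt_eqF// rx_gt0.
have di := der_id r.
have d1 := derM di (der_cst r y).
have dx := derB (der_cst r 1) (derM di (der_cst r x)).
have d2 := derZ (- t) (derM d1 (derV N0' (dN r))).
have d3 := derZ (al + 1) (der_atan (derM d1 (derV (f := fun r => 1 - r * x) x0 dx))).
apply: (der_eq (derD d2 d3)); rewrite /db /g1 /g2 /p1 /p2.
rewrite /N in N0' *; by field; rewrite N0' x0.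
Qed.

(** Dividing by (1 - r z)^2, whose squared modulus is p1^2 + p2^2 = N^2. *)
Let solve_ode (d1 d2 f1 f2 : R) (r : R) : 0 <= r <= 1 ->
  p1 r * d1 + - p2 r * d2 + - g1 r * f1 + g2 r * f2 = 0 ->
  p1 r * d2 + p2 r * d1 + - g1 r * f2 + - g2 r * f1 = 0 ->
  d1 = da r * f1 - db r * f2 /\ d2 = da r * f2 + db r * f1.
Proof.
move=> r01 E1 E2.
have N0 : N r != 0 by rewrite gt_eqF// N_gt0.
have NN : p1 r ^+ 2 + p2 r ^+ 2 = N r ^+ 2 by rewrite /p1 /p2 /N; ring.
have e1 : N r ^+ 2 * d1 = (g1 r * p1 r + g2 r * p2 r) * f1 - (g2 r * p1 r - g1 r * p2 r) * f2.
  have : p1 r * (p1 r * d1 + - p2 r * d2 + - g1 r * f1 + g2 r * f2) +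
    p2 r * (p1 r * d2 + p2 r * d1 + - g1 r * f2 + - g2 r * f1) = 0.
    by rewrite E1 E2 !mulr0 addr0.
  by rewrite -NN => E; apply/eqP; rewrite -subr_eq0 -[X in _ == X]E; apply/eqP; ring.
have e2 : N r ^+ 2 * d2 = (g1 r * p1 r + g2 r * p2 r) * f2 + (g2 r * p1 r - g1 r * p2 r) * f1.
  have : p1 r * (p1 r * d2 + p2 r * d1 + - g1 r * f2 + - g2 r * f1) -
    p2 r * (p1 r * d1 + - p2 r * d2 + - g1 r * f1 + g2 r * f2) = 0.
    by rewrite E1 E2 !mulr0 subr0.
  by rewrite -NN => E; apply/eqP; rewrite -subr_eq0 -[X in _ == X]E; apply/eqP; ring.
have N2 : N r ^+ 2 != 0 by rewrite expf_neq0.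
by split; apply: (mulfI N2); rewrite ?e1 ?e2 /da /db; field.
Qed.

Definition gen_arg_re := t * ((x ^+ 2 + y ^+ 2 - x) / ((1 - x) ^+ 2 + y ^+ 2))
  - (al + 1) / 2 * ln ((1 - x) ^+ 2 + y ^+ 2).
Definition gen_arg_im := - t * (y / ((1 - x) ^+ 2 + y ^+ 2)) + (al + 1) * atan (y / (1 - x)).

(** The functions A and B are the real and imaginary parts of - t r z / (1 - r
    z) - (al + 1) log (1 - r z); the arctangent is the right branch of the
    argument because 1 - r x > 0. *)
Theorem generating_function :
  series (fun n => u n * a n) @ \oo --> expR gen_arg_re * cos gen_arg_im /\
  series (fun n => v n * a n) @ \oo --> expR gen_arg_re * sin gen_arg_im.
Proof.
have D r (r01 : 0 <= r <= 1) : is_derive r 1 (pser c) (da r * pser c r - db r * pser c' r) /\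
   is_derive r 1 (pser c') (da r * pser c' r + db r * pser c r).
  have [d1 c1 c2] := geombound_derive q01 gc r01.
  have [d2 c3 c4] := geombound_derive q01 gc' r01.
  have E1 := residual_zero (fun n => (cpow_le n).1) r01 c2 c4 c1 c3
    (q1 := p1 r) (q2 := - p2 r) (h1 := - g1 r) (h2 := g2 r).
  have E2 := residual_zero (fun n => (cpow_le n).2) r01 c4 c2 c3 c1
    (q1 := p1 r) (q2 := p2 r) (h1 := - g1 r) (h2 := - g2 r).
  have [||e1 e2] := @solve_ode (pser (pseries_diffs c) r) (pser (pseries_diffs c') r)
    (pser c r) (pser c' r) r r01.
  - by apply: E1 => n; rewrite -residual1; ring.
  - by apply: E2 => n; rewrite -residual2; ring.
  by split; [apply: (der_eq d1)|apply: (der_eq d2)].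
have N0 : N 0 = 1 by rewrite /N; ring.
have A0 : A 0 = 0 by rewrite /A N0 ln1; ring.
have B0 : B 0 = 0 by rewrite /B !mul0r atan0; ring.
have f0 : pser c 0 = 1 by rewrite pser0 /c a0 mulr1.
have h0 : pser c' 0 = 0 by rewrite pser0 /c' mul0r.
have [H1 H2] := polar_ode dA dB (fun r r01 => (D r r01).1) (fun r r01 => (D r r01).2) A0 B0 f0 h0.
have A1 : A 1 = gen_arg_re by rewrite /A /N /gen_arg_re !mul1r expr1n mul1r.
have B1 : B 1 = gen_arg_im by rewrite /B /N /gen_arg_im !mul1r.
have one : 0 <= (1 : R) <= 1 by rewrite ler01 lexx.
have [_ c1 _] := geombound_derive q01 gc one; have [_ c2 _] := geombound_derive q01 gc' one.
by rewrite -A1 -B1 -H1 -H2 /pser !pseries1; rewrite !pseries1 in c1 c2; split.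
Qed.

End GeneratingFunction.

End PowerPairs.

(** * Quaternions slice by slice *)

Section Quaternions.
Variable R : realType.
Local Notation H := (quat R).
Implicit Types (p q : H) (a b c d : R).

Lemma quat_ext p q : qre p = qre q -> qi p = qi q -> qj p = qj q -> qk p = qk q ->
  p = q.
Proof. by case: p => ? ? ? ?; case: q => ? ? ? ? /= -> -> -> ->. Qed.

Lemma series_coord (c : H -> R) (u : nat -> H) :
  (forall p q, c (p + q) = c p + c q) -> c 0 = 0 ->
  (fun n => c (series u n)) = series (fun n => c (u n)).
Proof.
move=> cD c0; apply/funext => N; rewrite /series/=.
elim: N => [|N IH]; first by rewrite !big_geq.
by rewrite !big_nat_recr//= cD IH.
Qed.

Lemma qnormE q : `|q| = Num.sqrt (qnormsq q). Proof. by []. Qed.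

Lemma qnorm_sq q : `|q| ^+ 2 = qnormsq q.
Proof. by rewrite qnormE sqr_sqrtr// qnormsq_ge0. Qed.

Lemma qnormsqM p q : qnormsq (p * q) = qnormsq p * qnormsq q.
Proof. by rewrite /qnormsq /=; ring. Qed.

Lemma qnormM p q : `|p * q| = `|p| * `|q|.
Proof. by rewrite !qnormE qnormsqM sqrtrM// qnormsq_ge0. Qed.

Lemma qnorm1 : `|1 : H| = 1.
Proof. by rewrite qnormE (_ : qnormsq _ = 1) ?sqrtr1// /qnormsq/=; ring. Qed.

Lemma qnormX q n : `|q ^+ n| = `|q| ^+ n.
Proof. by elim: n => [|n IH]; rewrite ?expr0 ?qnorm1// !exprS qnormM IH. Qed.

Lemma qcoord_le q : [/\ `|qre q| <= `|q|, `|qi q| <= `|q|, `|qj q| <= `|q| & `|qk q| <= `|q|].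
Proof.
have h := qnorm_sq q; rewrite /qnormsq in h.
have h1 := sqr_ge0 (qre q); have h2 := sqr_ge0 (qi q).
have h3 := sqr_ge0 (qj q); have h4 := sqr_ge0 (qk q).
by split; rewrite -(ler_pXn2r (n := 2)) ?nnegrE// real_normK ?num_real//; lra.
Qed.

Lemma qnorm_le q : `|q| <= `|qre q| + `|qi q| + `|qj q| + `|qk q|.
Proof.
rewrite -(ler_pXn2r (n := 2)) ?nnegrE ?addr_ge0// qnorm_sq /qnormsq.
rewrite -!(@real_normK _ (_ q)) ?num_real//.
have h1 := normr_ge0 (qre q); have h2 := normr_ge0 (qi q).
have h3 := normr_ge0 (qj q); have h4 := normr_ge0 (qk q).
nra.
Qed.

Lemma quat_cvg (u : nat -> H) (l : H) :
  qre (u n) @[n --> \oo] --> qre l -> qi (u n) @[n --> \oo] --> qi l ->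
  qj (u n) @[n --> \oo] --> qj l -> qk (u n) @[n --> \oo] --> qk l ->
  u @ \oo --> l.
Proof.
move=> h1 h2 h3 h4.
have z (f : nat -> R) (m : R) : f @ \oo --> m -> (fun n => `|m - f n|) @ \oo --> (0 : R).
  move=> fm; rewrite -(@normr0 _ R) -(subrr m); apply: cvg_norm.
  by apply: cvgB => //; exact: cvg_cst.
have H0 : (fun n => `|l - u n|) @ \oo --> (0 : R).
  apply: (@squeeze_cvgr _ _ _ _ (cst 0) (fun n => `|qre l - qre (u n)| +
    `|qi l - qi (u n)| + `|qj l - qj (u n)| + `|qk l - qk (u n)|)).
  - by apply: nearW => n; rewrite normr_ge0/=; exact: qnorm_le.
  - exact: cvg_cst.
  - rewrite -[X in _ --> X](addr0 0) -[X in _ --> X + _](addr0 0).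
    rewrite -[X in _ --> X + _ + _](addr0 0).
    by do 3 (apply: cvgD; last exact: z); exact: z.
apply/cvgrPdist_lt => e e0; move/cvgrPdist_lt : H0 => /(_ e e0).
by apply: filterS => n; rewrite sub0r normrN normr_id.
Qed.

Lemma quat_cvgP (u : nat -> H) (l : H) : u @ \oo --> l ->
  [/\ qre (u n) @[n --> \oo] --> qre l, qi (u n) @[n --> \oo] --> qi l,
      qj (u n) @[n --> \oo] --> qj l & qk (u n) @[n --> \oo] --> qk l].
Proof.
move=> /cvgrPdist_lt h.
have z (f : H -> R) : (forall p q, `|f p - f q| <= `|p - q|) ->
    f (u n) @[n --> \oo] --> f l.
  move=> fle; apply/cvgrPdist_lt => e e0; have := h e e0.
  by apply: filterS => n; exact: le_lt_trans.
by split; apply: z => p q; have [] := qcoord_le (p - q).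
Qed.

(** The complex number a + b i in the plane spanned by 1 and J, when J^2 = -1;
    on this plane the quaternion operations are the complex ones. *)
Definition cq (J : H) a b : H := a%:A + b *: J.
Definition imunit (J : H) := qre J = 0 /\ qnormsq J = 1.

Lemma cqE J a b : qre J = 0 -> cq J a b = Quat a (b * qi J) (b * qj J) (b * qk J).
Proof. by move=> J0; apply: quat_ext => /=; rewrite ?J0; ring. Qed.

Lemma cqM J a b c d : imunit J ->
  cq J a b * cq J c d = cq J (a * c - b * d) (a * d + b * c).
Proof.
move=> [J0 J1]; rewrite !cqE//; rewrite /qnormsq J0 in J1.
have e : qi J ^+ 2 + qj J ^+ 2 + qk J ^+ 2 = 1 by rewrite -J1; ring.
apply: quat_ext => /=; [|ring..].
transitivity (a * c - b * d * (qi J ^+ 2 + qj J ^+ 2 + qk J ^+ 2)); first by ring.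
by rewrite e mulr1.
Qed.

Lemma cqD J a b c d : cq J a b + cq J c d = cq J (a + c) (b + d).
Proof. by rewrite /cq !scalerDl addrACA. Qed.

Lemma cqZ J a b c : c *: cq J a b = cq J (c * a) (c * b).
Proof. by rewrite /cq scalerDr !scalerA. Qed.

Lemma cq10 J : cq J 1 0 = 1.
Proof. by rewrite /cq scale0r addr0 scale1r. Qed.

Lemma cqX J x y n : imunit J -> cq J x y ^+ n = cq J (cpow x y n).1 (cpow x y n).2.
Proof.
move=> hJ; elim: n => [|n IH]; first by rewrite expr0 /= cq10.
by rewrite exprS IH cqM//=.
Qed.

(** The imaginary direction of q; for real q any imaginary unit will do. *)
Lemma slice q : exists2 J, imunit J & q = cq J (qre q) `|qim q|.
Proof.
have [q0|q0] := eqVneq (qim q) 0.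
  exists (Quat 0 1 0 0); first by split=> //; rewrite /qnormsq/=; ring.
  by rewrite q0 normr0 /cq scale0r addr0; apply/eqP; rewrite -subr_eq0 -/(qim q) q0.
have n0 : `|qim q| != 0 by rewrite normr_eq0.
exists (`|qim q|^-1 *: qim q).
  split; first by rewrite /qim /=; ring.
  rewrite -qnorm_sq normrZ normfV normr_id mulVf// expr1n//.
by rewrite /cq scalerA divff// scale1r /qim addrC subrK.
Qed.

Lemma qpower_series_cq J x y (c : nat -> R) : imunit J ->
  series (fun n => c n *: cq J x y ^+ n) =
  (fun N => cq J (series (fun n => (cpow x y n).1 * c n) N)
                 (series (fun n => (cpow x y n).2 * c n) N)).
Proof.
move=> hJ; apply/funext => N; rewrite /series/=.
elim: N => [|N IH]; first by rewrite !big_geq// /cq !scale0r addr0.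
by rewrite !big_nat_recr//= IH cqX// cqZ cqD; congr (cq _ (_ + _) (_ + _)); rewrite mulrC.
Qed.

Lemma cq_cvg J (u v : nat -> R) a b : qre J = 0 -> u @ \oo --> a -> v @ \oo --> b ->
  (fun n => cq J (u n) (v n)) @ \oo --> cq J a b.
Proof.
move=> J0 ua vb; under eq_fun do rewrite cqE//.
by rewrite cqE//; apply: quat_cvg => //=; apply: cvgMr_tmp.
Qed.

Lemma qexp_cq J a b : imunit J -> qexp (cq J a b) = cq J (expR a * cos b) (expR a * sin b).
Proof.
move=> hJ; have [c1 c2] := cexp_series a b.
apply/cvg_lim => //; rewrite qpower_series_cq//.
exact: (cq_cvg hJ.1 c1 c2).
Qed.

Lemma q_unit q : (q \is a GRing.unit) = (q != 0). Proof. by []. Qed.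

Lemma qinv_unique p q : p * q = 1 -> p^-1 = q.
Proof.
move=> pq; have up : p \is a GRing.unit.
  by rewrite q_unit; apply: contra_eq_neq pq => ->; rewrite mul0r eq_sym oner_neq0.
by rewrite -[p^-1]mulr1 -pq mulKr.
Qed.

Lemma cq_inv J a b : imunit J -> a ^+ 2 + b ^+ 2 != 0 ->
  (cq J a b)^-1 = cq J (a / (a ^+ 2 + b ^+ 2)) (- b / (a ^+ 2 + b ^+ 2)).
Proof.
move=> hJ n0; apply: qinv_unique; rewrite cqM// -[RHS](cq10 J).
by congr cq; field.
Qed.

Lemma qexpV J a b : imunit J -> (qexp (cq J a b))^-1 = qexp (cq J (- a) (- b)).
Proof.
move=> hJ; apply: qinv_unique; rewrite !qexp_cq// cqM// cosN sinN -[RHS](cq10 J).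
have h := expRxMexpNx_1 a; have h2 := cos2Dsin2 b.
congr cq; last by ring.
transitivity ((expR a * expR (- a)) * (cos b ^+ 2 + sin b ^+ 2)); first by ring.
by rewrite h h2 mulr1.
Qed.

Lemma qexp_mul J a b c d : imunit J ->
  qexp (cq J a b) * qexp (cq J c d) = qexp (cq J (a + c) (b + d)).
Proof.
move=> hJ; rewrite !qexp_cq// cqM// expRD cosD sinD; congr cq; ring.
Qed.

Lemma acos_atan (c s : R) : 0 < c -> 0 <= s ->
  acos (c / Num.sqrt (c ^+ 2 + s ^+ 2)) = atan (s / c).
Proof.
move=> c0 s0; have sc : 0 <= s / c by rewrite divr_ge0// ltW.
have -> : c / Num.sqrt (c ^+ 2 + s ^+ 2) = cos (atan (s / c)).
  rewrite cos_atan.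
  have -> : 1 + (s / c) ^+ 2 = (c ^+ 2 + s ^+ 2) / c ^+ 2 by field; rewrite gt_eqF.
  rewrite sqrtrM ?addr_ge0 ?sqr_ge0// sqrtrV ?sqr_ge0// sqrtr_sqr gtr0_norm//.
  by rewrite invfM invrK mulrC.
apply: cosK; rewrite in_itv/=; apply/andP; split.
  by rewrite -[leLHS]atan0 le_atan.
by rewrite ltW// (lt_le_trans (atan_ltpi2 _))// ler_pdivrMr// ler_peMr ?pi_ge0// ler1n.
Qed.

Lemma qim_cq J a b : imunit J -> qim (cq J a b) = b *: J.
Proof. by move=> [J0 _]; rewrite /qim /cq /= J0 mulr0 addr0 mulr1 addrC addKr. Qed.

Lemma norm_cq J a b : imunit J -> `|cq J a b| = Num.sqrt (a ^+ 2 + b ^+ 2).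
Proof.
move=> [J0 J1]; rewrite qnormE; congr Num.sqrt; rewrite cqE// /qnormsq/=.
rewrite /qnormsq J0 in J1.
have e : qi J ^+ 2 + qj J ^+ 2 + qk J ^+ 2 = 1 by rewrite -J1; ring.
transitivity (a ^+ 2 + b ^+ 2 * (qi J ^+ 2 + qj J ^+ 2 + qk J ^+ 2)); first by ring.
by rewrite e mulr1.
Qed.

(** In the right half-plane the arc cosine in the principal logarithm is an
    arctangent ([acos_atan]). The sign makes the lemma fit 1 - q. *)
Lemma qlog_cq J c s : imunit J -> 0 < c -> 0 <= s ->
  qlog (cq J c (- s)) = cq J (ln (c ^+ 2 + s ^+ 2) / 2) (- atan (s / c)).
Proof.
move=> hJ c0 s0; have [J0 J1] := hJ.
have n0 : 0 < c ^+ 2 + s ^+ 2 by rewrite ltr_pwDl ?sqr_ge0// exprn_gt0.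
rewrite /qlog norm_cq// sqrrN qim_cq// [qre _]/= J0 mulr0 addr0 mulr1 acos_atan//.
rewrite /cq; congr (_ + _).
  congr (_ *: _); rewrite -powR12_sqrt ?ltW// ln_powR mulrC//.
rewrite normrZ normrN (ger0_norm s0) (_ : `|J| = 1) ?mulr1; last first.
  by rewrite qnormE J1 sqrtr1.
rewrite scalerA; congr (_ *: _).
have [->|s1] := eqVneq s 0; first by rewrite !mul0r atan0 !oppr0 mulr0.
by field.
Qed.

(** The kernel of the Bargmann transform is the closed form of the generating
    function: both are the exponential of a complex logarithm. *)
Theorem kernel_slice J x y al t : imunit J -> 0 <= y -> x ^+ 2 + y ^+ 2 < 1 ->
  (qpow (1 - cq J x y) (al + 1))^-1 * qexp (t *: (cq J x y / (cq J x y - 1))) =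
  cq J (expR (gen_arg_re x y al t) * cos (gen_arg_im x y al t))
       (expR (gen_arg_re x y al t) * sin (gen_arg_im x y al t)).
Proof.
move=> hJ y0 xy1.
have x1 : 0 < 1 - x.
  rewrite subr_gt0 ltNge; apply/negP => x1; have y2 := sqr_ge0 y.
  have x2 : 1 <= x ^+ 2 by rewrite exprn_ege1.
  by move: xy1; rewrite ltNge => /negP; apply; lra.
have n0 : 0 < (1 - x) ^+ 2 + y ^+ 2 by rewrite ltr_pwDl ?sqr_ge0// exprn_gt0.
have cqN a b : - cq J a b = cq J (- a) (- b).
  by rewrite -scaleN1r cqZ !mulN1r.
have e1 : 1 - cq J x y = cq J (1 - x) (- y) by rewrite -(cq10 J) cqN cqD sub0r.
have e2 : cq J x y - 1 = cq J (x - 1) y by rewrite -(cq10 J) cqN cqD oppr0 addr0.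
have n0' : (x - 1) ^+ 2 + y ^+ 2 != 0 by rewrite -(sqrrN (x - 1)) opprB gt_eqF.
rewrite e1 e2 /qpow qlog_cq// cqZ qexpV// cq_inv// cqM// cqZ qexp_mul// qexp_cq//.
have n1 : (1 - x) ^+ 2 + y ^+ 2 != 0 by rewrite gt_eqF.
have eP : - ((al + 1) * (ln ((1 - x) ^+ 2 + y ^+ 2) / 2)) +
    t * (x * ((x - 1) / ((x - 1) ^+ 2 + y ^+ 2)) - y * (- y / ((x - 1) ^+ 2 + y ^+ 2)))
    = gen_arg_re x y al t.
  by rewrite /gen_arg_re; field; rewrite ?n0' ?n1.
have eQ : - ((al + 1) * - atan (y / (1 - x))) +
    t * (x * (- y / ((x - 1) ^+ 2 + y ^+ 2)) + y * ((x - 1) / ((x - 1) ^+ 2 + y ^+ 2)))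
    = gen_arg_im x y al t.
  by rewrite /gen_arg_im; field; rewrite ?n0' ?n1 ?(gt_eqF x1).
by rewrite !eP !eQ.
Qed.

End Quaternions.

(** * Integration against the generating function, and completeness *)

Section RealExpansion.
Variable R : realType.
Local Notation mu := (@lebesgue_measure R).
Local Notation pos := (@posline R).
Variables (al : R) (al0 : 0 < al).
Implicit Types (f g : R -> R) (x y t : R).

Let mpos := @measurable_posline R.

(** The hypotheses of [generating_function] hold for those t at which the sum
    of the s^n |L_n(t)| converges, with s halfway between |x + i y| and 1. *)
Lemma laguerre_generating x y : x ^+ 2 + y ^+ 2 < 1 ->
  {ae mu, forall t, pos t ->
    series (fun n => (cpow x y n).1 * (laguerre al n).[t]) @ \oo -->
      expR (gen_arg_re x y al t) * cos (gen_arg_im x y al t) /\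
    series (fun n => (cpow x y n).2 * (laguerre al n).[t]) @ \oo -->
      expR (gen_arg_re x y al t) * sin (gen_arg_im x y al t)}.
Proof.
move=> xy1; have r0 := cmod_ge0 x y.
have r1 := cmod_lt1 xy1.
pose s := (cmod x y + 1) / 2.
have s01 : 0 <= s < 1 by apply/andP; split; rewrite /s; lra.
have rs : cmod x y < s by rewrite /s; lra.
apply: (ae_imp _ (laguerre_abs_cvg al0 s01)) => t + pt => /(_ pt) cs.
have /andP[_ s1] := s01.
apply: (generating_function xy1 _ _ _ rs s1 cs); last exact: ltW.
- by rewrite /laguerre/= hornerC.
- by rewrite /laguerre/= hornerD hornerN hornerC hornerX.
- move=> n; have := congr1 (fun p : {poly R} => p.[t]) (laguerre_rec al n.+1).
  by rewrite /= !(hornerM, hornerD, hornerN, hornerX, hornerC).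
Qed.

Lemma measurable_gen x y :
  measurable_fun pos (fun t => expR (gen_arg_re x y al t) * cos (gen_arg_im x y al t)) /\
  measurable_fun pos (fun t => expR (gen_arg_re x y al t) * sin (gen_arg_im x y al t)).
Proof.
have h (a b : R) : measurable_fun pos (fun t : R => t * a - b).
  by apply: measurable_funB => //; exact: measurable_funM.
have h' (a b : R) : measurable_fun pos (fun t : R => - t * a + b).
  by apply: measurable_funD => //; apply: measurable_funM => //; exact: measurable_funN.
have mc : measurable_fun setT (@cos R).
  by apply: continuous_measurable_fun; exact: continuous_cos.
have ms : measurable_fun setT (@sin R).
  by apply: continuous_measurable_fun; exact: continuous_sin.
have mA : measurable_fun pos (fun t => expR (gen_arg_re x y al t)).
  by apply: (measurableT_comp (@measurable_expR R)); exact: h.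
have mB : measurable_fun pos (fun t => gen_arg_im x y al t) by exact: h'.
by split; apply: measurable_funM => //; [exact: measurableT_comp mc mB|exact: measurableT_comp ms mB].
Qed.

(** The instance of [laguerre_series_integral] for the real and imaginary parts
    of z^n, which are at most |z|^n. *)
Theorem generating_integral f x y : sqint mu pos f -> x ^+ 2 + y ^+ 2 < 1 ->
  let U t := expR (gen_arg_re x y al t) * cos (gen_arg_im x y al t) in
  let V t := expR (gen_arg_re x y al t) * sin (gen_arg_im x y al t) in
  [/\ intg mu pos (fun t => U t * (rootw al t * f t)),
      intg mu pos (fun t => V t * (rootw al t * f t)),
      series (fun n => (cpow x y n).1 * lagcoef al n f) @ \oo -->
        \int[mu]_(t in pos) (U t * (rootw al t * f t)) &
      series (fun n => (cpow x y n).2 * lagcoef al n f) @ \oo -->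
        \int[mu]_(t in pos) (V t * (rootw al t * f t))].
Proof.
move=> sf xy1 U V; have [mU mV] := measurable_gen x y.
have r0 := cmod_ge0 x y.
have r1 := cmod_lt1 xy1.
have r01 : 0 <= cmod x y < 1 by rewrite r0.
have gen := laguerre_generating xy1.
have gen1 : {ae mu, forall t, pos t ->
    series (fun n => (cpow x y n).1 * (laguerre al n).[t]) @ \oo --> U t}.
  by apply: (ae_imp _ gen) => t + pt => /(_ pt)[].
have gen2 : {ae mu, forall t, pos t ->
    series (fun n => (cpow x y n).2 * (laguerre al n).[t]) @ \oo --> V t}.
  by apply: (ae_imp _ gen) => t + pt => /(_ pt)[].
have [I1 C1] := @laguerre_series_integral _ _ al0 f (fun n => (cpow x y n).1) U _ sf r01
  (fun n => (cpow_le x y n).1) mU gen1.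
have [I2 C2] := @laguerre_series_integral _ _ al0 f (fun n => (cpow x y n).2) V _ sf r01
  (fun n => (cpow_le x y n).2) mV gen2.
by split.
Qed.

(** At the real point x = k / (k + 1) of the disc the generating function is a
    nonzero multiple C of t -> e^(-kt). *)
Theorem lagfun_total : total_family mu pos (lagfun al).
Proof.
move=> f sf f0.
have c0 n : lagcoef al n f = 0 by rewrite lagcoefE// f0 mulr0.
have Ig : intg mu pos (fun t => rootw al t * f t).
  apply: (intg_eq mpos _ (sqintM mpos (sqint_poly al0 1) sf)) => t _.
  by rewrite hornerC mul1r.
have : {ae mu, forall t, pos t -> rootw al t * f t = 0}.
  apply: laplace_unique => // k.
  pose x : R := k%:R / k.+1%:R.
  have k0 : k.+1%:R != 0 :> R by rewrite pnatr_eq0.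
  have x0 : 0 <= x by rewrite divr_ge0.
  have x1 : x < 1 by rewrite ltr_pdivrMr// mul1r ltr_nat.
  have xy1 : x ^+ 2 + 0 ^+ 2 < 1 by rewrite expr0n addr0 expr_lt1.
  have [IU _ CU _] := generating_integral sf xy1.
  have U0 : \int[mu]_(t in pos) (expR (gen_arg_re x 0 al t) * cos (gen_arg_im x 0 al t) *
       (rootw al t * f t)) = 0.
    rewrite -(cvg_lim (@Rhausdorff R) CU).
    apply/cvg_lim => //; rewrite (_ : series _ = cst 0); first exact: cvg_cst.
    by apply/funext => n; rewrite /series/= big1// => i _; rewrite c0 mulr0.
  pose C := expR (- ((al + 1) / 2 * ln ((1 - x) ^+ 2 + 0 ^+ 2))).
  have UE t : expR (gen_arg_re x 0 al t) * cos (gen_arg_im x 0 al t) =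
      C * expR (- (k%:R * t)).
    have -> : gen_arg_im x 0 al t = 0 by rewrite /gen_arg_im !mul0r atan0 !mulr0 addr0.
    rewrite cos0 mulr1 /C -expRD /gen_arg_re; congr expR.
    have x1' : 1 - x != 0 by rewrite subr_eq0 gt_eqF.
    rewrite addrC; congr (_ + _).
    have -> : (x ^+ 2 + 0 ^+ 2 - x) / ((1 - x) ^+ 2 + 0 ^+ 2) = - (x / (1 - x)).
      rewrite expr0n !addr0; field; exact: x1'.
    have -> : x / (1 - x) = k%:R.
      have -> : 1 - x = k.+1%:R^-1 by rewrite /x -natr1; field; rewrite natr1.
      by rewrite invrK /x divfK.
    by rewrite mulrN mulrC.
  have C0 : C != 0 by rewrite gt_eqF// expR_gt0.
  have E : C * \int[mu]_(t in pos) (expR (- (k%:R * t)) * (rootw al t * f t)) = 0.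
    rewrite -[RHS]U0 -RintegralZl//.
      by apply: eq_Rintegral => t _; rewrite UE mulrA.
    apply: (intg_eq mpos _ (intgZ mpos C^-1 IU)) => t _.
    by rewrite UE !mulrA mulVf// mul1r.
  by move/eqP : E; rewrite mulf_eq0 (negPf C0)/= => /eqP.
apply: ae_imp => t + pt => /(_ pt)/eqP; rewrite mulf_eq0 gt_eqF ?rootw_gt0//=.
by move/eqP.
Qed.

End RealExpansion.

(** * Laguerre coefficients of quaternion-valued functions *)

Section QuaternionL2.
Variable R : realType.
Local Notation H := (quat R).
Local Notation mu := (@lebesgue_measure R).
Local Notation pos := (@posline R).
Variables (al : R) (al0 : 0 < al).
Implicit Types (f g : R -> R) (x y t : R) (p q : H) (phi psi : R -> H) (c : H -> R).
Local Notation sq := (sqint mu pos).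
Local Notation rw := (rootw al).
Local Notation L2a := (@L2 R al).

Let mpos := @measurable_posline R.

(** The real functionals on the quaternions, in coordinates; those needed below
    are the coordinates of products with a fixed quaternion. *)
Definition real_linear c := exists k : H, forall q,
  c q = qre k * qre q + qi k * qi q + qj k * qj q + qk k * qk q.

Lemma real_linear_mulr a : [/\ real_linear (fun q => qre (q * a)), real_linear (fun q => qi (q * a)),
   real_linear (fun q => qj (q * a)) & real_linear (fun q => qk (q * a))].
Proof.
split.
- by exists (Quat (qre a) (- qi a) (- qj a) (- qk a)) => q /=; ring.
- by exists (Quat (qi a) (qre a) (qk a) (- qj a)) => q /=; ring.
- by exists (Quat (qj a) (- qk a) (qre a) (qi a)) => q /=; ring.
- by exists (Quat (qk a) (qj a) (- qi a) (qre a)) => q /=; ring.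
Qed.

Lemma real_linear_mull a : [/\ real_linear (fun q => qre (a * q)), real_linear (fun q => qi (a * q)),
   real_linear (fun q => qj (a * q)) & real_linear (fun q => qk (a * q))].
Proof.
split.
- by exists (Quat (qre a) (- qi a) (- qj a) (- qk a)) => q /=; ring.
- by exists (Quat (qi a) (qre a) (- qk a) (qj a)) => q /=; ring.
- by exists (Quat (qj a) (qk a) (qre a) (- qi a)) => q /=; ring.
- by exists (Quat (qk a) (- qj a) (qi a) (qre a)) => q /=; ring.
Qed.

Definition rootcoord c phi t := rw t * c (phi t).

Definition sqintq phi := [/\ sq (rootcoord (@qre R) phi), sq (rootcoord (@qi R) phi),
  sq (rootcoord (@qj R) phi) & sq (rootcoord (@qk R) phi)].

Lemma rootcoord_lin c phi k : (forall q, c q = qre k * qre q + qi k * qi q + qj k * qj q + qk k * qk q) ->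
  rootcoord c phi = (fun t => qre k * rootcoord (@qre R) phi t + qi k * rootcoord (@qi R) phi t
    + qj k * rootcoord (@qj R) phi t + qk k * rootcoord (@qk R) phi t).
Proof. by move=> ck; apply/funext => t; rewrite /rootcoord ck; ring. Qed.

Lemma sqintq_lin c phi : real_linear c -> sqintq phi -> sq (rootcoord c phi).
Proof.
move=> [k ck] [s1 s2 s3 s4]; rewrite (rootcoord_lin _ ck).
by do 3 (apply: sqintD => //; last exact: sqintZ); exact: sqintZ.
Qed.

(** |phi|^2 is the sum of the squares of the four coordinates, so square
    integrability can be tested on them. *)
Lemma L2_sqintq phi : L2a phi <-> sqintq phi.
Proof.
have mrw := measurable_rootw al.
have mw := measurable_weight al.
split=> [[[m1 m2 m3 m4] Loo]|[s1 s2 s3 s4]].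
  have mm c : measurable_fun pos (c \o phi) -> measurable_fun pos (rootcoord c phi).
    by move=> mc; apply: measurable_funM.
  have In : intg mu pos (fun t => `|phi t| ^+ 2 * weight al t).
    apply: intg_ge0P => //.
      apply: measurable_funM => //.
      have -> : (fun t => `|phi t| ^+ 2) = (fun t => qre (phi t) ^+ 2 + qi (phi t) ^+ 2 +
         qj (phi t) ^+ 2 + qk (phi t) ^+ 2) by apply/funext => t; rewrite qnorm_sq.
      by do 3 (apply: measurable_funD; last exact: measurable_funX); exact: measurable_funX.
    by move=> t pt; rewrite mulr_ge0 ?sqr_ge0// ltW// weight_gt0.
  have ms c : measurable_fun pos (c \o phi) -> (forall q, `|c q| <= `|q|) -> sq (rootcoord c phi).
    move=> mc cle; split; first exact: mm.
    apply: (intg_le mpos _ _ In); first by apply: measurable_funX; exact: mm.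
    move=> t pt; rewrite ger0_norm ?sqr_ge0// /rootcoord exprMn rootw_sq// mulrC.
    rewrite ler_wpM2r ?(ltW (weight_gt0 _ pt))//.
    by rewrite -[leLHS]real_normK ?num_real// ler_pXn2r ?nnegrE.
  by split; apply: ms => // q; have [] := qcoord_le q.
have mm c : sq (rootcoord c phi) -> measurable_fun pos (c \o phi).
  move=> [mc _]; apply: (@eq_measurable_fun _ _ _ _ _ (fun t => (rw t)^-1 * rootcoord c phi t)).
    move=> t /set_mem pt; rewrite /rootcoord mulrA mulVf ?mul1r//.
    by rewrite gt_eqF// rootw_gt0.
  by apply: measurable_funM => //; exact: measurable_rootwV.
split; first by split; exact: mm.
have Is : intg mu pos (fun t => `|phi t| ^+ 2 * weight al t).
  have I c : sq (rootcoord c phi) -> intg mu pos (fun t => rootcoord c phi t ^+ 2) by case.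
  apply: (intg_eq mpos _ (intgD mpos (intgD mpos (intgD mpos (I _ s1) (I _ s2)) (I _ s3)) (I _ s4))).
  by move=> t pt; rewrite qnorm_sq /qnormsq /rootcoord !exprMn rootw_sq//; ring.
by rewrite (intg_int mpos Is) ltry.
Qed.

Definition qcoef n phi : H := Quat
  (lagcoef al n (rootcoord (@qre R) phi)) (lagcoef al n (rootcoord (@qi R) phi))
  (lagcoef al n (rootcoord (@qj R) phi)) (lagcoef al n (rootcoord (@qk R) phi)).

Lemma lagcoefD n f g : sq f -> sq g ->
  lagcoef al n (fun t => f t + g t) = lagcoef al n f + lagcoef al n g.
Proof.
move=> sf sg; have sL := sqint_poly al0 (laguerre al n).
by rewrite /lagcoef ipC ipDl//; congr (_ + _); exact: ipC.
Qed.

Lemma lagcoefZ n a f : sq f -> lagcoef al n (fun t => a * f t) = a * lagcoef al n f.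
Proof.
move=> sf; have sL := sqint_poly al0 (laguerre al n).
by rewrite /lagcoef ipC ipZl//; congr (_ * _); exact: ipC.
Qed.

Lemma lagcoef_lin n c phi : real_linear c -> sqintq phi ->
  lagcoef al n (rootcoord c phi) = c (qcoef n phi).
Proof.
move=> [k ck] [s1 s2 s3 s4]; rewrite (rootcoord_lin _ ck) ck /=.
have z a f : sq f -> sq (fun t => a * f t) by exact: sqintZ.
rewrite !lagcoefD ?lagcoefZ//; try exact: z.
  by apply: sqintD => //; exact: z.
by apply: sqintD => //; [apply: sqintD => //; exact: z|exact: z].
Qed.

(** The coefficients are integrals against real functions, which commute with
    the constant a. *)
Lemma qcoefM n phi a : sqintq phi -> qcoef n (fun t => phi t * a) = qcoef n phi * a.
Proof.
move=> sp; have [l1 l2 l3 l4] := real_linear_mulr a; apply: quat_ext.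
- exact: (lagcoef_lin n l1 sp).
- exact: (lagcoef_lin n l2 sp).
- exact: (lagcoef_lin n l3 sp).
- exact: (lagcoef_lin n l4 sp).
Qed.

Lemma sqintqM phi a : sqintq phi -> sqintq (fun t => phi t * a).
Proof.
move=> sp; have [l1 l2 l3 l4] := real_linear_mulr a.
by split; [exact: (sqintq_lin l1 sp)|exact: (sqintq_lin l2 sp)|exact: (sqintq_lin l3 sp)|exact: (sqintq_lin l4 sp)].
Qed.

Lemma sqintqD phi psi : sqintq phi -> sqintq psi -> sqintq (fun t => phi t + psi t).
Proof.
move=> [s1 s2 s3 s4] [r1 r2 r3 r4].
have h c : sq (rootcoord c phi) -> sq (rootcoord c psi) -> (forall p q, c (p + q) = c p + c q) ->
    sq (rootcoord c (fun t => phi t + psi t)).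
  move=> s r cD; have := sqintD mpos s r; congr (sqint _ _).
  by apply/funext => t; rewrite /rootcoord cD mulrDr.
by split; apply: h.
Qed.

Lemma qcoefD n phi psi : sqintq phi -> sqintq psi ->
  qcoef n (fun t => phi t + psi t) = qcoef n phi + qcoef n psi.
Proof.
move=> [s1 s2 s3 s4] [r1 r2 r3 r4].
have h c : sq (rootcoord c phi) -> sq (rootcoord c psi) -> (forall p q, c (p + q) = c p + c q) ->
    lagcoef al n (rootcoord c (fun t => phi t + psi t)) =
    lagcoef al n (rootcoord c phi) + lagcoef al n (rootcoord c psi).
  move=> s r cD; rewrite -lagcoefD//; congr (lagcoef _ _ _).
  by apply/funext => t; rewrite /rootcoord cD mulrDr.
by apply: quat_ext => /=; apply: h.
Qed.

Lemma lagcoef_unique f g : sq f -> sq g -> (forall n, lagcoef al n f = lagcoef al n g) ->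
  {ae mu, forall t, pos t -> f t = g t}.
Proof.
move=> sf sg fg.
have : {ae mu, forall t, pos t -> f t - g t = 0}.
  apply: (lagfun_total al0) => [|n]; first exact: sqintB.
  have := fg n; rewrite !lagcoefE// => /mulfI h.
  have sl := sqint_lagfun al0 n.
  by rewrite ipBl// h ?subrr// gt_eqF// sqrtr_gt0 lnorm_gt0.
by apply: ae_imp => t + pt => /(_ pt)/eqP; rewrite subr_eq0 => /eqP.
Qed.

Lemma qcoef_unique phi psi : L2a phi -> L2a psi ->
  (forall n, qcoef n phi = qcoef n psi) -> L2_eq phi psi.
Proof.
move=> /L2_sqintq[s1 s2 s3 s4] /L2_sqintq[r1 r2 r3 r4] h.
have e1 := lagcoef_unique s1 r1 (fun n => congr1 (@qre R) (h n)).
have e2 := lagcoef_unique s2 r2 (fun n => congr1 (@qi R) (h n)).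
have e3 := lagcoef_unique s3 r3 (fun n => congr1 (@qj R) (h n)).
have e4 := lagcoef_unique s4 r4 (fun n => congr1 (@qk R) (h n)).
apply: (ae_imp _ (ae_and (ae_and e1 e2) (ae_and e3 e4))).
move=> t [[h1 h2] [h3 h4]] pt.
have r0 : rw t != 0 by rewrite gt_eqF// rootw_gt0.
by apply: quat_ext; apply: (mulfI r0); [exact: h1|exact: h2|exact: h3|exact: h4].
Qed.

End QuaternionL2.

(** * Riesz-Fischer and Parseval for quaternion-valued functions *)

Section QuaternionParseval.
Variable R : realType.
Local Notation H := (quat R).
Local Notation mu := (@lebesgue_measure R).
Local Notation pos := (@posline R).
Variables (al : R) (al0 : 0 < al).
Implicit Types (f g : R -> R) (x y t : R) (p q : H) (phi psi : R -> H) (c : H -> R).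
Local Notation sq := (sqint mu pos).
Local Notation rw := (rootw al).
Local Notation L2a := (@L2 R al).

Let mpos := @measurable_posline R.

Lemma riesz_fischer_lag (a : nat -> R) :
  cvgn (series (fun n => a n ^+ 2 / lnorm al n)) ->
  exists2 f, sq f & forall n, lagcoef al n f = a n.
Proof.
move=> ca; pose b n := a n / Num.sqrt (lnorm al n).
have l0 n : 0 < lnorm al n by exact: lnorm_gt0.
have s0 n : Num.sqrt (lnorm al n) != 0 by rewrite gt_eqF// sqrtr_gt0.
have cb : cvgn (series (fun n => b n ^+ 2)).
  have -> // : (fun n => b n ^+ 2) = (fun n => a n ^+ 2 / lnorm al n).
  by apply/funext => n; rewrite /b expr_div_n sqr_sqrtr// ltW.
have [f [sf fb _]] := riesz_fischer mpos (sqint_lagfun al0) (lagfun_orthonormal al0) cb.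
by exists f => // n; rewrite lagcoefE// fb /b mulrC divfK.
Qed.

Lemma qriesz_fischer (c : nat -> H) :
  cvgn (series (fun n => `|c n| ^+ 2 / lnorm al n)) ->
  exists2 phi, L2a phi & forall n, qcoef al n phi = c n.
Proof.
move=> cc.
have ex (d : H -> R) : (forall q, `|d q| <= `|q|) ->
    exists2 f, sq f & forall n, lagcoef al n f = d (c n).
  move=> dle; apply: (@riesz_fischer_lag (fun n => d (c n))).
  apply: (series_le_cvg _ _ _ cc) => n.
  - by rewrite divr_ge0 ?sqr_ge0// ltW// lnorm_gt0.
  - by rewrite divr_ge0 ?sqr_ge0// ltW// lnorm_gt0.
  - rewrite ler_wpM2r ?invr_ge0 ?(ltW (lnorm_gt0 al0 n))//.
    by rewrite -[leLHS]real_normK ?num_real// ler_pXn2r ?nnegrE.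
have [f1 s1 h1] := ex (@qre R) (fun q => let: And4 h _ _ _ := qcoord_le q in h).
have [f2 s2 h2] := ex (@qi R) (fun q => let: And4 _ h _ _ := qcoord_le q in h).
have [f3 s3 h3] := ex (@qj R) (fun q => let: And4 _ _ h _ := qcoord_le q in h).
have [f4 s4 h4] := ex (@qk R) (fun q => let: And4 _ _ _ h := qcoord_le q in h).
pose phi t := (rw t)^-1 *: Quat (f1 t) (f2 t) (f3 t) (f4 t).
have rE f t : pos t -> rw t * ((rw t)^-1 * f t) = f t.
  by move=> pt; rewrite mulrA divff ?mul1r// gt_eqF// rootw_gt0.
have sqE f g : (forall t, pos t -> g t = f t) -> sq f -> sq g.
  move=> fg [mf If]; split.
    apply: (@eq_measurable_fun _ _ _ _ _ f) => // t /set_mem pt.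
    by rewrite fg.
  by apply: (intg_eq mpos _ If) => t pt; rewrite fg.
have coE f g n : (forall t, pos t -> g t = f t) -> lagcoef al n g = lagcoef al n f.
  by move=> fg; apply: eq_Rintegral => t /set_mem pt; rewrite fg.
exists phi.
  apply/L2_sqintq; split; [apply: sqE s1|apply: sqE s2|apply: sqE s3|apply: sqE s4] => t pt;
  exact: (rE _ t pt).
move=> n; apply: quat_ext; rewrite /qcoef/=; [rewrite -h1|rewrite -h2|rewrite -h3|rewrite -h4];
  apply: coE => t pt; exact: (rE _ t pt).
Qed.

Lemma lag_bessel f : sq f -> cvgn (series (fun n => lagcoef al n f ^+ 2 / lnorm al n)).
Proof.
move=> sf; have := is_cvg_bessel mpos (sqint_lagfun al0) (lagfun_orthonormal al0) sf.
have -> // : (fun k => ip mu pos f (lagfun al k) ^+ 2) =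
  (fun n => lagcoef al n f ^+ 2 / lnorm al n).
apply/funext => n; rewrite lagcoefE// exprMn sqr_sqrtr ?(ltW (lnorm_gt0 al0 n))//.
by rewrite mulrAC divff ?mul1r// gt_eqF// lnorm_gt0.
Qed.

Lemma qbessel phi : L2a phi -> cvgn (series (fun n => `|qcoef al n phi| ^+ 2 / lnorm al n)).
Proof.
move=> /L2_sqintq[s1 s2 s3 s4].
have := is_cvg_seriesD (is_cvg_seriesD (lag_bessel s1) (lag_bessel s2))
  (is_cvg_seriesD (lag_bessel s3) (lag_bessel s4)).
set u := _ + _; have -> // : u = (fun n => `|qcoef al n phi| ^+ 2 / lnorm al n).
by apply/funext => n; rewrite /u !fctE qnorm_sq /qnormsq /qcoef /=; ring.
Qed.

Lemma lag_parseval f g : sq f -> sq g ->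
  series (fun n => (lnorm al n)^-1 * (lagcoef al n f * lagcoef al n g)) @ \oo -->
  ip mu pos f g.
Proof.
move=> sf sg.
have := parseval mpos (sqint_lagfun al0) (lagfun_orthonormal al0) (lagfun_total al0) sf sg.
have -> // : (fun k => ip mu pos f (lagfun al k) * ip mu pos g (lagfun al k)) =
  (fun n => (lnorm al n)^-1 * (lagcoef al n f * lagcoef al n g)).
apply/funext => n; rewrite !lagcoefE//; have l0 := lnorm_gt0 al0 n.
set s := Num.sqrt _; have ss : s ^+ 2 = lnorm al n by rewrite sqr_sqrtr// ltW.
rewrite -ss; field; by rewrite gt_eqF// sqrtr_gt0.
Qed.

(** Each coordinate of conj(phi) psi is a signed sum of four products of
    coordinates of phi and psi. *)
Lemma four_parseval (f1 g1 f2 g2 f3 g3 f4 g4 : R -> R) (s1 s2 s3 : R) (h : R -> R) :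
  sq f1 -> sq g1 -> sq f2 -> sq g2 -> sq f3 -> sq g3 -> sq f4 -> sq g4 ->
  (forall t, pos t -> h t = f1 t * g1 t + s1 * (f2 t * g2 t) + s2 * (f3 t * g3 t) + s3 * (f4 t * g4 t)) ->
  series (fun n => (lnorm al n)^-1 * (lagcoef al n f1 * lagcoef al n g1
    + s1 * (lagcoef al n f2 * lagcoef al n g2) + s2 * (lagcoef al n f3 * lagcoef al n g3)
    + s3 * (lagcoef al n f4 * lagcoef al n g4))) @ \oo -->
  \int[mu]_(t in pos) h t.
Proof.
move=> a1 b1 a2 b2 a3 b3 a4 b4 hE.
have -> : \int[mu]_(t in pos) h t = ip mu pos f1 g1 + s1 * ip mu pos f2 g2
    + s2 * ip mu pos f3 g3 + s3 * ip mu pos f4 g4.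
  have I1 := sqintM mpos a1 b1.
  have I2 := intgZ mpos s1 (sqintM mpos a2 b2).
  have I3 := intgZ mpos s2 (sqintM mpos a3 b3).
  have I4 := intgZ mpos s3 (sqintM mpos a4 b4).
  transitivity (\int[mu]_(t in pos) (f1 t * g1 t + s1 * (f2 t * g2 t)
      + s2 * (f3 t * g3 t) + s3 * (f4 t * g4 t))).
    by apply: eq_Rintegral => t /set_mem pt; rewrite hE.
  have Z s f g : sq f -> sq g -> \int[mu]_(t in pos) (s * (f t * g t)) = s * ip mu pos f g.
    by move=> sf sg; apply: RintegralZl => //; exact: sqintM.
  rewrite (RintegralD mpos (intgD mpos (intgD mpos I1 I2) I3) I4).
  rewrite (RintegralD mpos (intgD mpos I1 I2) I3) (RintegralD mpos I1 I2).
  by congr (_ + _ + _ + _); exact: Z.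
have P1 := lag_parseval a1 b1.
have P2 := lag_parseval a2 b2.
have P3 := lag_parseval a3 b3.
have P4 := lag_parseval a4 b4.
have := cvgD (cvgD (cvgD P1 (cvgMl_tmp (a := s1) P2)) (cvgMl_tmp (a := s2) P3))
  (cvgMl_tmp (a := s3) P4).
move=> h0; rewrite (_ : series _ = (fun N => series (fun n => (lnorm al n)^-1 * (lagcoef al n f1 * lagcoef al n g1)) N
   + s1 * series (fun n => (lnorm al n)^-1 * (lagcoef al n f2 * lagcoef al n g2)) N
   + s2 * series (fun n => (lnorm al n)^-1 * (lagcoef al n f3 * lagcoef al n g3)) N
   + s3 * series (fun n => (lnorm al n)^-1 * (lagcoef al n f4 * lagcoef al n g4)) N)).
  exact: h0.
apply/funext => N; rewrite /series/= !mulr_sumr -!big_split/=.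
by apply: eq_bigr => i _; ring.
Qed.

Theorem qparseval phi psi : L2a phi -> L2a psi ->
  series (fun n => (lnorm al n)^-1 *: (qconj (qcoef al n phi) * qcoef al n psi)) @ \oo -->
  L2_inner al phi psi.
Proof.
move=> /L2_sqintq[s1 s2 s3 s4] /L2_sqintq[r1 r2 r3 r4].
have cvg_eq (u v : nat -> R) (l : R) : (forall n, v n = u n) ->
    series u @ \oo --> l -> series v @ \oo --> l by move=> /funext ->.
apply: quat_cvg; rewrite series_coord//.
- apply: (cvg_eq _ _ _ _ (four_parseval (s1 := 1) (s2 := 1) (s3 := 1)
    (h := fun t => weight al t * qre (qconj (phi t) * psi t)) s1 r1 s2 r2 s3 r3 s4 r4 _)) => [n|t pt].
    by rewrite /=; ring.
  by rewrite -rootw_sq// /rootcoord /=; ring.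
- apply: (cvg_eq _ _ _ _ (four_parseval (s1 := (-1)) (s2 := (-1)) (s3 := 1)
    (h := fun t => weight al t * qi (qconj (phi t) * psi t)) s1 r2 s2 r1 s3 r4 s4 r3 _)) => [n|t pt].
    by rewrite /=; ring.
  by rewrite -rootw_sq// /rootcoord /=; ring.
- apply: (cvg_eq _ _ _ _ (four_parseval (s1 := 1) (s2 := (-1)) (s3 := (-1))
    (h := fun t => weight al t * qj (qconj (phi t) * psi t)) s1 r3 s2 r4 s3 r1 s4 r2 _)) => [n|t pt].
    by rewrite /=; ring.
  by rewrite -rootw_sq// /rootcoord /=; ring.
- apply: (cvg_eq _ _ _ _ (four_parseval (s1 := (-1)) (s2 := 1) (s3 := (-1))
    (h := fun t => weight al t * qk (qconj (phi t) * psi t)) s1 r4 s2 r3 s3 r2 s4 r1 _)) => [n|t pt].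
    by rewrite /=; ring.
  by rewrite -rootw_sq// /rootcoord /=; ring.
Qed.

End QuaternionParseval.

(** * Uniqueness of power series coefficients *)

Section PowerSeriesUniqueness.
Variable R : realType.
Local Notation H := (quat R).

(** The power series is continuous at 0, where its value is e 0. *)
Lemma real_series_head (e : nat -> R) :
  (forall r, 0 < r < 1 -> series (fun n => r ^+ n * e n) @ \oo --> (0 : R)) -> e 0%N = 0.
Proof.
move=> he.
have ps r : 0 < r < 1 -> pseries e r @ \oo --> (0 : R).
  move=> /he; rewrite /pseries.
  by have -> : (fun n => r ^+ n * e n) = (fun i => e i * r ^+ i)
    by apply/funext => n; rewrite mulrC.
have h2 : 0 < (2^-1 : R) < 1 by rewrite invr_gt0 ltr0n invf_lt1 ?ltr1n ?ltr0n.
have c2 : cvgn (pseries e 2^-1) by apply/cvg_ex; exists 0; exact: ps.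
have c3 : cvgn (pseries (fun i => `|e i|) 3^-1).
  apply: (is_cvg_pseries_inside_norm c2).
  by rewrite !ger0_norm ?invr_ge0// ltf_pV2 ?posrE// ltr_nat.
(* rescaling by 1/6 turns the radius of convergence into one above 1, as
   geombound_derive requires; 1/3 is a point of absolute convergence *)
pose e' n := e n * 6^-1 ^+ n.
have g' : geombound e' 2^-1.
  exists (limn (pseries (fun i => `|e i|) 3^-1)) => n.
  have p0 k : 0 <= `|e k| * 3^-1 ^+ k by rewrite mulr_ge0// exprn_ge0// invr_ge0.
  have := nnseries_le_lim n.+1 p0 c3.
  rewrite {1}/series/= big_nat_recr//= => h.
  have {h} h : `|e n| * 3^-1 ^+ n <= limn (pseries (fun i => `|e i|) 3^-1).
    by apply: le_trans h; rewrite lerDr sumr_ge0.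
  rewrite /e' normrM (@ger0_norm _ (6^-1 ^+ n)) ?exprn_ge0 ?invr_ge0//.
  have -> : 6^-1 = 3^-1 * 2^-1 :> R by rewrite -invfM -natrM.
  by rewrite exprMn mulrA ler_wpM2r// exprn_ge0// invr_ge0.
have h01 : 0 <= (2^-1 : R) < 1 by have /andP[h h'] := h2; rewrite h' ltW.
have [d0 _ _] := @geombound_derive R e' 2^-1 0 h01 g' ltac:(by rewrite lexx ler01).
have := der_continuous d0; rewrite /continuous_at => cont.
have lim0 : (fun n => pser e' n.+2%:R^-1) @ \oo --> pser e' 0.
  exact: (continuous_cvg _ cont (@cvg_invS2 R)).
have e0 : e 0%N = pser e' 0 by rewrite pser0 /e' expr0 mulr1.
rewrite e0 -(cvg_lim (@Rhausdorff R) lim0).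
apply/cvg_lim => //; rewrite (_ : (fun _ => _) = cst 0); first exact: cvg_cst.
apply/funext => n; apply/cvg_lim => //.
have r01 : 0 < (6^-1 * n.+2%:R^-1 : R) < 1.
  rewrite mulr_gt0 ?invr_gt0//= -invfM invf_lt1 ?mulr_gt0//.
  by rewrite -natrM ltr1n.
have -> : pseries e' n.+2%:R^-1 = pseries e (6^-1 * n.+2%:R^-1).
  by rewrite /pseries; congr series; apply/funext => k /=; rewrite /e' exprMn mulrA.
exact: ps.
Qed.

(** Once the constant term is 0, divide by r and repeat. *)
Lemma real_series_unique (e : nat -> R) :
  (forall r, 0 < r < 1 -> series (fun n => r ^+ n * e n) @ \oo --> (0 : R)) ->
  forall n, e n = 0.
Proof.
move=> he n; elim: n e he => [|n IH] e he; first exact: real_series_head.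
apply: (IH (fun k => e k.+1)) => r r01.
have e0 := real_series_head he.
have /andP[r0 _] := r01.
have := he r r01; rewrite -cvg_shiftS => /(cvgMl_tmp (a := r^-1)).
rewrite mulr0.
have -> // : (fun N => r^-1 * series (fun n => r ^+ n * e n) N.+1) =
   series (fun k => r ^+ k * e k.+1).
apply/funext => N; rewrite /series/= big_nat_recl// e0 mulr0 add0r mulr_sumr.
by apply: eq_bigr => k _; rewrite exprS; field; rewrite gt_eqF.
Qed.

(** Restrict to real points q and separate coordinates. *)
Lemma expansion_unique (f : H -> H) (c d : nat -> H) :
  expansion f c -> expansion f d -> c = d.
Proof.
move=> fc fd; apply/funext => n; apply/eqP; rewrite -subr_eq0; apply/eqP.
have realq (r : R) k : (r%:A : H) ^+ k = (r ^+ k)%:A.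
  by elim: k => [|k IH]; rewrite ?expr0 ?scale1r// !exprS IH -scalerAl mul1r scalerA.
have key r : 0 < r < 1 -> series (fun k => r ^+ k *: (c k - d k)) @ \oo --> (0 : H).
  move=> /andP[r0 r1].
  have qb : qball (r%:A : H).
    by rewrite /qball/= normrZ qnorm1 mulr1 gtr0_norm.
  have C := cvgB (fc _ qb) (fd _ qb); rewrite subrr in C.
  have -> : series (fun k => r ^+ k *: (c k - d k)) =
      (fun N => qpower_series c r%:A N - qpower_series d r%:A N); last exact: C.
  apply/funext => N; rewrite /qpower_series /series/= -sumrB.
  by apply: eq_bigr => k _; rewrite realq -!scalerAl !mul1r scalerBr.
by apply: quat_ext; [apply: (@real_series_unique (fun k => qre (c k - d k)))
  |apply: (@real_series_unique (fun k => qi (c k - d k)))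
  |apply: (@real_series_unique (fun k => qj (c k - d k)))
  |apply: (@real_series_unique (fun k => qk (c k - d k)))] => r r01;
  have [h1 h2 h3 h4] := quat_cvgP (key r r01); rewrite series_coord// in h1;
  rewrite series_coord// in h2; rewrite series_coord// in h3; rewrite series_coord// in h4.
Qed.

End PowerSeriesUniqueness.

(** * The Bargmann transform in Laguerre coefficients *)

Section BargmannExpansion.
Variable R : realType.
Local Notation H := (quat R).
Local Notation mu := (@lebesgue_measure R).
Local Notation pos := (@posline R).
Variables (al : R) (al0 : 0 < al).
Implicit Types (f g : R -> R) (x y t : R) (p q : H) (phi psi : R -> H) (c : H -> R).
Local Notation sq := (sqint mu pos).
Local Notation rw := (rootw al).
Local Notation L2a := (@L2 R al).

Let mpos := @measurable_posline R.

Definition qintg (g : R -> H) := [/\ intg mu pos (fun t => qre (g t)),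
  intg mu pos (fun t => qi (g t)), intg mu pos (fun t => qj (g t)) &
  intg mu pos (fun t => qk (g t))].

Lemma qintg_lin c (g : R -> H) : real_linear c -> qintg g ->
  intg mu pos (fun t => c (g t)) /\
  \int[mu]_(t in pos) c (g t) = c (qintegral pos g).
Proof.
move=> [k ck] [i1 i2 i3 i4].
have I1 := intgZ mpos (qre k) i1; have I2 := intgZ mpos (qi k) i2.
have I3 := intgZ mpos (qj k) i3; have I4 := intgZ mpos (qk k) i4.
have J := intgD mpos (intgD mpos (intgD mpos I1 I2) I3) I4.
split; first by apply: (intg_eq mpos _ J) => t _; rewrite ck.
rewrite ck /=; under eq_Rintegral do rewrite ck.
rewrite (RintegralD mpos (intgD mpos (intgD mpos I1 I2) I3) I4).
rewrite (RintegralD mpos (intgD mpos I1 I2) I3) (RintegralD mpos I1 I2).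
by congr (_ + _ + _ + _); apply: RintegralZl.
Qed.

Lemma qintg_mull p (g : R -> H) : qintg g ->
  qintg (fun t => p * g t) /\ qintegral pos (fun t => p * g t) = p * qintegral pos g.
Proof.
move=> ig; have [l1 l2 l3 l4] := real_linear_mull p.
have [a1 b1] := qintg_lin l1 ig; have [a2 b2] := qintg_lin l2 ig.
have [a3 b3] := qintg_lin l3 ig; have [a4 b4] := qintg_lin l4 ig.
by split; [split|apply: quat_ext].
Qed.

Lemma qintgD (g h : R -> H) : qintg g -> qintg h ->
  qintg (fun t => g t + h t) /\
  qintegral pos (fun t => g t + h t) = qintegral pos g + qintegral pos h.
Proof.
move=> [i1 i2 i3 i4] [j1 j2 j3 j4]; split.
  by split; apply: intgD.
by apply: quat_ext; apply: RintegralD.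
Qed.

Lemma qcvg_mull p (u : nat -> H) (l : H) : u @ \oo --> l -> (fun n => p * u n) @ \oo --> p * l.
Proof.
move=> ul; have H0 : (fun n => `|l - u n|) @ \oo --> (0 : R).
  by rewrite -(normr0 H) -(subrr l); apply: cvg_norm; apply: cvgB => //; exact: cvg_cst.
have H1 : (fun n => `|p| * `|l - u n|) @ \oo --> `|p| * 0 by exact: cvgMl_tmp.
apply/cvgrPdist_lt => e e0; move/cvgrPdist_lt : H1 => /(_ e e0).
by apply: filterS => n; rewrite mulr0 sub0r normrN -qnormM mulrBr normr_id.
Qed.

Lemma generating_qintegral phi x y : sqintq al phi -> x ^+ 2 + y ^+ 2 < 1 ->
  let U t := expR (gen_arg_re x y al t) * cos (gen_arg_im x y al t) in
  let V t := expR (gen_arg_re x y al t) * sin (gen_arg_im x y al t) in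
  [/\ qintg (fun t => U t *: (weight al t *: phi t)),
      qintg (fun t => V t *: (weight al t *: phi t)),
      series (fun n => (cpow x y n).1 *: qcoef al n phi) @ \oo -->
        qintegral pos (fun t => U t *: (weight al t *: phi t)) &
      series (fun n => (cpow x y n).2 *: qcoef al n phi) @ \oo -->
        qintegral pos (fun t => V t *: (weight al t *: phi t))].
Proof.
move=> [s1 s2 s3 s4] xy1 U V.
have [a1 b1 c1 d1] := generating_integral al0 s1 xy1.
have [a2 b2 c2 d2] := generating_integral al0 s2 xy1.
have [a3 b3 c3 d3] := generating_integral al0 s3 xy1.
have [a4 b4 c4 d4] := generating_integral al0 s4 xy1.
have wE (W : R -> R) c t : pos t ->
    W t * (rw t * rootcoord al c phi t) = W t * (weight al t * c (phi t)).
  by move=> pt; rewrite /rootcoord -rootw_sq//; ring.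
have I (W : R -> R) c : intg mu pos (fun t => W t * (rw t * rootcoord al c phi t)) ->
    intg mu pos (fun t => W t * (weight al t * c (phi t))).
  by apply: intg_eq => // t pt; exact: wE.
have E (W : R -> R) c : \int[mu]_(t in pos) (W t * (rw t * rootcoord al c phi t)) =
    \int[mu]_(t in pos) (W t * (weight al t * c (phi t))).
  by apply: eq_Rintegral => t /set_mem pt; exact: wE.
split.
- by split; apply: I.
- by split; apply: I.
- by rewrite !E in c1 c2 c3 c4; apply: quat_cvg; rewrite series_coord.
- by rewrite !E in d1 d2 d3 d4; apply: quat_cvg; rewrite series_coord.
Qed.

Definition bconst : R := (Num.sqrt (pi * gammaf al))^-1.

Lemma bconst_neq0 : bconst != 0.
Proof. by rewrite invr_eq0 gt_eqF// sqrtr_gt0 mulr_gt0 ?pi_gt0 ?gammaf_gt0. Qed.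

(** On the slice of q the kernel is U + V J with U and V real, by
    [kernel_slice], and q^n has the same J; so [generating_qintegral], applied
    to the real and imaginary parts, gives the expansion. The factors stay to
    the left of phi. *)
Theorem bargmann_expansion phi : L2a phi ->
  expansion (bargmann al phi) (fun n => bconst *: qcoef al n phi).
Proof.
move=> /L2_sqintq sp q; rewrite /qball/= => q1.
have [J hJ qE] := slice q.
set x := qre q in qE; set y := `|qim q| in qE.
have y0 : 0 <= y by exact: normr_ge0.
have xy1 : x ^+ 2 + y ^+ 2 < 1.
  have h : 0 <= x ^+ 2 + y ^+ 2 by rewrite addr_ge0 ?sqr_ge0.
  move: q1; rewrite qE norm_cq// -(ltr_pXn2r (n := 2)) ?nnegrE ?sqrtr_ge0//.
  by rewrite sqr_sqrtr// expr1n.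
pose U t := expR (gen_arg_re x y al t) * cos (gen_arg_im x y al t).
pose V t := expR (gen_arg_re x y al t) * sin (gen_arg_im x y al t).
pose GU t := U t *: (weight al t *: phi t).
pose GV t := V t *: (weight al t *: phi t).
have [IU IV CU CV] : [/\ qintg GU, qintg GV,
    series (fun n => (cpow x y n).1 *: qcoef al n phi) @ \oo --> qintegral pos GU &
    series (fun n => (cpow x y n).2 *: qcoef al n phi) @ \oo --> qintegral pos GV].
  exact: generating_qintegral.
set P := qpow (1 - q) (al + 1).
pose E t := qexp (t *: (q / (q - 1))).
have K t : P^-1 * E t = cq J (U t) (V t) by rewrite /P /E qE kernel_slice.
have P0 : P \is a GRing.unit.
  rewrite q_unit; apply/eqP => P0.
  have := congr1 (fun p => `|p|) (K 0); rewrite P0 invr0 mul0r normr0 norm_cq// => /esym/eqP.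
  rewrite sqrtr_eq0 /U /V leNgt => /negP; apply.
  rewrite !exprMn -mulrDr cos2Dsin2 mulr1 exprn_gt0//; exact: expR_gt0.
have [IVJ EV] := qintg_mull J IV.
have [IK EK] := qintgD IU IVJ.
have [_ EP] := qintg_mull P IK.
have -> : bargmann al phi q = bconst *: (qintegral pos GU + J * qintegral pos GV).
  rewrite /bargmann -/P -/bconst; congr (_ *: _).
  rewrite -EV -EK -[RHS](mulKr P0) -EP; congr (_ * qintegral _ _).
  apply/funext => t.
  have -> : qexp (t *: (q / (q - 1))) = P * cq J (U t) (V t) by rewrite -K mulVKr.
  rewrite -mulrA scalerAr; congr (P * _).
  rewrite /cq mulrDl scalerDr /GU /GV -!scalerAl mul1r.
  rewrite -!scalerAr !scalerA; congr (_ *: _ + _ *: _); exact: mulrC.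
have -> : qpower_series (fun n => bconst *: qcoef al n phi) q =
  (fun N => bconst *: (series (fun n => (cpow x y n).1 *: qcoef al n phi) N +
     J * series (fun n => (cpow x y n).2 *: qcoef al n phi) N)).
  apply/funext => N; rewrite /qpower_series /series/= mulr_sumr -big_split/= scaler_sumr.
  apply: eq_bigr => n _; rewrite qE cqX// -scalerAr; congr (_ *: _).
  by rewrite /cq mulrDl -!scalerAl mul1r scalerAr.
apply: cvgZl_tmp; apply: cvgD; first exact: CU.
exact: qcvg_mull CV.
Qed.

End BargmannExpansion.

Section Final.
Variable R : realType.
Local Notation H := (quat R).
Local Notation mu := (@lebesgue_measure R).
Local Notation pos := (@posline R).
Variables (al : R) (al0 : 0 < al).
Implicit Types (p q : H) (phi psi : R -> H).
Local Notation L2a := (@L2 R al).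

Lemma qconjM p q : qconj (p * q) = qconj q * qconj p.
Proof. by apply: quat_ext => /=; ring. Qed.

Lemma qconj_mull p : qconj p * p = (qnormsq p)%:A.
Proof. by apply: quat_ext => /=; rewrite /qnormsq; ring. Qed.

Lemma qconj_mulr p : p * qconj p = (qnormsq p)%:A.
Proof. by apply: quat_ext => /=; rewrite /qnormsq; ring. Qed.

Lemma qnorm_conj p : `|qconj p| = `|p|.
Proof. by rewrite !qnormE; congr Num.sqrt; rewrite /qnormsq /= !sqrrN. Qed.

Variables (theta : H) (th1 : `|theta| = 1).

Lemma norm_thn n : `|theta ^+ n| = 1. Proof. by rewrite qnormX th1 expr1n. Qed.

Lemma normsq_thn n : qnormsq (theta ^+ n) = 1.
Proof. by rewrite -qnorm_sq norm_thn expr1n. Qed.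

Lemma thn_conjl n : qconj (theta ^+ n) * theta ^+ n = 1.
Proof. by rewrite qconj_mull normsq_thn scale1r. Qed.

Lemma thn_conjr n : theta ^+ n * qconj (theta ^+ n) = 1.
Proof. by rewrite qconj_mulr normsq_thn scale1r. Qed.

Lemma qcoef_L2_eq phi psi : L2a phi -> L2a psi -> L2_eq phi psi ->
  forall n, qcoef al n phi = qcoef al n psi.
Proof.
move=> /L2_sqintq[s1 s2 s3 s4] /L2_sqintq[r1 r2 r3 r4] e n.
have [ml _] := sqint_poly al0 (laguerre al n).
have h (c : H -> R) : sqint mu pos (rootcoord al c phi) -> sqint mu pos (rootcoord al c psi) ->
    lagcoef al n (rootcoord al c phi) = lagcoef al n (rootcoord al c psi).
  move=> [m1 _] [m2 _]; rewrite /lagcoef ipC [RHS]ipC; apply: (ip_aeL (@measurable_posline R) m1 m2 ml).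
  by apply: (ae_imp _ e) => t + pt => /(_ pt); rewrite /rootcoord => ->.
by apply: quat_ext => /=; apply: h.
Qed.

Lemma coefs_bargmann phi : L2a phi ->
  coefs (bargmann al phi) = (fun n => bconst al *: qcoef al n phi).
Proof.
move=> sp; have e := bargmann_expansion al0 sp.
by rewrite /coefs; case: xgetP => [c _ ec|/(_ _ e)//]; exact: expansion_unique ec e.
Qed.

(** Unimodular factors do not change the weighted sum of squares of the
    coefficients. *)
Lemma theta_multiple phi : L2a phi ->
  exists2 chi, L2a chi & forall n, qcoef al n chi = theta ^+ n * qcoef al n phi.
Proof.
move=> sp; apply: (qriesz_fischer al0 (c := fun n => theta ^+ n * qcoef al n phi)).
rewrite (_ : (fun n => _) = (fun n => `|qcoef al n phi| ^+ 2 / lnorm al n)); first exact: qbessel.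
by apply/funext => n; rewrite qnormM norm_thn mul1r.
Qed.

(** Since coefficients are unique, Gamma_theta acts on A phi as multiplication
    of the coefficients by the powers of theta. *)
Lemma Gamma_bargmann phi chi : L2a phi -> L2a chi ->
  (forall n, qcoef al n chi = theta ^+ n * qcoef al n phi) ->
  forall q, qball q -> bargmann al chi q = Gamma_act theta (bargmann al phi) q.
Proof.
move=> sp sc hc q qb; rewrite /Gamma_act coefs_bargmann//.
have e := bargmann_expansion al0 sc qb.
rewrite -(cvg_lim _ e)//; congr (limn (qpower_series _ q)).
by apply/funext => n; rewrite hc -scalerAr.
Qed.

(** The inverse of A is specified only on the Bergman space, so membership of
    Gamma_theta A phi is needed for its preimage to be selected. *)
Lemma bergman_Gamma phi chi : L2a phi -> L2a chi ->
  (forall n, qcoef al n chi = theta ^+ n * qcoef al n phi) ->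
  bergman al (Gamma_act theta (bargmann al phi)).
Proof.
move=> sp sc hc; exists (fun n => bconst al *: qcoef al n chi).
  have := is_cvg_seriesZ (k := bconst al ^+ 2) (qbessel al0 sc).
  set u := _ *: _; have -> // : u = (fun n => n`!%:R / gammaf (al + n%:R + 1) *
    `|bconst al *: qcoef al n chi| ^+ 2).
  apply/funext => n; rewrite /u !fctE normrZ exprMn real_normK ?num_real//.
  by rewrite /lnorm invf_div /GRing.scale/=; ring.
move=> q qb; rewrite -(Gamma_bargmann sp sc hc qb); exact: bargmann_expansion.
Qed.

(** The function chi of [theta_multiple] is a preimage of Gamma_theta A phi;
    the one that the inverse selects has the same expansion, hence the same
    coefficients. *)
Lemma Ltheta_spec phi : L2a phi -> L2a (Ltheta al theta phi) /\
  forall n, qcoef al n (Ltheta al theta phi) = theta ^+ n * qcoef al n phi.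
Proof.
move=> sp; have [chi sc hc] := theta_multiple sp.
rewrite /Ltheta /bargmann_inv; case: xgetP => [psi _ [_ sT hT]|/(_ chi)]; last first.
  by case; split => //; [exact: bergman_Gamma sp sc hc|exact: Gamma_bargmann].
split => // n; rewrite -hc.
have e1 := bargmann_expansion al0 sT; have e2 := bargmann_expansion al0 sc.
have e3 : expansion (bargmann al psi) (fun n => bconst al *: qcoef al n chi).
  by move=> q qb; rewrite hT// -(Gamma_bargmann sp sc hc qb); exact: e2.
have := congr1 (@^~ n) (expansion_unique e1 e3) => /=.
by apply: scalerI; exact: bconst_neq0.
Qed.

(** Coefficients determine a function up to equality almost everywhere, and
    inner products by Parseval, so each clause can be checked on them; there it
    follows from conj (theta^n) theta^n = theta^n conj (theta^n) = 1. *)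
Lemma diagonal_unitary (T : (R -> H) -> R -> H) :
  (forall phi, L2a phi -> L2a (T phi) /\ forall n, qcoef al n (T phi) = theta ^+ n * qcoef al n phi) ->
  unitary al T.
Proof.
move=> TP; split.
- by move=> phi /TP[].
- move=> phi psi sp sq e; have [s1 h1] := TP _ sp; have [s2 h2] := TP _ sq.
  by apply: (qcoef_unique al0 s1 s2) => n; rewrite h1 h2 (qcoef_L2_eq sp sq e).
- move=> phi psi a b sp sq; have [s1 h1] := TP _ sp; have [s2 h2] := TP _ sq.
  have lin u v : L2a u -> L2a v -> L2a (fun t => u t * a + v t * b) /\
      forall n, qcoef al n (fun t => u t * a + v t * b) = qcoef al n u * a + qcoef al n v * b.
    move=> /L2_sqintq su /L2_sqintq sv; have sua := sqintqM a su; have svb := sqintqM b sv.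
    split; first exact/L2_sqintq/sqintqD.
    by move=> n; rewrite qcoefD// !qcoefM.
  have [s3 h3] := lin _ _ sp sq; have [s4 h4] := lin _ _ s1 s2.
  have [s5 h5] := TP _ s3.
  by apply: (qcoef_unique al0 s5 s4) => n; rewrite h5 h4 h3 h1 h2 mulrDr !mulrA.
- move=> phi psi sp sq; have [s1 h1] := TP _ sp; have [s2 h2] := TP _ sq.
  have c1 := qparseval al0 s1 s2; have c2 := qparseval al0 sp sq.
  rewrite -(cvg_lim (@norm_hausdorff _ H) c1) -(cvg_lim (@norm_hausdorff _ H) c2).
  congr (limn (series _)).
  apply/funext => n; rewrite h1 h2 qconjM mulrA -(mulrA (qconj (qcoef al n phi))).
  by rewrite thn_conjl mulr1.
- move=> psi sp.
  have [phi sf hf] : exists2 phi, L2a phi &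
      forall n, qcoef al n phi = qconj (theta ^+ n) * qcoef al n psi.
    apply: (qriesz_fischer al0 (c := fun n => qconj (theta ^+ n) * qcoef al n psi)).
    rewrite (_ : (fun n => _) = (fun n => `|qcoef al n psi| ^+ 2 / lnorm al n)); first exact: qbessel.
    by apply/funext => n; rewrite qnormM qnorm_conj norm_thn mul1r.
  exists phi => //; have [s1 h1] := TP _ sf.
  by apply: (qcoef_unique al0 s1 sp) => n; rewrite h1 hf mulrA thn_conjr mul1r.
Qed.

End Final.

Theorem corollary3p2 (R : realType) (alpha : R) (theta : quat R)
    (alpha_gt0 : 0 < alpha) (theta_norm : `|theta| = 1) :
  unitary alpha (Ltheta alpha theta).
Proof. by apply: (diagonal_unitary alpha_gt0 theta_norm) => phi /(Ltheta_spec alpha_gt0 theta_norm). Qed.
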